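(* Let $R$ be a standard graded $\mathsf{k}$-algebra over an infinite field $\mathsf{k}$, and let $M$ be a finitely generated graded $R$-module that is pure of type $\mathbf{d}=(d_0,\dots,d_p)$. Write $\beta_{i,j}=\beta^R_{i,j}(M)$. Then the following are equivalent: (i) $\operatorname{cmd}(M)=\operatorname{cmd}(R)$; (ii) $\operatorname{codim}(M)=\operatorname{pdim}_R(M)$; (iii) $\sum_{i=0}^p(-1)^i d_i^{\,l}\,\beta_{i,d_i}=0$ for $l=0,\dots,p-1$; (iv) $\beta^R(M)=\beta^R_0(M)\,\pi(\mathbf{d})$, i.e. $\beta^R_{i,j}(M)=\beta^R_0(M)\,\pi(\mathbf{d})_{i,j}$ for all $0\le i\le p$ and $j\in\mathbb{Z}$; (v) $\beta^R(M)=\beta^R_p(M)\,\pi'(\mathbf{d})$, i.e. $\beta^R_{i,j}(M)=\beta^R_p(M)\,\pi'(\mathbf{d})_{i,j}$ for all $0\le i\le p$ and $j\in\mathbb{Z}$.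
   Context: A standard graded $\mathsf{k}$-algebra is a graded ring $R=\bigoplus_{i\ge 0}R_i$ with $R_0=\mathsf{k}$, generated as a $\mathsf{k}$-algebra by finitely many elements of degree $1$. For a finitely generated graded module $M\ne 0$, $\operatorname{cmd}(M)=\dim(M)-\operatorname{depth}(M)$ (depth with respect to the homogeneous maximal ideal), $\operatorname{codim}(M)=\dim(R)-\dim(M)$, and $\operatorname{pdim}_R(M)$ is the projective dimension. The graded Betti numbers are $\beta^R_{i,j}(M)=\dim_{\mathsf{k}}(\operatorname{Tor}^R_i(M,\mathsf{k})_j)$, the total Betti numbers are $\beta^R_i(M)=\dim_{\mathsf{k}}\operatorname{Tor}^R_i(\mathsf{k},M)=\sum_j\beta^R_{i,j}(M)$, and $\beta^R(M)$ denotes the table $(\beta^R_{i,j}(M))_{i,j}$. The module $M$ is pure if for each $i$ there is at most one $j$ with $\beta^R_{i,j}(M)\neq 0$. It is pure of type $\mathbf{d}=(d_0,\dots,d_p)$ if it is pure, has finite projective dimension $p$, and $\beta^R_{i,d_i}(M)\neq 0$ for $0\le i\le p$ (then automatically $d_0<d_1<\dots<d_p$). For $\mathbf{d}=(d_0<\dots<d_p)$, $0\le i\le p$ and $j\in\mathbb{Z}$, the pure diagrams are $$\pi(\mathbf{d})_{i,j}=\begin{cases}\prod_{0\le k\le p,\ k\neq i,0}\left|\frac{d_k-d_0}{d_k-d_i}\right| & j=d_i\\ 0 & j\neq d_i\end{cases},\qquad \pi'(\mathbf{d})_{i,j}=\begin{cases}\prod_{0\le k\le p,\ k\neq i,p}\left|\frac{d_k-d_p}{d_k-d_i}\right|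 & j=d_i\\ 0 & j\neq d_i\end{cases}.$$ Empty products equal $1$, and $0^0=1$. *)

(* Defs.v *)
From HB Require Import structures.
From mathcomp Require Import all_boot all_order all_algebra.
From mathcomp Require Import ring_quotient.
From mathcomp Require Import boolp classical_sets cardinality.

Set Implicit Arguments.
Unset Strict Implicit.
Unset Printing Implicit Defensive.

Import Order.TTheory GRing.Theory Num.Theory.
Local Open Scope classical_set_scope.
Local Open Scope ring_scope.

(* The largest element of P; junk value 0 if P is empty or unbounded. *)
Definition max_nat (P : set nat) : nat :=
  xget 0%N [set n | P n /\ forall m, P m -> (m <= n)%N].

(** Gradings *)

Definition internal_direct_sum (I : eqType) (V : zmodType)
    (A : I -> {pred V}) : Prop :=
  [/\ forall i, zmod_closed (A i),
      forall v, exists (s : seq I) (f : I -> V),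
        (forall i, f i \in A i) /\ v = \sum_(i <- s) f i
    & forall (s : seq I) (f : I -> V), uniq s -> (forall i, f i \in A i) ->
        \sum_(i <- s) f i = 0 -> {in s, forall i, f i = 0}].

(* k -> R is injective because a comAlgType is a nontrivial ring, so the third
   clause identifies R_0 with k. *)
Definition standard_graded (k : fieldType) (R : comAlgType k)
    (gR : nat -> {pred R}) : Prop :=
  [/\ internal_direct_sum gR,
      forall i j x y, x \in gR i -> y \in gR j -> x * y \in gR (i + j)%N,
      forall x, x \in gR 0%N <-> exists c : k, x = c%:A
    & exists s : seq R, {subset s <= gR 1%N} /\
        forall S : {pred R}, subalg_closed S -> {subset s <= S} ->
          forall x, x \in S].

Definition graded_module (k : fieldType) (R : comAlgType k)
    (gR : nat -> {pred R}) (M : lmodType R) (gM : int -> {pred M}) : Prop :=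
  internal_direct_sum gM /\
  forall i j x m, x \in gR i -> m \in gM j -> x *: m \in gM (i%:Z + j).

Definition fin_gen (R : nzRingType) (M : lmodType R) : Prop :=
  exists (n : nat) (g : 'I_n -> M),
    forall m, exists c : 'I_n -> R, m = \sum_i c i *: g i.

(* R_z for z in Z, with R_z = 0 for z < 0 *)
Definition zgrade (R : nzRingType) (gR : nat -> {pred R}) (z : int) : {pred R} :=
  if z is Posz n then gR n else pred1 0.

(* the homogeneous maximal ideal R_1 + R_2 + ... *)
Definition irrelevant (R : nzRingType) (gR : nat -> {pred R}) : set R :=
  [set x | exists (n : nat) (f : nat -> R),
     (forall i, f i \in gR i.+1) /\ x = \sum_(i < n) f i].

(* the projection R -> R / irrelevant = k *)
Definition residue (k : fieldType) (R : comAlgType k) (gR : nat -> {pred R})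
    (x : R) : k :=
  xget 0 [set c : k | irrelevant gR (x - c%:A)].

(** Dimension and depth *)

(* p 0 < ... < p n is a chain of prime ideals containing the annihilator
   of M. *)
Definition prime_chain (R : comNzRingType) (M : lmodType R) (n : nat)
    (p : nat -> {pred R}) : Prop :=
  [/\ forall i, (i <= n)%N -> idealr_closed (p i) /\ prime_idealr_closed (p i),
      forall i x, (i <= n)%N -> (forall m : M, x *: m = 0) -> x \in p i
    & forall i, (i < n)%N ->
        {subset p i <= p i.+1} /\ ~ {subset p i.+1 <= p i}].

Definition kdim (R : comNzRingType) (M : lmodType R) : nat :=
  max_nat [set n | exists p, @prime_chain R M n p].

(* the submodule (s_0, s_1, ...) M *)
Definition seq_mul (R : nzRingType) (M : lmodType R) (s : seq R) : set M :=
  [set m | exists f : nat -> M, m = \sum_(i < size s) s`_i *: f i].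

Definition regular_seq (R : comNzRingType) (M : lmodType R) (s : seq R) : Prop :=
  (forall i (m : M), (i < size s)%N ->
     seq_mul (take i s) (s`_i *: m) -> seq_mul (take i s) m) /\
  exists m : M, ~ seq_mul s m.

Definition depth (R : comNzRingType) (gR : nat -> {pred R}) (M : lmodType R) :
    nat :=
  max_nat [set n | exists s : seq R,
    [/\ size s = n, forall x, x \in s -> irrelevant gR x & regular_seq M s]].

Definition cmd (R : comNzRingType) (gR : nat -> {pred R}) (M : lmodType R) :
    int :=
  (kdim M)%:Z - (depth gR M)%:Z.

Definition codim (R : comNzRingType) (M : lmodType R) : int :=
  (kdim R^o)%:Z - (kdim M)%:Z.

(** Projective dimension *)

Definition projective (R : nzRingType) (P : lmodType R) : Prop :=
  forall (A B : lmodType R) (f : {linear A -> B}) (g : {linear P -> B}),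
    (forall b, exists a, f a = b) ->
    exists h : {linear P -> A}, forall x, f (h x) = g x.

Definition has_proj_resolution (R : nzRingType) (M : lmodType R) (n : nat) :
    Prop :=
  exists (P : nat -> lmodType R) (d : forall i, {linear P i.+1 -> P i})
         (e : {linear P 0%N -> M}),
    [/\ forall i, projective (P i),
        forall m, exists x, e x = m,
        forall x, e x = 0 <-> exists y, d 0%N y = x,
        forall i x, d i x = 0 <-> exists y, d i.+1 y = x
      & forall i, (n < i)%N -> forall x : P i, x = 0].

Definition is_pdim (R : nzRingType) (M : lmodType R) (n : nat) : Prop :=
  has_proj_resolution M n /\
  forall m, has_proj_resolution M m -> (n <= m)%N.

(* junk value 0 if the projective dimension is infinite *)
Definition pdim (R : nzRingType) (M : lmodType R) : nat := xget 0%N (is_pdim M).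

(** Graded Betti numbers *)

(* F_i is the direct sum of the R(- shift i a), a < rk i, seen as row vectors;
   F_(i+1) -> F_i is v |-> v *m diff i, and F_0 -> M sends the b-th basis
   vector to aug b.  No minimality is assumed. *)
Record free_resolution (k : fieldType) (R : comAlgType k)
    (gR : nat -> {pred R}) (M : lmodType R) (gM : int -> {pred M}) :=
  FreeResolution {
    rk : nat -> nat;
    shift : forall i, 'I_(rk i) -> int;
    diff : forall i, 'M[R]_(rk i.+1, rk i);
    aug : 'I_(rk 0) -> M;
    diff_homogeneous : forall i a b,
      diff i a b \in zgrade gR (shift a - shift b);
    aug_homogeneous : forall b, aug b \in gM (shift b);
    aug_surjective : forall m, exists v : 'rV[R]_(rk 0),
      m = \sum_b v 0 b *: aug b;
    aug_exact : forall v : 'rV[R]_(rk 0),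
      \sum_b v 0 b *: aug b = 0 <-> exists w, v = w *m diff 0%N;
    diff_exact : forall i (v : 'rV[R]_(rk i.+1)),
      v *m diff i = 0 <-> exists w, v = w *m diff i.+1
  }.

Section Tor.
Variables (k : fieldType) (R : comAlgType k) (gR : nat -> {pred R}).
Variables (M : lmodType R) (gM : int -> {pred M}) (F : free_resolution gR gM).

(* The complex F (x) k has the terms k^(rk i) and the differentials tdiff i. *)
Definition tdiff (i : nat) : 'M[k]_(rk F i.+1, rk F i) :=
  map_mx (residue gR) (diff F i).

(* Its row space is the degree j part of F_i (x) k. *)
Definition strand (i : nat) (j : int) : 'M[k]_(rk F i) :=
  diag_mx (\row_a (shift a == j)%:R).

Definition cycles (i : nat) : 'M[k]_(rk F i) :=
  match i with 0%N => 1%:M | i'.+1 => kermx (tdiff i') end.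

(* the k-dimension of H_i(F (x) k)_j *)
Definition tor_dim (i : nat) (j : int) : nat :=
  (\rank (strand i j :&: cycles i)%MS - \rank (strand i.+1 j *m tdiff i))%N.

(* the k-dimension of H_i(F (x) k) *)
Definition total_tor_dim (i : nat) : nat :=
  (\rank (cycles i) - \rank (tdiff i))%N.

End Tor.

(* Tor does not depend on the resolution F, and F exists when M is a finitely
   generated graded module over a standard graded algebra. *)
Definition betti (k : fieldType) (R : comAlgType k) (gR : nat -> {pred R})
    (M : lmodType R) (gM : int -> {pred M}) (i : nat) (j : int) : nat :=
  xget 0%N [set b | exists F : free_resolution gR gM, b = tor_dim F i j].

Definition total_betti (k : fieldType) (R : comAlgType k)
    (gR : nat -> {pred R}) (M : lmodType R) (gM : int -> {pred M}) (i : nat) :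
    nat :=
  xget 0%N [set b | exists F : free_resolution gR gM, b = total_tor_dim F i].

Definition pure (k : fieldType) (R : comAlgType k) (gR : nat -> {pred R})
    (M : lmodType R) (gM : int -> {pred M}) : Prop :=
  forall i j1 j2, betti gR gM i j1 <> 0%N -> betti gR gM i j2 <> 0%N -> j1 = j2.

Definition pure_of_type (k : fieldType) (R : comAlgType k)
    (gR : nat -> {pred R}) (M : lmodType R) (gM : int -> {pred M})
    (p : nat) (d : 'I_p.+1 -> int) : Prop :=
  [/\ pure gR gM, is_pdim M p & forall i : 'I_p.+1, betti gR gM i (d i) <> 0%N].

(** Pure diagrams *)

Definition pure_diagram (p : nat) (d : 'I_p.+1 -> int) (i : 'I_p.+1) (j : int) :
    rat :=
  if j == d i then
    \prod_(l < p.+1 | (l != i) && (l != ord0))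
      `| (d l - d ord0)%:~R / (d l - d i)%:~R |
  else 0.

Definition pure_diagram' (p : nat) (d : 'I_p.+1 -> int) (i : 'I_p.+1)
    (j : int) : rat :=
  if j == d i then
    \prod_(l < p.+1 | (l != i) && (l != ord_max))
      `| (d l - d ord_max)%:~R / (d l - d i)%:~R |
  else 0.

(* Main.v *)
(* By pureness the minimal graded free resolution F of M has all generators of
   F_i in degree d_i, so beta_{i,d_i} is the rank of F_i.

   (i) <-> (ii) is the Auslander-Buchsbaum formula.  Depth is read off Koszul
   cohomology: it drops by one modulo a regular element, and rises by one from
   a module to its syzygy because the differentials of F have entries in the
   maximal ideal.  Regular sequences of full length exist because a module
   without socle has a regular linear form over an infinite field.

   (ii) <-> (iii) compares Hilbert polynomials.  The Krull dimension of R / I is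
   the degree of the polynomial giving dim_k (R / I)_{< n}: noetherian induction
   produces a chain of primes of that length, and a Gelfand-Kirillov growth
   estimate bounds all chains.  Additivity along F expresses the polynomial of M
   as an alternating sum of shifts of that of R; by Taylor's formula its degree
   drops by the least l with sum_i (-1)^i d_i^l beta_i <> 0.

   (iii) <-> (iv), (v) is Vandermonde: pairing the moments with the polynomial
   prod_{k <> i, z} (X - d_k) leaves only the terms i and z. *)
From HB Require Import structures.
Require Import Defs.
From mathcomp Require Import all_boot all_order all_algebra.
From mathcomp Require Import ring_quotient.
From mathcomp Require Import boolp classical_sets cardinality.
From mathcomp Require Import zify ring lra.

Set Implicit Arguments.
Unset Strict Implicit.
Unset Printing Implicit Defensive.

Import Order.TTheory GRing.Theory Num.Theory.
Local Open Scope classical_set_scope.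
Local Open Scope ring_scope.

(** * Noetherian modules *)

(** Quotient modules are never formed. A module with [b] generators is [R^b] together with a
    submodule [N], so regularity, Koszul cohomology and [k]-dimension are stated for vectors modulo
    a set, and chain maps and homotopies become explicit matrices. Krull dimension quantifies over
    arbitrary prime chains, while Hilbert functions are used for homogeneous ideals. Both sides of
    the gap are closed: the noetherian induction stays among homogeneous ideals, where primality
    need only be tested on homogeneous elements, and the growth estimate asks for no homogeneity of
    the primes in the chain. [kdim M] is defined through the annihilator, whereas the resolution
    measures [M] itself. The two Hilbert functions bound each other up to the factor [rk F 0], which
    leaves the degree of the polynomial unchanged. The [d_i] may be negative, but degrees of [R] are
    natural numbers. They enter as [e_i = d_i - d_0]; an affine substitution carries the vanishing
    of an initial segment of moments from [d_i] to [- e_i] and back. *)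

Lemma seq_choice (T : Type) (P : seq T -> T -> Prop) :
  (forall s, exists x, P s x) ->
  exists a : nat -> T, forall n, P (mkseq a n) (a n).
Proof.
move=> hP.
have [f hf] := choice hP.
(* Iterating on the list of choices, and not on the last choice, lets each step refer to all earlier
   ones. *)
pose hist n := iter n (fun s => rcons s (f s)) [::].
exists (fun n => f (hist n)) => n.
suff -> : mkseq (fun n => f (hist n)) n = hist n by [].
by elim: n => [//|n IHn]; rewrite mkseqS IHn.
Qed.

Section Span.
Variables (R : nzRingType) (E : lmodType R).
Implicit Types (N : set E) (s t : seq E).

Definition submodset N := N 0 /\ forall a u v, N u -> N v -> N (a *: u + v).

Definition lspan s : set E :=
  [set v | exists c : nat -> R, v = \sum_(i < size s) c i *: s`_i].

(** The ascending chain condition in terms of elements: the spans of initial segments cannot grow at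
    every step. In this form it passes to extensions and polynomial rings without chains of
    submodules. *)
Definition noetherian := forall a : nat -> E, exists n, lspan (mkseq a n) (a n).

Lemma submodsetD N u v : submodset N -> N u -> N v -> N (u + v).
Proof. by move=> [_ hN] hu hv; rewrite -[u]scale1r; apply: hN. Qed.

Lemma submodsetZ N a u : submodset N -> N u -> N (a *: u).
Proof. by move=> [h0 hN] hu; rewrite -[_ *: _]addr0; apply: hN. Qed.

Lemma submodsetN N u : submodset N -> N u -> N (- u).
Proof. by move=> hN hu; rewrite -scaleN1r; apply: submodsetZ. Qed.

Lemma submodsetB N u v : submodset N -> N u -> N v -> N (u - v).
Proof. by move=> hN hu hv; apply: submodsetD => //; apply: submodsetN. Qed.

Lemma submodset_sum N (I : Type) (r : seq I) (P : pred I) (F : I -> E) :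
  submodset N -> (forall i, P i -> N (F i)) -> N (\sum_(i <- r | P i) F i).
Proof.
move=> hN hF; elim/big_rec: _ => [|i x Pi hx]; first by case: hN.
by apply: submodsetD => //; apply: hF.
Qed.

Lemma submodset_subl N u v : submodset N -> N v -> N (u + v) -> N u.
Proof. by move=> hN hv h; rewrite -(addrK v u); apply: submodsetB. Qed.

Lemma submodset0 : submodset [set 0].
Proof. by split=> [//|a u v -> ->]; rewrite scaler0 addr0. Qed.

Lemma lspan_submod s : submodset (lspan s).
Proof.
split=> [|a _ _ [c ->] [c' ->]].
  by exists (fun=> 0); rewrite big1 // => i _; rewrite scale0r.
exists (fun i => a * c i + c' i); rewrite scaler_sumr -big_split /=.
by apply: eq_bigr => i _; rewrite scalerDl scalerA.
Qed.

Lemma lspan0 s : lspan s 0.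
Proof. by case: (lspan_submod s). Qed.

Lemma lspan_mem s x : x \in s -> lspan s x.
Proof.
move=> /(nthP 0) [i hi <-]; exists (fun j => (j == i)%:R).
rewrite (bigD1 (Ordinal hi)) //= eqxx scale1r big1 ?addr0 // => j hj.
by rewrite -val_eqE /= in hj; rewrite (negPf hj) scale0r.
Qed.

Lemma lspan_min N s : submodset N -> (forall x, x \in s -> N x) -> lspan s `<=` N.
Proof.
move=> hN hs _ [c ->]; apply: submodset_sum => // i _.
by apply: submodsetZ => //; apply/hs/mem_nth.
Qed.

Lemma lspan_sub s t : {subset s <= t} -> lspan s `<=` lspan t.
Proof.
by move=> st; apply: lspan_min => [|x /st]; [apply: lspan_submod|apply: lspan_mem].
Qed.

Lemma mkseq_subset (a : nat -> E) m n :
  (m <= n)%N -> {subset mkseq a m <= mkseq a n}.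
Proof.
move=> mn x /mapP [i]; rewrite mem_iota /= add0n => hi ->.
by apply/map_f; rewrite mem_iota /= add0n (leq_trans hi).
Qed.

Lemma mkseq_mem (a : nat -> E) i n : (i < n)%N -> a i \in mkseq a n.
Proof. by move=> hi; apply/map_f; rewrite mem_iota. Qed.

Lemma noetherian_fg N : noetherian -> submodset N ->
  exists s, (forall x, x \in s -> N x) /\ N `<=` lspan s.
Proof.
move=> hE hN; apply: contrapT => hs.
pose P s x := (forall y, y \in s -> N y) -> N x /\ ~ lspan s x.
have /seq_choice [a ha] : forall s, exists x, P s x.
  move=> s; have [hsN|hsN] := pselect (forall y, y \in s -> N y); last by exists 0.
  have [x [Nx nx]] : exists x, N x /\ ~ lspan s x.
    apply: contrapT => hx; apply: hs; exists s; split=> // x Nx.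
    by apply: contrapT => nx; apply: hx; exists x.
  by exists x.
have hN' n : forall y, y \in mkseq a n -> N y.
  elim: n => [//|n IHn] y; rewrite mkseqS mem_rcons inE => /orP [/eqP ->|/IHn //].
  by case: (ha n IHn).
have [n hn] := hE a.
by case: (ha n (hN' n)).
Qed.

(** Without a maximal member above [N0] every member has a strictly larger one; the elements gained
    at the enlargements form a sequence that contradicts [noetherian]. *)
Lemma noetherian_max (F : set (set E)) N0 : noetherian ->
  (forall N, F N -> submodset N) -> F N0 ->
  exists N, [/\ F N, N0 `<=` N & forall N', F N' -> N `<=` N' -> N' `<=` N].
Proof.
move=> hE hF FN0; apply: contrapT => hmax.
have step (N : {N | F N /\ N0 `<=` N}) : exists N' : {N | F N /\ N0 `<=` N},
    sval N `<=` sval N' /\ exists x, sval N' x /\ ~ sval N x.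
  case: N => N [FN hN] /=; apply: contrapT => hN'; apply: hmax; exists N; split=> //.
  move=> N' FN' NN' x N'x; apply: contrapT => Nx; apply: hN'.
  by exists (exist _ N' (conj FN' (subset_trans hN NN'))); split=> //; exists x.
have [f hf] := choice step.
pose c n : {N | F N /\ N0 `<=` N} := iter n f (exist _ N0 (conj FN0 (@subset_refl _ N0))).
have /choice [a ha] : forall n, exists x, sval (c n.+1) x /\ ~ sval (c n) x.
  by move=> n; case: (hf (c n)).
have mono m n : (m <= n)%N -> sval (c m) `<=` sval (c n).
  elim: n => [|n IHn]; first by rewrite leqn0 => /eqP ->.
  rewrite leq_eqVlt => /orP [/eqP -> //|]; rewrite ltnS => /IHn h.
  by apply: (subset_trans h); case: (hf (c n)).
have [n hn] := hE a.
case: (ha n) => _; apply.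
apply: lspan_min hn => [|x]; first by apply: hF; case: (svalP (c n)).
move=> /mapP [i]; rewrite mem_iota /= add0n => hi ->.
by apply: (mono i.+1) => //; case: (ha i).
Qed.

(* The sequence is thinned out to one whose image under [f] vanishes modulo
   earlier terms. *)
Lemma noetherian_ext (A : lmodType R) (f : {linear E -> A}) :
  (forall b : nat -> A, exists n (c : nat -> R), b n = \sum_(i < n) c i *: b i) ->
  (forall a : nat -> E, (forall n, f (a n) = 0) -> exists n, lspan (mkseq a n) (a n)) ->
  noetherian.
Proof.
move=> hA hK a.
have hA' m : exists n x, [/\ (m <= n)%N, lspan (mkseq a n) x & f (a n - x) = 0].
  have [n [c hn]] := hA (fun i => f (a (m + i)%N)).
  exists (m + n)%N, (\sum_(i < n) c i *: a (m + i)%N); split; first exact: leq_addr.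
    apply: submodset_sum => [|i _]; first exact: lspan_submod.
    apply: submodsetZ; first exact: lspan_submod.
    by apply/lspan_mem/mkseq_mem; rewrite ltn_add2l.
  rewrite linearB linear_sum hn; apply/eqP; rewrite subr_eq0; apply/eqP.
  by apply: eq_bigr => i _; rewrite linearZ.
have [g hg] := choice hA'.
have [y hy] := choice hg.
pose t i := iter i (fun m => (g m).+1) 0%N.
have tmono i j : (i <= j)%N -> (t i <= t j)%N.
  elim: j => [|j IHj]; first by rewrite leqn0 => /eqP ->.
  rewrite leq_eqVlt => /orP [/eqP -> //|]; rewrite ltnS => /IHj h.
  by rewrite /=; apply: (leq_trans h); case: (hy (t j)) => /leqW.
have [i|n hn] := hK (fun i => a (g (t i)) - y (t i)); first by case: (hy (t i)).
exists (g (t n)).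
have [_ hyn _] := hy (t n).
rewrite -(subrK (y (t n)) (a _)); apply: submodsetD => //; first exact: lspan_submod.
apply: lspan_min hn => [|x]; first exact: lspan_submod.
move=> /mapP [i]; rewrite mem_iota /= add0n => hi ->.
have hig : (g (t i) < g (t n))%N.
  case: (hy (t n)) => h _ _; apply: leq_trans h.
  exact: (tmono i.+1 n hi).
apply: submodsetB; first exact: lspan_submod.
  exact/lspan_mem/mkseq_mem.
case: (hy (t i)) => _ h _; apply: lspan_sub h.
exact/mkseq_subset/ltnW.
Qed.

End Span.

(** The extension principle for the first coordinate: on vectors where it vanishes, deleting it
    loses nothing, so the induction hypothesis applies. *)
Lemma noetherian_rV (R : nzRingType) b :
  noetherian R^o -> noetherian 'rV[R]_b.
Proof.
move=> hR; elim: b => [|b IHb].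
  by move=> a; exists 0%N; rewrite [a _]thinmx0; apply: lspan0.
pose f (v : 'rV[R]_b.+1) : R^o := v 0 ord0.
have lf : linear f by move=> c u v; rewrite /f !mxE.
pose F : {linear 'rV[R]_b.+1 -> R^o} := HB.pack f (GRing.isLinear.Build _ _ _ _ _ lf).
apply: (noetherian_ext (f := F)).
  move=> c; have [n [e]] := hR c; rewrite size_mkseq => he; exists n, e.
  by rewrite he; apply: eq_bigr => i _; rewrite nth_mkseq.
move=> a ha; have [n [e]] := IHb (fun n => col' ord0 (a n)).
rewrite size_mkseq => he; exists n, e; rewrite size_mkseq.
apply/rowP => j; rewrite summxE.
have [->|] := eqVneq j ord0.
  rewrite [LHS]ha big1 // => i _; rewrite nth_mkseq // !mxE.
  by have := ha i; rewrite /= /f => ->; rewrite mulr0.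
rewrite eq_sym => hj; have [j' -> _] := unlift_some hj.
have /rowP/(_ j') := he; rewrite summxE !mxE => ->.
by apply: eq_bigr => i _; rewrite !nth_mkseq // !mxE.
Qed.

Lemma noetherian_field (k : fieldType) : noetherian k^o.
Proof.
move=> a; have [h|h] := eqVneq (a 0%N) 0.
  by exists 0%N; rewrite h; apply: lspan0.
exists 1%N, (fun=> a 1%N / a 0%N); rewrite big_ord_recl big_ord0 addr0 /=.
by rewrite [_ *: _](divfK h).
Qed.

Lemma noetherian_surj (A R : nzRingType) (f : {rmorphism A -> R}) :
  (forall x, exists y, f y = x) -> noetherian A^o -> noetherian R^o.
Proof.
move=> hf hA b; have [g hg] := choice hf.
have [n [c]] := hA (fun i => g (b i)); rewrite size_mkseq => hn.
exists n, (fun i => f (c i)); rewrite size_mkseq -[b n]hg hn rmorph_sum.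
by apply: eq_bigr => i _; rewrite !nth_mkseq // [c i *: _]/GRing.scale /= rmorphM hg.
Qed.

(* Hilbert's argument: choose [f n] of minimal size outside the ideal of the
   previous choices; a linear relation among the leading coefficients then
   produces an element of smaller size. *)
Lemma noetherian_poly (A : comNzRingType) : noetherian A^o -> noetherian {poly A}^o.
Proof.
move=> hA a; apply: contrapT => ha.
have ha' n : ~ lspan (mkseq a n) (a n) by move=> h; apply: ha; exists n.
pose I : set {poly A}^o := [set x | exists n, lspan (mkseq a n) x].
have hI : submodset I.
  split=> [|c u v [m hu] [n hv]]; first by exists 0%N; apply: lspan0.
  exists (maxn m n); apply: submodsetD; first exact: lspan_submod.
    apply: submodsetZ; first exact: lspan_submod.
    by apply: lspan_sub hu; apply: mkseq_subset; rewrite leq_maxl.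
  by apply: lspan_sub hv; apply: mkseq_subset; rewrite leq_maxr.
pose P (s : seq {poly A}^o) (x : {poly A}^o) := (forall y, y \in s -> I y) ->
  [/\ I x, ~ lspan s x & forall y : {poly A}^o,
    I y -> ~ lspan s y -> (size (x : {poly A}) <= size (y : {poly A}))%N].
have /seq_choice [f hf] : forall s, exists x, P s x.
  move=> s; have [hs|] := pselect (forall y, y \in s -> I y); last by exists 0.
  have [n hn] : exists n, lspan s `<=` lspan (mkseq a n).
    elim: s hs => [|y s IHs] hs.
      exists 0%N; apply: lspan_min; first exact: lspan_submod.
      by [].
    have [n hn] : exists n, lspan s `<=` lspan (mkseq a n).
      by apply: IHs => z hz; apply: hs; rewrite inE hz orbT.
    have [m hm] := hs y (mem_head _ _).
    exists (maxn m n); apply: lspan_min; first exact: lspan_submod.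
    move=> z; rewrite inE => /orP [/eqP ->|hz].
      by apply: lspan_sub hm; apply: mkseq_subset; rewrite leq_maxl.
    apply: (lspan_sub (s := mkseq a n)); first by apply: mkseq_subset; rewrite leq_maxr.
    exact/hn/lspan_mem.
  pose Q d := `[< exists x : {poly A}^o, [/\ I x, ~ lspan s x & size (x : {poly A}) = d] >].
  have exQ : exists d, Q d.
    exists (size (a n : {poly A})); apply/asboolP; exists (a n); split=> //.
      by exists n.+1; apply/lspan_mem/mkseq_mem.
    by move=> /hn /ha'.
  case: (ex_minnP exQ) => d /asboolP [x [Ix nx <-]] hmin; exists x => _; split=> // y Iy ny.
  by apply: hmin; apply/asboolP; exists y.
have hfI n : forall y, y \in mkseq f n -> I y.
  elim: n => [//|n IHn] y; rewrite mkseqS mem_rcons inE => /orP [/eqP ->|/IHn //].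
  by case: (hf n IHn).
have {hf} hf n := hf n (hfI n).
pose F n : {poly A} := f n.
have Fmono i n : (i <= n)%N -> (size (F i) <= size (F n))%N.
  move=> hin; case: (hf i) => _ _; apply; first by case: (hf n).
  by move=> h; case: (hf n) => _ + _; apply; apply: lspan_sub h; apply: mkseq_subset.
have [n [c]] := hA (fun i => lead_coef (F i)); rewrite size_mkseq => hn.
have F0 : F n != 0.
  apply/eqP => h; case: (hf n) => _ + _; apply; rewrite -/(F n) h.
  exact: lspan0.
pose g : {poly A} := \sum_(i < n) (c i *: 'X^(size (F n) - size (F i))) * F i.
have gspan : lspan (mkseq f n) (g : {poly A}^o).
  apply: (submodset_sum (E := {poly A}^o)); first exact: lspan_submod.
  move=> i _; apply: (submodsetZ (E := {poly A}^o)); first exact: lspan_submod.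
  exact/lspan_mem/mkseq_mem.
have sF : (0 < size (F n))%N by rewrite lt0n size_poly_eq0.
have : (size (F n - g)%R < size (F n))%N.
  rewrite -(prednK sF) ltnS; apply/leq_sizeP => j hj; rewrite coefB.
  have cg : g`_j = \sum_(i < n) c i * (F i)`_(j - (size (F n) - size (F i))).
    rewrite coef_sum; apply: eq_bigr => i _; rewrite -scalerAl coefZ coefXnM.
    case: ltnP => // h; have := Fmono i n (ltnW (ltn_ord i)) => hi.
    rewrite nth_default ?mulr0 // leqNgt; apply/negP => h'.
    move: hj h hi h' sF; move: (size (F n)) (size (F i)) => u v; lia.
  case: (leqP (size (F n)) j) => hj'.
    rewrite nth_default // cg big1 ?subrr // => i _; rewrite nth_default ?mulr0 //.
    by have := Fmono i n (ltnW (ltn_ord i)); move: hj'; move: (size (F n)) (size (F i)) => u v; lia.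
  have hje : j = (size (F n)).-1 by move: hj hj' sF; move: (size (F n)) => u; lia.
  rewrite cg hje -lead_coefE hn; apply/eqP; rewrite subr_eq0; apply/eqP.
  apply: eq_bigr => i _; rewrite nth_mkseq //; congr (_ * _); rewrite lead_coefE.
  have hi := Fmono i n (ltnW (ltn_ord i)); congr (_ `_ _).
  by move: sF hi; move: (size (F n)) (size (F i)) => u v; lia.
rewrite ltnNge => /negP; apply; case: (hf n) => fI nf; apply.
  apply: (submodsetB (E := {poly A}^o)) => //.
  by apply: lspan_min gspan => // y; apply: hfI.
move=> h; apply: nf; rewrite -[f n](subrK (g : {poly A}^o)).
by apply: submodsetD => //; apply: lspan_submod.
Qed.

(** Generators are adjoined one at a time: a map from [B] extends to [{poly B}] by sending the
    variable to the next generator. The final image is a subalgebra containing [s], hence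
    everything. *)
Lemma noetherian_fg_algebra (k : fieldType) (R : comAlgType k) (s : seq R) :
  (forall S : {pred R}, subalg_closed S -> {subset s <= S} -> forall x, x \in S) ->
  noetherian R^o.
Proof.
move=> hs.
have [B [f [hB hf1 hf2]]] : exists (B : comNzRingType) (f : {rmorphism B -> R}),
    [/\ noetherian B^o, forall c : k, exists b, f b = c%:A
      & forall x, x \in s -> exists b, f b = x].
  elim: s {hs} => [|y s [B [f [hB hf1 hf2]]]].
    by exists k, (in_alg R); split=> [|c|//]; [exact: noetherian_field|exists c].
  exists {poly B}, (horner_morph (fun b => mulrC y (f b))); split.
  - exact: noetherian_poly.
  - by move=> c; have [b hb] := hf1 c; exists b%:P; rewrite /= horner_morphC.
  - move=> x; rewrite inE => /orP [/eqP ->|/hf2 [b hb]]; first by exists 'X; rewrite /= horner_morphX.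
    by exists b%:P; rewrite /= horner_morphC.
apply: (noetherian_surj (f := f)) => // x.
have := hs (fun x => `[< exists b, f b = x >]) _ _ x.
rewrite /in_mem /= => h; apply/asboolP/h => [|z /hf2 hz]; last exact/asboolP.
split=> [|a u v|u v]; rewrite /in_mem /=.
- by apply/asboolP; exists 1; rewrite rmorph1.
- move=> /asboolP [b <-] /asboolP [b' <-]; apply/asboolP; have [e he] := hf1 a.
  by exists (e * b + b'); rewrite rmorphD rmorphM he mulr_algl.
- by move=> /asboolP [b <-] /asboolP [b' <-]; apply/asboolP; exists (b * b'); rewrite rmorphM.
Qed.

(** * Graded modules *)

Lemma big_uniq_support (I : eqType) (V : zmodType) (s t : seq I) (g : I -> V) :
  uniq s -> uniq t -> {subset s <= t} -> (forall i, i \notin s -> g i = 0) ->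
  \sum_(i <- s) g i = \sum_(i <- t) g i.
Proof.
move=> us ut st hg; rewrite [RHS](bigID (mem s)) /= [X in _ + X]big1 // addr0.
rewrite -[RHS]big_filter; apply: perm_big; apply: uniq_perm => //; first exact: filter_uniq.
by move=> i; rewrite mem_filter /=; case: (boolP (i \in s)) => // /st ->.
Qed.

Section Components.
Variables (I : eqType) (V : zmodType) (A : I -> {pred V}).

(** The family of homogeneous components is a total function with an existential finite support, so
    that adding two families only asks for the union of the supports. *)
Definition gcomp_spec (v : V) : set (I -> V) :=
  [set g | (forall i, g i \in A i) /\
    exists s, [/\ uniq s, forall i, i \notin s -> g i = 0 & v = \sum_(i <- s) g i]].

Definition gcomp (i : I) (v : V) : V := xget (fun=> 0) (gcomp_spec v) i.

Hypothesis hA : internal_direct_sum A.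

Let A0 i : 0 \in A i. Proof. by case: hA => /(_ i) []. Qed.
Let AB i u v : u \in A i -> v \in A i -> u - v \in A i.
Proof. by case: hA => /(_ i) [_ h] _ _; apply: h. Qed.
Let AD i u v : u \in A i -> v \in A i -> u + v \in A i.
Proof. by move=> hu hv; rewrite -[v]opprK; apply: AB => //; rewrite -sub0r AB. Qed.

Lemma gcomp_specD u v g h : gcomp_spec u g -> gcomp_spec v h ->
  gcomp_spec (u + v) (fun i => g i + h i).
Proof.
move=> [gA [s [us sg ->]]] [hhA [t [ut th ->]]]; split=> [i|]; first exact: AD.
exists (undup (s ++ t)); split; first exact: undup_uniq.
  by move=> i; rewrite mem_undup mem_cat negb_or => /andP [/sg -> /th ->]; rewrite addr0.
rewrite big_split /=; congr (_ + _); apply: big_uniq_support => //;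
  rewrite ?undup_uniq // => i hi; rewrite mem_undup mem_cat hi ?orbT //.
Qed.

Lemma gcomp_specN u g : gcomp_spec u g -> gcomp_spec (- u) (fun i => - g i).
Proof.
move=> [gA [s [us sg ->]]]; split=> [i|]; first by rewrite -sub0r AB.
by exists s; split=> // [i /sg ->|]; rewrite ?oppr0 // sumrN.
Qed.

Lemma gcomp_spec1 i u : u \in A i -> gcomp_spec u (fun j => if j == i then u else 0).
Proof.
move=> hu; split=> [j|]; first by case: eqP => [->|].
exists [:: i]; split=> // [j|]; first by rewrite inE => /negPf ->.
by rewrite big_seq1 eqxx.
Qed.

Lemma gcomp_spec0 : gcomp_spec 0 (fun=> 0).
Proof. by split=> // ; exists [::]; split=> //; rewrite big_nil. Qed.

Lemma gcomp_spec_ex v : exists g, gcomp_spec v g.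
Proof.
case: hA => _ + _ => /(_ v) [s [f [hf ->]]].
elim: s => [|i s [g hg]]; first by exists (fun=> 0); rewrite big_nil; apply: gcomp_spec0.
rewrite big_cons; exists (fun j => (if j == i then f i else 0) + g j).
exact: gcomp_specD (gcomp_spec1 (hf i)) hg.
Qed.

Lemma gcompP v : gcomp_spec v (gcomp^~ v).
Proof.
rewrite /gcomp; have [g hg] := gcomp_spec_ex v.
by case: xgetP => [h -> //|/(_ g)].
Qed.

Lemma gcomp_uniq v g : gcomp_spec v g -> gcomp^~ v = g.
Proof.
move=> hg; have [] := gcomp_specD (gcompP v) (gcomp_specN hg).
move=> hA1 [s [us sz]]; rewrite subrr => /esym h; apply/funext => i.
apply/eqP; rewrite -subr_eq0; apply/eqP.
have [/sz //|his] := boolP (i \notin s); case: hA => _ _ /(_ s _ us hA1 h); apply.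
by rewrite negbK in his.
Qed.

Lemma gcompD i u v : gcomp i (u + v) = gcomp i u + gcomp i v.
Proof.
by rewrite -[LHS]/((gcomp^~ (u + v)) i) (gcomp_uniq (gcomp_specD (gcompP u) (gcompP v))).
Qed.

Lemma gcomp_in i v : gcomp i v \in A i.
Proof. by case: (gcompP v). Qed.

Lemma gcomp_hom i j v : v \in A j -> gcomp i v = if i == j then v else 0.
Proof. by move=> hv; rewrite -[LHS]/((gcomp^~ v) i) (gcomp_uniq (gcomp_spec1 hv)). Qed.

Lemma gcomp_id i v : gcomp i v = v <-> v \in A i.
Proof.
split=> [<-|hv]; first exact: gcomp_in.
by rewrite (gcomp_hom _ hv) eqxx.
Qed.

Lemma gcomp_sum v : exists s, [/\ uniq s, forall i, i \notin s -> gcomp i v = 0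
  & v = \sum_(i <- s) gcomp i v].
Proof. by case: (gcompP v). Qed.

End Components.

(* [c z] is the projection onto the degree [z] part of a graded module. *)
Record grading (R : nzRingType) (gR : nat -> {pred R}) (E : lmodType R)
    (c : int -> E -> E) : Prop := Grading {
  grading_D : forall z u v, c z (u + v) = c z u + c z v;
  grading_idem : forall z w v, c z (c w v) = if z == w then c w v else 0;
  grading_sum : forall v, exists s, [/\ uniq s, forall z, z \notin s -> c z v = 0
    & v = \sum_(z <- s) c z v];
  grading_scale : forall z w x v, x \in zgrade gR w ->
    c z (x *: v) = x *: c (z - w) v
}.

Section GradingTheory.
Variables (R : nzRingType) (gR : nat -> {pred R}) (E : lmodType R).
Variables (c : int -> E -> E) (hc : grading gR c).

Lemma grading0 z : c z 0 = 0.
Proof. by apply: (addrI (c z 0)); rewrite -(grading_D hc) !addr0. Qed.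

Lemma gradingN z v : c z (- v) = - c z v.
Proof. by apply: (addrI (c z v)); rewrite -(grading_D hc) !subrr grading0. Qed.

Lemma gradingB z u v : c z (u - v) = c z u - c z v.
Proof. by rewrite (grading_D hc) gradingN. Qed.

Lemma grading_sumD z (I : Type) (r : seq I) (P : pred I) (F : I -> E) :
  c z (\sum_(i <- r | P i) F i) = \sum_(i <- r | P i) c z (F i).
Proof.
elim/big_rec2: _ => [|i u v _ <-]; first exact: grading0.
by rewrite (grading_D hc).
Qed.

Lemma grading_eq0 v : (forall z, c z v = 0) -> v = 0.
Proof. by move=> h; have [s [_ _ ->]] := grading_sum hc v; rewrite big1. Qed.

Lemma grading_ext u v : (forall z, c z u = c z v) -> u = v.
Proof.
move=> h; apply/eqP; rewrite -subr_eq0; apply/eqP/grading_eq0 => z.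
by rewrite gradingB h subrr.
Qed.

Definition homog (N : set E) := forall z v, N v -> N (c z v).

Lemma grading_subset v (s : seq int) : uniq s -> (forall z, z \notin s -> c z v = 0) ->
  v = \sum_(z <- s) c z v.
Proof.
move=> us hs; have [t [ut ht {1}->]] := grading_sum hc v.
have ust := undup_uniq (s ++ t).
rewrite (big_uniq_support ut ust) //; last first.
  by move=> z hz; rewrite mem_undup mem_cat hz orbT.
by rewrite -(big_uniq_support us ust) // => z hz; rewrite mem_undup mem_cat hz.
Qed.

End GradingTheory.

Lemma graded_module_grading (k : fieldType) (R : comAlgType k)
    (gR : nat -> {pred R}) (M : lmodType R) (gM : int -> {pred M}) :
  graded_module gR gM -> grading gR (gcomp gM).
Proof.
move=> [hM hRM]; split.
- by move=> z u v; apply: gcompD.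
- by move=> z w v; rewrite (gcomp_hom hM _ (gcomp_in hM w v)).
- exact: gcomp_sum.
move=> z w x v; case: w => [n|n] /=; last first.
  rewrite inE => /eqP ->; rewrite !scale0r.
  by have := gcomp_uniq hM (gcomp_spec0 hM) => /(congr1 (fun f => f z)).
move=> hx.
suff h : gcomp_spec gM (x *: v) (fun z => x *: gcomp gM (z - n%:Z) v).
  by rewrite -[LHS]/((gcomp gM ^~ _) z) (gcomp_uniq hM h).
have [s [us sz hs]] := gcomp_sum hM v.
split=> [i|].
  by have := hRM n (i - n%:Z) x _ hx (gcomp_in hM (i - n%:Z) v); rewrite [X in gM X]addrC subrK.
exists [seq z + n%:Z | z <- s]; split.
- by rewrite map_inj_uniq // => a b /addIr.
- move=> i hi; rewrite sz ?scaler0 //; apply: contra hi => hi.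
  by apply/mapP; exists (i - n%:Z) => //; rewrite subrK.
- rewrite big_map {1}hs scaler_sumr; apply: eq_bigr => i _; by rewrite addrK.
Qed.

(** * Standard graded algebras: components, residue map and generators *)

Section StandardGraded.
Variables (k : fieldType) (R : comAlgType k) (gR : nat -> {pred R}).
Hypothesis hR : standard_graded gR.

Lemma zgrade_direct : internal_direct_sum (zgrade gR).
Proof.
case: hR => [[h1 h2 h3] _ _ _]; split.
- case=> [n|n] /=; first exact: h1.
  by split=> [|u v]; rewrite ?inE // => /eqP -> /eqP ->; rewrite subr0.
- move=> v; have [s [f [hf ->]]] := h2 v.
  exists (map Posz s), (fun z => if z is Posz n then f n else 0); split.
    by case=> [n|n] //=; rewrite inE.
  by rewrite big_map.
- move=> s f us hf hs.
  have f0 z : (z < 0)%R -> f z = 0 by case: z => // n _; have := hf (Negz n); rewrite inE => /eqP.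
  pose t := [seq `|z|%N | z <- s & 0 <= z].
  have ut : uniq t.
    rewrite map_inj_in_uniq ?filter_uniq // => x y; rewrite !mem_filter.
    by move=> /andP [hx _] /andP [hy _] h; rewrite -(gez0_abs hx) -(gez0_abs hy) h.
  have h0 : \sum_(i <- t) f (Posz i) = 0.
    rewrite big_map big_filter -[RHS]hs [RHS](bigID (fun z => 0 <= z)) /=.
    rewrite [X in _ = _ + X]big1 ?addr0 => [|z]; last by rewrite -ltNge => /f0.
    by apply: eq_bigr => z hz; rewrite gez0_abs.
  move=> z hz; case: (leP 0 z) => hz0; last exact: f0.
  have := h3 t (fun n => f (Posz n)) ut (fun n => hf n) h0 `|z|%N.
  rewrite gez0_abs //; apply; apply/mapP; exists z => //.
  by rewrite mem_filter hz0.
Qed.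

Lemma regular_graded : graded_module (M := R^o) gR (zgrade gR).
Proof.
split; first exact: zgrade_direct.
case: hR => _ hm _ _ i [j|j] x m hx /=; first exact: hm.
rewrite inE => /eqP ->; rewrite scaler0.
by case: zgrade_direct => /(_ (i%:Z + Negz j)) [].
Qed.

Definition rc (z : int) (x : R) : R := gcomp (zgrade gR) z x.

Lemma rc_grading : grading (E := R^o) gR rc.
Proof. exact: graded_module_grading regular_graded. Qed.

Lemma rcD z x y : rc z (x + y) = rc z x + rc z y.
Proof. exact: (grading_D rc_grading). Qed.

Lemma rcB z x y : rc z (x - y) = rc z x - rc z y.
Proof. exact: (gradingB rc_grading). Qed.

Lemma rc0 z : rc z 0 = 0.
Proof. exact: (grading0 rc_grading). Qed.

Lemma rc_sumD z (I : Type) (r : seq I) (P : pred I) (F : I -> R) :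
  rc z (\sum_(i <- r | P i) F i) = \sum_(i <- r | P i) rc z (F i).
Proof. exact: (grading_sumD rc_grading). Qed.

Lemma rc_in z x : rc z x \in zgrade gR z.
Proof. exact: (gcomp_in zgrade_direct). Qed.

Lemma rc_hom z w x : x \in zgrade gR w -> rc z x = if z == w then x else 0.
Proof. exact: (gcomp_hom zgrade_direct). Qed.

Lemma rcP z x : rc z x = x <-> x \in zgrade gR z.
Proof. exact: (gcomp_id zgrade_direct). Qed.

Lemma rcM z w x y : x \in zgrade gR w -> rc z (x * y) = x * rc (z - w) y.
Proof. exact: (grading_scale rc_grading). Qed.

Lemma rcMr z w x y : y \in zgrade gR w -> rc z (x * y) = rc (z - w) x * y.
Proof. by move=> hy; rewrite mulrC (rcM _ _ hy) mulrC. Qed.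

Lemma rc_neg z x : (z < 0) -> rc z x = 0.
Proof. by case: z => // n _; have := rc_in (Negz n) x; rewrite inE => /eqP. Qed.

Lemma rc_ext x y : (forall z, rc z x = rc z y) -> x = y.
Proof. exact: (grading_ext rc_grading). Qed.

Lemma zgrade_zmod z : zmod_closed (zgrade gR z).
Proof. by case: zgrade_direct. Qed.

Lemma zgradeA (c : k) : c%:A \in zgrade gR 0.
Proof. by case: hR => _ _ h _; apply/h; exists c. Qed.

Lemma rcZ z (c : k) x : rc z (c *: x) = c *: rc z x.
Proof.
by rewrite -mulr_algl (rcM _ _ (zgradeA c)) subr0 mulr_algl.
Qed.

Lemma rcA z (c : k) : rc z c%:A = if z == 0 then c%:A else 0.
Proof. exact: rc_hom (zgradeA c). Qed.

Lemma rc1 z : rc z 1 = if z == 0 then 1 else 0.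
Proof. by have := rcA z 1; rewrite scale1r. Qed.

(** One bound serves every larger [n], so the decomposition can be cut at a length that also covers
    a prescribed degree. *)
Lemma rc_sum x : exists N, forall n, (N <= n)%N ->
  x = \sum_(i < n) rc i x /\ forall z, n%:Z <= z -> rc z x = 0.
Proof.
have [s [us sz hs]] := grading_sum rc_grading x.
pose N := \max_(z <- s) `|z|.+1%N; exists N => n hn.
have h0 z : n%:Z <= z -> rc z x = 0.
  move=> hz; apply: sz; apply/negP => zs.
  have : (`|z|.+1 <= N)%N by exact: (leq_bigmax_seq (P := xpredT) (F := fun z : int => (`|z|.+1)%N) z zs isT).
  by move: hz hn; lia.
split=> //; rewrite -(big_mkord xpredT (fun i => rc (Posz i) x)).
rewrite {1}(grading_subset rc_grading (v := x) (s := map Posz (index_iota 0 n))) ?big_map //.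
  by rewrite map_inj_uniq ?iota_uniq // => a b [].
move=> z hz; case: (ltP z 0) => [/rc_neg -> //|z0].
apply: h0; rewrite leNgt; apply/negP => hzn; move/negP: hz; apply.
by apply/mapP; exists `|z|%N; [rewrite mem_index_iota; lia|lia].
Qed.

Lemma irrelevantP x : irrelevant gR x <-> rc 0 x = 0.
Proof.
split=> [[n [f [hf ->]]]|hx].
  rewrite rc_sumD big1 // => i _.
  by rewrite (@rc_hom 0 i.+1%:Z) // hf.
have [N /(_ N.+1 (leqnSn _)) [hN _]] := rc_sum x.
exists N, (fun i => rc i.+1 x); split=> [i|]; first exact: (rc_in i.+1).
by rewrite {1}hN big_ord_recl /= hx add0r.
Qed.

Lemma rc0P x : exists c : k, rc 0 x = c%:A.
Proof. by case: hR => _ _ h _; apply/h; apply: (rc_in 0). Qed.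

(** A component of positive degree in [x] would have to meet one of negative degree in [y], and
    there are none. This makes [residue] multiplicative. *)
Lemma rc0M x y : rc 0 (x * y) = rc 0 x * rc 0 y.
Proof.
have [N /(_ N.+1 (leqnSn _)) [hN _]] := rc_sum x.
rewrite {1}hN mulr_suml rc_sumD big_ord_recl /= big1 ?addr0 => [|i _].
  by rewrite (rcM _ _ (rc_in 0 x)) subr0.
by rewrite (rcM _ _ (rc_in _ x)) [rc (0 - _) y]rc_neg ?mulr0 //= /bump; lia.
Qed.

Lemma algA_inj (a b : k) : a%:A = b%:A :> R -> a = b.
Proof.
move=> h; apply/eqP; rewrite -subr_eq0; have : (a - b)%:A == 0 :> R by rewrite scalerBl h subrr.
by rewrite scaler_eq0 oner_eq0 orbF.
Qed.

Lemma residueE x : (residue gR x)%:A = rc 0 x.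
Proof.
rewrite /residue; case: xgetP => [c -> /irrelevantP|].
  by rewrite rcB rcA eqxx => /eqP; rewrite subr_eq0 => /eqP ->.
have [c hc] := rc0P x => /(_ c) []; apply/irrelevantP.
by rewrite rcB rcA eqxx hc subrr.
Qed.

Lemma residue_eq c x : rc 0 x = c%:A -> residue gR x = c.
Proof. by move=> h; apply: algA_inj; rewrite residueE. Qed.

Lemma residue_is_zmod_morphism : zmod_morphism (residue gR).
Proof. by move=> x y; apply: residue_eq; rewrite rcB -!residueE scalerBl. Qed.

Lemma residue_is_monoid_morphism : monoid_morphism (residue gR).
Proof.
split=> [|x y]; apply: residue_eq; first by rewrite rc1 scale1r.
by rewrite rc0M -!residueE -scalerAl mul1r scalerA.
Qed.

Lemma residue_eq0 x : residue gR x = 0 <-> rc 0 x = 0.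
Proof.
split=> h; first by rewrite -residueE h scale0r.
by apply: residue_eq; rewrite h scale0r.
Qed.

Lemma irrelevant_submod : submodset (E := R^o) (irrelevant gR).
Proof.
split=> [|a u v /irrelevantP hu /irrelevantP hv]; first by apply/irrelevantP; rewrite rc0.
by apply/irrelevantP; rewrite rcD [a *: u]/GRing.scale /= rc0M hu hv mulr0 addr0.
Qed.

Lemma irrelevant1 : ~ irrelevant gR 1.
Proof. by move/irrelevantP; rewrite rc1 eqxx; apply/eqP/oner_neq0. Qed.

Lemma irrelevant_zgrade z x : 0 < z -> x \in zgrade gR z -> irrelevant gR x.
Proof.
by move=> hz hx; apply/irrelevantP; rewrite (rc_hom _ hx) ifN // lt_eqF.
Qed.

(** The monomials of degree [n] in [ys], with repetitions. *)
Fixpoint words (ys : seq R) (n : nat) : seq R :=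
  if n is n'.+1 then [seq y * w | y <- ys, w <- words ys n'] else [:: 1].

Lemma wordsM ys m n u v : u \in words ys m -> v \in words ys n -> u * v \in words ys (m + n).
Proof.
elim: m u => [|m IHm] u /=; first by rewrite inE => /eqP -> hv; rewrite mul1r.
move=> /allpairsP [[y w] /= [hy hw ->]] hv; rewrite -mulrA.
by apply/allpairsP; exists (y, w * v); split=> //=; apply: IHm.
Qed.

(** The elements whose components are all [k]-combinations of words of matching length form a
    subalgebra. It contains the algebra generators, so it is all of [R]. *)
Lemma standard_graded_generators : exists ys : seq R,
  [/\ forall y, y \in ys -> y \in gR 1,
      forall n x, x \in gR n -> lspan (R := k) (words ys n) x
    & forall x, irrelevant gR x <-> lspan (E := R^o) ys x].
Proof.
case: (hR) => _ _ _ [ys [ys1 hys]]; exists ys.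
have hW : forall x (n : nat), lspan (R := k) (words ys n) (rc n x).
  move=> x; pose S (x : R) := `[< forall n : nat, lspan (R := k) (words ys n) (rc n x) >].
  have := hys S _ _ x; rewrite /in_mem /= => h; apply/asboolP/h => {x h} [|y hy]; last first.
    apply/asboolP => n; rewrite (@rc_hom n 1 y) ?ys1 //.
    case: eqP => [[->]|_]; last exact: lspan0.
    by apply: lspan_mem; apply/allpairsP; exists (y, 1); split; rewrite ?inE ?mulr1.
  split=> [|a u v|u v]; rewrite /in_mem /=.
  - apply/asboolP => n; rewrite rc1; case: eqP => [[->]|_]; last exact: lspan0.
    by apply: lspan_mem; rewrite inE.
  - move=> /asboolP hu /asboolP hv; apply/asboolP => n; rewrite rcD rcZ.
    by case: (lspan_submod (R := k) (words ys n)) => _; apply.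
  - move=> /asboolP hu /asboolP hv; apply/asboolP => n.
    have [N /(_ N (leqnn N)) [{2}-> _]] := rc_sum u.
    rewrite mulr_suml rc_sumD; apply: submodset_sum => [|i _]; first exact: lspan_submod.
    rewrite (rcM _ _ (rc_in _ u)).
    case: (leqP i n) => hi; last by rewrite [rc (n%:Z - _) v]rc_neg ?mulr0; [exact: lspan0|lia].
    have -> : n%:Z - i%:Z = (n - i)%N by lia.
    have [a ->] := hu i; have [b ->] := hv (n - i)%N.
    rewrite mulr_suml; apply: submodset_sum => [|j _]; first exact: lspan_submod.
    rewrite mulr_sumr; apply: submodset_sum => [|l _]; first exact: lspan_submod.
    rewrite -scalerAl -scalerAr; apply: submodsetZ; first exact: lspan_submod.
    apply: submodsetZ; first exact: lspan_submod.
    by apply: lspan_mem; have := @wordsM ys i (n - i) _ _ (mem_nth 0 (ltn_ord j)) (mem_nth 0 (ltn_ord l)); rewrite subnKC.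
split=> // [n x hx|x].
  by have := hW x n; rewrite (@rc_hom n n) // eqxx.
split=> [hx|]; last first.
  apply: lspan_min => [|y hy]; first exact: irrelevant_submod.
  by apply: (@irrelevant_zgrade 1) => //; apply: ys1.
have [N /(_ N.+1 (leqnSn _)) [-> _]] := rc_sum x.
rewrite big_ord_recl /= (irrelevantP x).1 // add0r.
apply: (submodset_sum (E := R^o)) => [|i _]; first exact: lspan_submod.
(* An ideal is also a [k]-subspace, so it suffices to place each word of positive length in it, and
   such a word has a factor in [ys]. *)
have hk : submodset (lspan (E := R^o) ys : set (R : lmodType k)).
  split=> [|a u v hu hv]; first exact: lspan0.
  by rewrite -[a *: u]mulr_algl; case: (lspan_submod (E := R^o) ys) => _; apply.
apply: (lspan_min hk) (hW x (bump 0 i)) => z /= /allpairsP [[y w] /= [hy _ ->]].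
rewrite mulrC; apply: (submodsetZ (E := R^o)); first exact: lspan_submod.
exact: lspan_mem.
Qed.

Lemma standard_graded_noetherian : noetherian R^o.
Proof. by case: (hR) => _ _ _ [ys [_ h]]; apply: noetherian_fg_algebra h. Qed.

Section RowGrading.
Variables (b : nat) (sh : 'I_b -> int).

(** The grading of the direct sum of the [R(- sh a)]: basis vector [a] sits in degree [sh a]. *)
Definition rcrow (z : int) (v : 'rV[R]_b) : 'rV[R]_b := \row_a rc (z - sh a) (v 0 a).

Lemma rcrow_grading : grading gR rcrow.
Proof.
split.
- by move=> z u v; apply/rowP => a; rewrite !mxE rcD.
- move=> z w v; apply/rowP => a; rewrite !mxE (@rc_hom _ (w - sh a)) ?rc_in //.
  by rewrite (inj_eq (addIr _)); case: eqP => _; rewrite !mxE.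
- move=> v; have /choice [s hs] : forall a, exists s, [/\ uniq s,
      forall z, z \notin s -> rc z (v 0 a) = 0 & v 0 a = \sum_(z <- s) rc z (v 0 a)].
    by move=> a; apply: (grading_sum rc_grading).
  pose t := undup (flatten [seq [seq z + sh a | z <- s a] | a : 'I_b]).
  have ht a z : z \in s a -> z + sh a \in t.
    move=> hz; rewrite mem_undup; apply/flattenP.
    exists [seq z + sh a | z <- s a]; last exact: map_f.
    by apply/mapP; exists a => //; rewrite mem_enum.
  exists t; split; first exact: undup_uniq.
    move=> z hz; apply/rowP => a; rewrite !mxE; case: (hs a) => _ h _; apply: h.
    by apply: contra hz => /ht; rewrite subrK.
  apply/rowP => a; rewrite summxE.
  rewrite {1}(grading_subset rc_grading (v := v 0 a) (s := [seq z - sh a | z <- t])).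
  + by rewrite big_map; apply: eq_bigr => z _; rewrite mxE.
  + by rewrite map_inj_uniq ?undup_uniq // => x y /addIr.
  + move=> z hz; case: (hs a) => _ h _; apply: h; apply: contra hz => /ht h.
    by apply/mapP; exists (z + sh a); rewrite ?addrK.
- move=> z w x v hx; apply/rowP => a; rewrite !mxE (rcM _ _ hx).
  by congr (_ * rc _ _); rewrite addrAC.
Qed.

End RowGrading.

End StandardGraded.

(** * Comparison of projective resolutions *)

Section ImageModule.
Variables (R : nzRingType) (A B : lmodType R) (d : {linear A -> B}).

Definition image_pred : {pred B} := fun b => `[< exists a, d a = b >].

Lemma image_predP b : reflect (exists a, d a = b) (b \in image_pred).
Proof. exact: asboolP. Qed.

Lemma image_submod_closed : submod_closed image_pred.
Proof.
split=> [|a u v /image_predP [x <-] /image_predP [y <-]]; apply/image_predP.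
  by exists 0; rewrite linear0.
by exists (a *: x + y); rewrite linearP.
Qed.

HB.instance Definition _ := GRing.isSubmodClosed.Build R B image_pred image_submod_closed.

(** [projective] only lifts along surjections; to lift along an arbitrary map, its image must exist
    as a module of its own. *)
Record image_mod := ImageMod { image_val : B; image_valP : image_val \in image_pred }.

HB.instance Definition _ := [isSub for image_val].
HB.instance Definition _ := [Choice of image_mod by <:].
HB.instance Definition _ := [SubChoice_isSubLmodule of image_mod by <:].

End ImageModule.

Lemma projective_lift (R : nzRingType) (X A B : lmodType R) (f : {linear X -> B})
    (d : {linear A -> B}) : projective X -> (forall x, exists a, d a = f x) ->
  exists h : {linear X -> A}, forall x, d (h x) = f x.
Proof.
move=> hX hf.
have hfd x : f x \in image_pred d by apply/image_predP/hf.
have hdd a : d a \in image_pred d by apply/image_predP; exists a.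
pose g (x : X) : image_mod d := ImageMod (hfd x).
pose e (a : A) : image_mod d := ImageMod (hdd a).
have lg : linear g by move=> c u v; apply: val_inj; rewrite linearP /= linearP.
have le : linear e by move=> c u v; apply: val_inj; rewrite linearP /= linearP.
pose G : {linear X -> image_mod d} := HB.pack g (GRing.isLinear.Build _ _ _ _ _ lg).
pose D : {linear A -> image_mod d} := HB.pack e (GRing.isLinear.Build _ _ _ _ _ le).
have [|h hh] := hX _ _ D G.
  by case=> b hb; have /image_predP [a ha] := hb; exists a; apply: val_inj.
by exists h => x; have := congr1 val (hh x).
Qed.

Lemma projective_rV (R : nzRingType) n : projective 'rV[R]_n.
Proof.
move=> A B f g hf; have /choice [a ha] : forall i : 'I_n, exists a, f a = g (delta_mx 0 i).
  by move=> i; apply: hf.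
pose h (v : 'rV[R]_n) : A := \sum_i v 0 i *: a i.
have lh : linear h.
  move=> c u v; rewrite /h scaler_sumr -big_split /=; apply: eq_bigr => i _.
  by rewrite !mxE scalerDl scalerA.
exists (HB.pack h (GRing.isLinear.Build _ _ _ _ _ lh) : {linear _ -> _}) => x /=.
rewrite /h linear_sum [in RHS](row_sum_delta x) linear_sum.
by apply: eq_bigr => i _; rewrite !linearZ /= ha.
Qed.

(** Dependent choice over varying types. The invariant [Inv] is what guarantees that a next step
    exists. *)
Lemma dependent_chain (T : nat -> Type) (Q : forall i, T i -> T i.+1 -> Prop)
    (Inv : forall i, T i -> Prop) (x0 : T 0%N) :
  Inv 0%N x0 ->
  (forall i x, Inv i x -> exists y, Q i x y /\ Inv i.+1 y) ->
  exists f : forall i, T i, f 0%N = x0 /\ forall i, Q i (f i) (f i.+1) /\ Inv i (f i).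
Proof.
move=> h0 hs.
pose step i (p : {x : T i | Inv i x}) : {y : T i.+1 | Inv i.+1 y} :=
  let y := cid (hs i (sval p) (svalP p)) in exist _ (sval y) (proj2 (svalP y)).
pose f i : {x : T i | Inv i x} :=
  nat_rect (fun i => {x : T i | Inv i x}) (exist _ x0 h0) step i.
exists (fun i => sval (f i)); split=> // i; split; last exact: (svalP (f i)).
rewrite /= /step /=; by case: cid => y [].
Qed.

(* The complexes are augmented: [X 0] is the resolved module and [X i.+1] the
   [i]-th term of the resolution. *)
Section Comparison.
Variables (R : nzRingType) (X Y : nat -> lmodType R).
Variables (dX : forall i, {linear X i.+1 -> X i}) (dY : forall i, {linear Y i.+1 -> Y i}).

Definition acyclic :=
  (forall y, exists z, dY 0%N z = y) /\
  forall i y, dY i y = 0 -> exists z, dY i.+1 z = y.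

Hypothesis cX : forall i x, dX i (dX i.+1 x) = 0.
Hypothesis pX : forall i, projective (X i.+1).
Hypothesis aY : acyclic.

Lemma comparison (f0 : {linear X 0%N -> Y 0%N}) :
  exists f : forall i, {linear X i -> Y i},
    f 0%N = f0 /\ forall i x, dY i (f i.+1 x) = f i (dX i x).
Proof.
(* The invariant says that [f] after the differential of [X] lands in the image of the differential
   of [Y], which is what [projective_lift] asks for. *)
have [] := @dependent_chain (fun i => {linear X i -> Y i})
  (fun i f g => forall x, dY i (g x) = f (dX i x))
  (fun i f => forall x, exists y, dY i y = f (dX i x)) f0.
- by move=> x; case: aY => h _; apply: h.
- move=> i f hf; have [g hg] := projective_lift (f := f \o dX i) (pX (i := i)) hf.
  exists g; split=> // x; case: aY => _; apply.
  by rewrite hg /= cX linear0.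
by move=> f [f0E hf]; exists f; split=> // i; case: (hf i).
Qed.

Lemma comparison_homotopy (f : forall i, {linear X i -> Y i}) :
  (forall x, f 0%N x = 0) -> (forall i x, dY i (f i.+1 x) = f i (dX i x)) ->
  exists s : forall i, {linear X i -> Y i.+1},
    (forall x, s 0%N x = 0) /\
    forall i x, f i.+1 x = dY i.+1 (s i.+1 x) + s i (dX i x).
Proof.
move=> f0 hf.
have [||s [s0 hs]] := @dependent_chain (fun i => {linear X i -> Y i.+1})
  (fun i s s' => forall x, dY i.+1 (s' x) = f i.+1 x - s (dX i x))
  (fun i s => forall x, exists y, dY i.+1 y = f i.+1 x - s (dX i x)) \0.
- move=> x; case: aY => _; apply; by rewrite subr0 hf f0.
- move=> i s h; have [s' hs'] := projective_lift (f := f i.+1 \- (s \o dX i)) (pX (i := i)) h.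
  exists s'; split=> // x; case: aY => _; apply.
  by rewrite linearB hs' /= hf cX linear0 subr0 subrr.
exists s; split=> [x|i x]; first by rewrite s0.
case: (hs i) => -> _; by rewrite subrK.
Qed.

End Comparison.

(** * Independence of Tor from the resolution *)

Section HomogeneousMatrices.
Variables (k : fieldType) (R : comAlgType k) (gR : nat -> {pred R}).
Hypothesis hR : standard_graded gR.

Local Notation rc := (rc gR).

Definition is_hmx m n (s : 'I_m -> int) (t : 'I_n -> int) (A : 'M[R]_(m, n)) :=
  forall a b, A a b \in zgrade gR (s a - t b).

(** The degree zero part of a map between shifted free modules. It is compatible with products by
    homogeneous matrices, so chain maps and homotopies found without regard to gradings become
    graded once [hmx] is applied to their matrices. *)
Definition hmx m n (s : 'I_m -> int) (t : 'I_n -> int) (A : 'M[R]_(m, n)) :=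
  \matrix_(a, b) rc (s a - t b) (A a b).

Lemma hmxP m n s t (A : 'M[R]_(m, n)) : is_hmx s t (hmx s t A).
Proof. by move=> a b; rewrite mxE; apply: rc_in. Qed.

Lemma hmx_id m n s t (A : 'M[R]_(m, n)) : is_hmx s t A -> hmx s t A = A.
Proof. by move=> hA; apply/matrixP => a b; rewrite mxE; apply/rcP/hA. Qed.

Lemma hmxD m n s t (A B : 'M[R]_(m, n)) : hmx s t (A + B) = hmx s t A + hmx s t B.
Proof. by apply/matrixP => a b; rewrite !mxE rcD. Qed.

Lemma hmx_mull m n p s t u (D : 'M[R]_(m, n)) (A : 'M[R]_(n, p)) :
  is_hmx s t D -> hmx s u (D *m A) = D *m hmx t u A.
Proof.
move=> hD; apply/matrixP => a b; rewrite !mxE rc_sumD //.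
apply: eq_bigr => i _; rewrite mxE (rcM hR _ _ (hD a i)); congr (_ * rc _ _).
lia.
Qed.

Lemma hmx_mulr m n p s t u (A : 'M[R]_(m, n)) (D : 'M[R]_(n, p)) :
  is_hmx t u D -> hmx s u (A *m D) = hmx s t A *m D.
Proof.
move=> hD; apply/matrixP => a b; rewrite !mxE rc_sumD //.
apply: eq_bigr => i _; rewrite mxE (rcMr hR _ _ (hD i b)); congr (rc _ _ * _).
lia.
Qed.

Lemma is_hmxM m n p s t u (A : 'M[R]_(m, n)) (B : 'M[R]_(n, p)) :
  is_hmx s t A -> is_hmx t u B -> is_hmx s u (A *m B).
Proof. by move=> hA hB; rewrite -(hmx_id hB) -(hmx_mull _ _ hA); apply: hmxP. Qed.

Lemma is_hmx1 n (s : 'I_n -> int) : is_hmx s s 1%:M.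
Proof.
move=> a b; rewrite mxE; case: eqP => [->|_]; last by case: (zgrade_zmod hR (s a - s b)).
by rewrite subrr; have := zgradeA hR 1; rewrite scale1r.
Qed.

Lemma is_hmxB m n s t (A B : 'M[R]_(m, n)) :
  is_hmx s t A -> is_hmx s t B -> is_hmx s t (A - B).
Proof.
move=> hA hB a b; rewrite !mxE; case: (zgrade_zmod hR (s a - t b)) => _; apply.
  exact: hA.
exact: hB.
Qed.

(** Counterpart of [grading_scale] with the roles exchanged: the vector is homogeneous and the
    scalar arbitrary. *)
Lemma grading_scaler (E : lmodType R) (c : int -> E -> E) z w x v :
  grading gR c -> c w v = v -> c z (x *: v) = rc (z - w) x *: v.
Proof.
move=> hc hv; have [N /(_ (maxn N `|z - w|.+1) (leq_maxl _ _)) [hN _]] := rc_sum hR x.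
set n := maxn _ _ in hN.
rewrite {1}hN scaler_suml (grading_sumD hc).
have h (i : nat) : c z (rc i x *: v) = if i%:Z == z - w then rc i x *: v else 0.
  rewrite (grading_scale hc _ _ (rc_in hR i x)) -{1}hv (grading_idem hc) hv.
  have -> : (z - i%:Z == w) = (i%:Z == z - w) by apply/eqP/eqP; lia.
  by case: eqP; rewrite ?scaler0.
case: (leP 0 (z - w)) => hz; last first.
  rewrite [in RHS](rc_neg hR) // scale0r big1 // => i _; rewrite h ifN //.
  by apply/eqP => hi; move: hz; rewrite -hi.
have hl : (`|z - w| < n)%N by rewrite leq_max ltnSn orbT.
rewrite (bigD1 (Ordinal hl)) //= h gez0_abs // eqxx big1 ?addr0 // => i hi.
rewrite h ifN //; apply: contra hi => /eqP hi; rewrite -val_eqE /= -hi.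
by rewrite absz_nat.
Qed.

End HomogeneousMatrices.

Section ResolutionComplex.
Variables (k : fieldType) (R : comAlgType k) (gR : nat -> {pred R}).
Variables (M : lmodType R) (gM : int -> {pred M}) (F : free_resolution gR gM).

Definition aug_map (v : 'rV[R]_(rk F 0)) : M := \sum_b v 0 b *: aug b.

Lemma aug_map_is_linear : linear aug_map.
Proof.
move=> c u v; rewrite /aug_map scaler_sumr -big_split /=; apply: eq_bigr => i _.
by rewrite !mxE scalerDl scalerA.
Qed.

HB.instance Definition _ :=
  GRing.isLinear.Build R 'rV[R]_(rk F 0) M _ aug_map aug_map_is_linear.

Definition fr_module (i : nat) : lmodType R :=
  if i is i'.+1 then 'rV[R]_(rk F i') : lmodType R else M.

Definition fr_map (i : nat) : {linear fr_module i.+1 -> fr_module i} :=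
  match i with
  | 0%N => aug_map : {linear fr_module 1 -> fr_module 0}
  | i'.+1 => mulmxr (diff F i') : {linear fr_module i'.+2 -> fr_module i'.+1}
  end.

Lemma fr_complex i x : fr_map i (fr_map i.+1 x) = 0.
Proof.
case: i x => [|i] x /=; first by apply/aug_exact; exists x.
by apply/diff_exact; exists x.
Qed.

Lemma fr_projective i : projective (fr_module i.+1).
Proof. exact: projective_rV. Qed.

Lemma fr_acyclic : acyclic fr_map.
Proof.
split=> [m|]; first by have [v ->] := aug_surjective F m; exists v.
case=> [|i] y /=; first by move=> /aug_exact [w ->]; exists w.
by move=> /diff_exact [w ->]; exists w.
Qed.

Lemma diff_diff i : diff F i.+1 *m diff F i = 0.
Proof.
apply/row_matrixP => a; rewrite row_mul row0; apply/diff_exact.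
by exists (delta_mx 0 a); rewrite rowE.
Qed.

End ResolutionComplex.

Arguments aug_map {k R gR M gM} F v.

Section TorComparison.
Variables (k : fieldType) (R : comAlgType k) (gR : nat -> {pred R}).
Hypothesis hR : standard_graded gR.
Variables (M : lmodType R) (gM : int -> {pred M}).
Hypothesis hM : graded_module gR gM.

Lemma aug_map_hom (F : free_resolution gR gM) n (s : 'I_n -> int) (A : 'M[R]_(n, rk F 0)) a :
  aug_map F (row a (hmx gR s (@shift _ _ _ _ _ F 0) A)) =
  gcomp gM (s a) (aug_map F (row a A)).
Proof.
have gm := graded_module_grading hM.
rewrite /aug_map (grading_sumD gm); apply: eq_bigr => b _; rewrite !mxE.
rewrite (grading_scaler hR (w := shift b) _ _ gm) //.
apply/(gcomp_id (proj1 hM)); exact: aug_homogeneous.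
Qed.

Lemma graded_comparison (F G : free_resolution gR gM) :
  exists A : forall i, 'M[R]_(rk F i, rk G i),
    [/\ forall i, is_hmx gR (@shift _ _ _ _ _ F i) (@shift _ _ _ _ _ G i) (A i),
        forall i, diff F i *m A i = A i.+1 *m diff G i
      & forall v, aug_map G (v *m A 0%N) = aug_map F v].
Proof.
have [f [f0 hf]] := comparison (fr_complex (F := F)) (@fr_projective _ _ _ _ _ F)
  (@fr_acyclic _ _ _ _ _ G) (idfun : {linear M -> M}).
pose B i : 'M[R]_(rk F i, rk G i) := lin1_mx (f i.+1).
have hB i v : v *m B i = f i.+1 v by rewrite mul_rV_lin1.
exists (fun i => hmx gR (@shift _ _ _ _ _ F i) (@shift _ _ _ _ _ G i) (B i)); split.
- by move=> i; apply: hmxP.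
- move=> i; have hDF : is_hmx gR _ _ (diff F i) := @diff_homogeneous _ _ _ _ _ F i.
  have hDG : is_hmx gR _ _ (diff G i) := @diff_homogeneous _ _ _ _ _ G i.
  rewrite -(hmx_mull hR _ _ hDF) -(hmx_mulr hR _ _ hDG); congr (hmx _ _ _ _).
  apply/row_matrixP => a; rewrite !row_mul hB [row a (B _)]rowE hB [row a _]rowE.
  by rewrite -(hf i.+1 (delta_mx 0 a)).
- move=> v; rewrite [v]row_sum_delta mulmx_suml !linear_sum /=; apply: eq_bigr => a _.
  rewrite -scalemxAl !linearZ /=; congr (_ *: _); rewrite -rowE aug_map_hom rowE hB.
  have := hf 0%N (delta_mx 0 a) => /= ->; rewrite f0 /=.
  apply/(gcomp_id (proj1 hM)); rewrite /aug_map (bigD1 a) //= mxE !eqxx scale1r big1 ?addr0.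
    exact: aug_homogeneous.
  by move=> b hb; rewrite mxE eqxx (negPf hb) scale0r.
Qed.

Lemma graded_homotopy (F : free_resolution gR gM) (A : forall i, 'M[R]_(rk F i)) :
  (forall i, is_hmx gR (@shift _ _ _ _ _ F i) (@shift _ _ _ _ _ F i) (A i)) ->
  (forall i, diff F i *m A i = A i.+1 *m diff F i) ->
  (forall v, aug_map F (v *m A 0%N) = aug_map F v) ->
  exists s : forall i, 'M[R]_(rk F i, rk F i.+1),
    [/\ forall i, is_hmx gR (@shift _ _ _ _ _ F i) (@shift _ _ _ _ _ F i.+1) (s i),
        A 0%N - 1%:M = s 0%N *m diff F 0
      & forall i, A i.+1 - 1%:M = s i.+1 *m diff F i.+1 + diff F i *m s i].
Proof.
move=> hA hD h0.
pose f i : {linear fr_module F i -> fr_module F i} :=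
  match i with
  | 0%N => \0 : {linear fr_module F 0 -> fr_module F 0}
  | i'.+1 => mulmxr (A i' - 1%:M) : {linear fr_module F i'.+1 -> fr_module F i'.+1}
  end.
have [||s [s0 hs]] := comparison_homotopy (fr_complex (F := F)) (@fr_projective _ _ _ _ _ F)
  (@fr_acyclic _ _ _ _ _ F) (f := f).
- by [].
- case=> [|i] x /=; first by rewrite mulmxBr mulmx1 linearB /= h0 subrr.
  by rewrite -!mulmxA; congr (_ *m _); rewrite mulmxBl mulmxBr hD mul1mx mulmx1.
pose B i : 'M[R]_(rk F i, rk F i.+1) := lin1_mx (s i.+1).
have hB i v : v *m B i = s i.+1 v by rewrite mul_rV_lin1.
have hDF i : is_hmx gR _ _ (diff F i) := @diff_homogeneous _ _ _ _ _ F i.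
have hA1 i : hmx gR (@shift _ _ _ _ _ F i) (@shift _ _ _ _ _ F i) (A i - 1%:M) = A i - 1%:M.
  by apply: hmx_id => //; apply: is_hmxB => //; apply: is_hmx1.
exists (fun i => hmx gR (@shift _ _ _ _ _ F i) (@shift _ _ _ _ _ F i.+1) (B i)); split.
- by move=> i; apply: hmxP.
- rewrite -(hmx_mulr hR _ _ (hDF 0%N)) -hA1; congr (hmx _ _ _ _).
  apply/row_matrixP => a; rewrite row_mul [row a _]rowE [row a (B _)]rowE hB.
  by have := hs 0%N (delta_mx 0 a); rewrite s0 addr0.
- move=> i; rewrite -(hmx_mulr hR _ _ (hDF i.+1)) -(hmx_mull hR _ _ (hDF i)) -hmxD // -hA1.
  congr (hmx _ _ _ _); apply/row_matrixP => a; rewrite [in RHS]linearD /= !row_mul hB.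
  rewrite [row a (_ - _)]rowE [row a (B _)]rowE hB [row a _]rowE.
  exact: (hs i.+1 (delta_mx 0 a)).
Qed.

End TorComparison.

(** [f] induces an injection of [Z / B] into [Z' / B']: if [u *m f] lies in [B'], then [u *m f *m g]
    lies in [B], and [u] differs from it by an element of [B]. A homotopy on one side is thus enough
    for an inequality. *)
Lemma homology_rank_le (K : fieldType) (n n' r q r' q' : nat)
    (Z : 'M[K]_(r, n)) (B : 'M[K]_(q, n)) (Z' : 'M[K]_(r', n')) (B' : 'M[K]_(q', n'))
    (f : 'M[K]_(n, n')) (g : 'M[K]_(n', n)) :
  (B <= Z)%MS -> (B' <= Z')%MS -> (Z *m f <= Z')%MS -> (B' *m g <= B)%MS ->
  (forall u : 'rV_n, (u <= Z)%MS -> (u *m f *m g - u <= B)%MS) ->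
  (\rank Z - \rank B <= \rank Z' - \rank B')%N.
Proof.
move=> hB hB' hZ hg hfg; set Q := cokermx B'.
have h1 := mxrank_mul_ker Z (f *m Q).
have h2 := mxrank_mul_ker Z' Q.
have h3 : (\rank (Z :&: kermx (f *m Q))%MS <= \rank B)%N.
  apply/mxrankS/rV_subP => u; rewrite sub_capmx => /andP [uZ /sub_kermxP].
  rewrite mulmxA => /eqP; rewrite -submxE => uB'.
  have := hfg u uZ; have := submx_trans (submxMr g uB') hg => h h'.
  have -> : u = u *m f *m g - (u *m f *m g - u) by rewrite opprB addrC subrK.
  by rewrite addmx_sub // eqmx_opp.
have h4 : (\rank B' <= \rank (Z' :&: kermx Q)%MS)%N.
  apply: mxrankS; rewrite sub_capmx hB'; apply/sub_kermxP.
  by rewrite mulmx_coker.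
have h5 : (\rank (Z *m (f *m Q)) <= \rank (Z' *m Q))%N.
  by apply: mxrankS; rewrite mulmxA submxMr.
by move: h1 h2 h3 h4 h5; lia.
Qed.

Section TorInvariance.
Variables (k : fieldType) (R : comAlgType k) (gR : nat -> {pred R}).
Hypothesis hR : standard_graded gR.
Variables (M : lmodType R) (gM : int -> {pred M}).
Hypothesis hM : graded_module gR gM.

Definition residue_rmorphism : {rmorphism R -> k} :=
  HB.pack (residue gR)
    (GRing.isZmodMorphism.Build _ _ _ (residue_is_zmod_morphism hR))
    (GRing.isMonoidMorphism.Build _ _ _ (residue_is_monoid_morphism hR)).

Local Notation res := residue_rmorphism.

(** An entry between generators of different degrees is homogeneous of nonzero degree, so its
    residue is zero. *)
Lemma residue_hmx m n (s : 'I_m -> int) (t : 'I_n -> int) (A : 'M[R]_(m, n)) j :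
  is_hmx gR s t A ->
  diag_mx (\row_a (s a == j)%:R) *m map_mx res A =
  map_mx res A *m diag_mx (\row_b (t b == j)%:R).
Proof.
move=> hA; apply/matrixP => a b; rewrite mul_diag_mx mul_mx_diag !mxE.
have [h|h] := eqVneq (s a) (t b); first by rewrite h mulrC.
suff -> : res (A a b) = 0 by rewrite mul0r mulr0.
apply/(residue_eq0 hR); rewrite (rc_hom hR _ (hA a b)) ifN // eq_sym.
by rewrite subr_eq0.
Qed.

Lemma strand_idem (F : free_resolution gR gM) i j : strand F i j *m strand F i j = strand F i j.
Proof.
rewrite /strand mulmx_diag; congr diag_mx; apply/rowP => a; rewrite !mxE.
by case: eqP; rewrite ?mulr1 ?mulr0.
Qed.

Lemma sub_strand (F : free_resolution gR gM) i j m (u : 'M_(m, _)) :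
  (u <= strand F i j)%MS <-> u *m strand F i j = u.
Proof.
split=> [/submxP [v ->]|<-]; last exact: submxMl.
by rewrite -mulmxA strand_idem.
Qed.

Lemma tdiff_strand (F : free_resolution gR gM) i j :
  strand F i.+1 j *m tdiff F i = tdiff F i *m strand F i j.
Proof. by apply: residue_hmx; apply: diff_homogeneous. Qed.

Lemma tdiff_cycles (F : free_resolution gR gM) i : (tdiff F i <= cycles F i)%MS.
Proof.
case: i => [|i] /=; first exact: submx1.
apply/sub_kermxP; rewrite /tdiff -(map_mxM res) diff_diff.
exact: (map_mx0 res).
Qed.

(** Graded chain maps in both directions and the homotopy from their composite to the identity,
    reduced modulo the irrelevant ideal. Having degree zero, they respect every strand. *)
Lemma tor_comparison (F G : free_resolution gR gM) i :
  exists (f : 'M[k]_(rk F i, rk G i)) (g : 'M[k]_(rk G i, rk F i))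
         (g' : 'M[k]_(rk G i.+1, rk F i.+1)) (s : 'M[k]_(rk F i, rk F i.+1)),
  [/\ (cycles F i *m f <= cycles G i)%MS,
      tdiff G i *m g = g' *m tdiff F i,
      forall m (u : 'M_(m, _)), (u <= cycles F i)%MS -> u *m f *m g - u = u *m s *m tdiff F i
    & forall j, [/\ strand F i j *m f = f *m strand G i j,
       strand G i.+1 j *m g' = g' *m strand F i.+1 j
     & strand F i j *m s = s *m strand F i.+1 j]].
Proof.
have [A [hA DA augA]] := graded_comparison hR hM F G.
have [B [hB DB augB]] := graded_comparison hR hM G F.
have [||| s [hs s0 sS]] := graded_homotopy hR (F := F) (A := fun i => A i *m B i).
- by move=> l; apply: is_hmxM.
- by move=> l; rewrite mulmxA DA -mulmxA DB mulmxA.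
- by move=> v; rewrite mulmxA augB augA.
exists (map_mx res (A i)), (map_mx res (B i)), (map_mx res (B i.+1)), (map_mx res (s i)); split.
- case: i => [|i] /=; first exact: submx1.
  apply/sub_kermxP; rewrite /tdiff -mulmxA -(map_mxM res (A i.+1)) -DA (map_mxM res) mulmxA.
  by rewrite (mulmx_ker (map_mx res (diff F i))) mul0mx.
- by rewrite /tdiff -(map_mxM res) DB (map_mxM res).
- case: i => [|i] m u /= hu.
    rewrite -mulmxA -(map_mxM res) -{2}[u]mulmx1 -mulmxBr -(map_mx1 res) -(map_mxB res) s0.
    by rewrite (map_mxM res) mulmxA.
  rewrite -mulmxA -(map_mxM res) -{2}[u]mulmx1 -mulmxBr -(map_mx1 res) -(map_mxB res) sS.
  rewrite (map_mxD res) mulmxDr !(map_mxM res) !mulmxA.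
  have /sub_kermxP hu0 := hu.
  by rewrite [X in _ + X *m _]hu0 mul0mx addr0.
- by move=> j; split; apply: residue_hmx; [apply: hA|apply: hB|apply: hs].
Qed.

Lemma tor_dim_le (F G : free_resolution gR gM) i j : (tor_dim F i j <= tor_dim G i j)%N.
Proof.
have [f [g [g' [s [hf hg hs /(_ j) [sf sg ss]]]]]] := tor_comparison F G i.
have hst (H : free_resolution gR gM) : (strand H i.+1 j *m tdiff H i <= strand H i j :&: cycles H i)%MS.
  by rewrite sub_capmx {1}tdiff_strand submxMl /= mulmx_sub // tdiff_cycles.
apply: (homology_rank_le (f := f) (g := g)) => //.
- rewrite sub_capmx; apply/andP; split.
    apply/sub_strand; rewrite -mulmxA -sf mulmxA; congr (_ *m _).
    by apply/sub_strand; apply: capmxSl.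
  by apply: submx_trans hf; apply/submxMr/capmxSr.
- by rewrite -mulmxA hg mulmxA sg -mulmxA submxMl.
- move=> u; rewrite sub_capmx => /andP [/sub_strand us uc].
  by rewrite hs // -us -(mulmxA u) ss !mulmxA -mulmxA submxMl.
Qed.

Lemma total_tor_dim_le (F G : free_resolution gR gM) i :
  (total_tor_dim F i <= total_tor_dim G i)%N.
Proof.
have [f [g [g' [s [hf hg hs _]]]]] := tor_comparison F G i.
apply: (homology_rank_le (f := f) (g := g)) => //; try exact: tdiff_cycles.
  by rewrite hg submxMl.
by move=> u uc; rewrite hs // submxMl.
Qed.

Lemma bettiE (F : free_resolution gR gM) i j : betti gR gM i j = tor_dim F i j.
Proof.
rewrite /betti; case: xgetP => [_ -> [G ->]|/(_ (tor_dim F i j)) []]; last by exists F.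
by apply/eqP; rewrite eqn_leq !tor_dim_le.
Qed.

Lemma total_bettiE (F : free_resolution gR gM) i : total_betti gR gM i = total_tor_dim F i.
Proof.
rewrite /total_betti; case: xgetP => [_ -> [G ->]|/(_ (total_tor_dim F i)) []]; last by exists F.
by apply/eqP; rewrite eqn_leq !total_tor_dim_le.
Qed.

Definition minimal_resolution (F : free_resolution gR gM) :=
  forall i a b, irrelevant gR (diff F i a b).

Lemma minimal_tdiff (F : free_resolution gR gM) i : minimal_resolution F -> tdiff F i = 0.
Proof.
move=> hF; apply/matrixP => a b; rewrite !mxE.
by apply/(residue_eq0 hR)/(irrelevantP hR)/hF.
Qed.

Lemma minimal_tor_dim (F : free_resolution gR gM) i j : minimal_resolution F ->
  tor_dim F i j = \rank (strand F i j).
Proof.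
move=> hF; rewrite /tor_dim minimal_tdiff // mulmx0 mxrank0 subn0.
apply/eqmx_rank/andP; split; rewrite ?capmxSl // sub_capmx submx_refl /=.
case: i => [|i] /=; first exact: submx1.
by apply/sub_kermxP; rewrite minimal_tdiff // mulmx0.
Qed.

Lemma minimal_total_betti (F : free_resolution gR gM) i : minimal_resolution F ->
  total_betti gR gM i = rk F i.
Proof.
move=> hF; rewrite (total_bettiE F) /total_tor_dim minimal_tdiff // mxrank0 subn0.
case: i => [|i] /=; first by rewrite mxrank1.
by rewrite mxrank_ker minimal_tdiff // mxrank0 subn0.
Qed.

Lemma minimal_betti_shift (F : free_resolution gR gM) i a : minimal_resolution F ->
  betti gR gM i (shift (f := F) (i := i) a) <> 0%N.
Proof.
move=> hF; rewrite (bettiE F) minimal_tor_dim //; apply/eqP; rewrite mxrank_eq0.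
apply/eqP => /matrixP/(_ a a); rewrite !mxE !eqxx; apply/eqP.
exact: oner_neq0.
Qed.

Lemma minimal_betti_const (F : free_resolution gR gM) i j : minimal_resolution F ->
  (forall a, shift (f := F) (i := i) a = j) -> betti gR gM i j = rk F i.
Proof.
move=> hF hj; rewrite (bettiE F) minimal_tor_dim // -[RHS](mxrank1 k).
by congr (\rank _); apply/matrixP => a b; rewrite !mxE hj eqxx.
Qed.

Lemma minimal_betti_neq (F : free_resolution gR gM) i j : minimal_resolution F ->
  (forall a, shift (f := F) (i := i) a <> j) -> betti gR gM i j = 0%N.
Proof.
move=> hF hj; rewrite (bettiE F) minimal_tor_dim //; apply/eqP; rewrite mxrank_eq0.
apply/eqP/matrixP => a b; rewrite !mxE.
by case: eqP => [/hj|_] //; rewrite mul0rn.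
Qed.

End TorInvariance.

(** * Minimal graded free resolutions *)

Section MinimalGenerators.
Variables (k : fieldType) (R : comAlgType k) (gR : nat -> {pred R}).
Hypothesis hR : standard_graded gR.
Variables (E : lmodType R) (c : int -> E -> E) (hc : grading gR c).
Variables (N : set E) (hcN : homog c N).

Definition homog_generators (L : seq (int * E)) :=
  (forall q, q \in L -> c q.1 q.2 = q.2 /\ N q.2) /\ N `<=` lspan [seq q.2 | q <- L].

Lemma homog_generators_ex (s : seq E) :
  (forall x, x \in s -> N x) -> N `<=` lspan s -> exists L, homog_generators L.
Proof.
move=> hs hNs.
suff [L [hL sL]] : exists L : seq (int * E),
    (forall q, q \in L -> c q.1 q.2 = q.2 /\ N q.2) /\
    (forall x, x \in s -> lspan [seq q.2 | q <- L] x).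
  exists L; split=> // v /hNs hv; exact: (lspan_min (lspan_submod _) sL hv).
elim: s hs {hNs} => [|x s IHs] hs; first by exists [::].
have [L [hL sL]] : exists L : seq (int * E),
    (forall q, q \in L -> c q.1 q.2 = q.2 /\ N q.2) /\
    (forall x, x \in s -> lspan [seq q.2 | q <- L] x).
  by apply: IHs => y hy; apply: hs; rewrite inE hy orbT.
have [t [_ _ ht]] := grading_sum hc x.
exists ([seq (z, c z x) | z <- t] ++ L); split=> [q|y].
  rewrite mem_cat => /orP [/mapP [z _ ->] /=|/hL //].
  by rewrite (grading_idem hc) eqxx; split=> //; apply/hcN/hs/mem_head.
rewrite inE map_cat => /orP [/eqP ->|/sL]; last first.
  by apply: lspan_sub => z hz; rewrite mem_cat hz orbT.
rewrite [X in lspan _ X]ht big_seq; apply: submodset_sum => [|z hz]; first exact: lspan_submod.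
apply: lspan_mem; rewrite mem_cat; apply/orP; left; rewrite -map_comp.
by apply/mapP; exists z.
Qed.

(** Take a homogeneous generating list of least length. A relation with a coefficient of nonzero
    residue would express one generator through the others and shorten the list; this stands in for
    Nakayama's lemma. *)
Lemma minimal_generators (s : seq E) :
  (forall x, x \in s -> N x) -> N `<=` lspan s ->
  exists n (g : 'I_n -> E) (sh : 'I_n -> int),
    [/\ forall a, c (sh a) (g a) = g a, forall a, N (g a),
        forall v, N v -> exists w : 'rV[R]_n, v = \sum_a w 0 a *: g a
      & forall w : 'rV[R]_n, \sum_a w 0 a *: g a = 0 -> forall a, irrelevant gR (w 0 a)].
Proof.
move=> hs hNs; have [L0 hL0] := homog_generators_ex hs hNs.
pose Q d := `[< exists L, homog_generators L /\ size L = d >].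
have exQ : exists d, Q d by exists (size L0); apply/asboolP; exists L0.
case: (ex_minnP exQ) => n /asboolP [L [[hL sL] hn]] hmin {exQ hL0}.
pose g (a : 'I_n) : E := (nth (0, 0) L a).2.
pose sh (a : 'I_n) := (nth (0, 0) L a).1.
have memL (a : 'I_n) : nth (0, 0) L a \in L by rewrite mem_nth ?hn.
exists n, g, sh; split.
- by move=> a; case: (hL _ (memL a)).
- by move=> a; case: (hL _ (memL a)).
- move=> v /sL [e ->]; exists (\row_a e a); rewrite size_map hn; apply: eq_bigr => a _.
  by rewrite mxE (nth_map (0, 0)) ?hn.
move=> w hw a; apply/(irrelevantP hR); have [e he] := rc0P hR (w 0 a).
have [e0|e0] := eqVneq e 0; first by rewrite he e0 scale0r.
pose L' := [seq nth (0, 0) L b | b : 'I_n <- enum 'I_n & b != a].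
have sL' : (size L' < n)%N.
  have := count_predC (pred1 a) (enum 'I_n); rewrite size_enum_ord size_map size_filter.
  have : (0 < count (pred1 a) (enum 'I_n))%N.
    by rewrite -has_count; apply/hasP; exists a => //=; rewrite mem_enum.
  have -> : count (predC (pred1 a)) (enum 'I_n) = count (fun b => b != a) (enum 'I_n) by [].
  lia.
have : Q (size L'); last by move=> /hmin; rewrite leqNgt sL'.
apply/asboolP; exists L'; split=> //; split=> [q /mapP [b _ ->]|v /sL]; first exact: hL.
apply: lspan_min => [|x /mapP [q /(nthP (0, 0)) [b + <-] ->]]; first exact: lspan_submod.
rewrite hn => hb; pose b' := Ordinal hb.
have hL' (d : 'I_n) : d != a -> lspan [seq q.2 | q <- L'] (g d).
  move=> hd; apply/lspan_mem/mapP; exists (nth (0, 0) L d) => //.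
  by apply/mapP; exists d => //; rewrite mem_filter hd mem_enum.
have [hba|hba] := eqVneq b' a; last exact: (hL' b').
rewrite -[X in lspan _ X]/(g b') hba.
(* In degree [sh a] the coefficient of [g a] is cut down to its degree zero part, the invertible
   scalar [e]. *)
have := congr1 (c (sh a)) hw; rewrite (grading0 hc) (grading_sumD hc) (bigD1 a) //=.
have hgr d : c (sh a) (w 0 d *: g d) = rc gR (sh a - sh d) (w 0 d) *: g d.
  by apply: (grading_scaler hR) => //; case: (hL _ (memL d)).
rewrite hgr subrr he => /eqP; rewrite addr_eq0 => /eqP /(congr1 (fun x => (e^-1)%:A *: x)).
rewrite scalerA -scalerAl mul1r scalerA mulVf // scale1r scale1r => ->.
apply: submodsetZ; first exact: lspan_submod.
apply: submodsetN; first exact: lspan_submod.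
apply: submodset_sum => [|d hd]; first exact: lspan_submod.
by rewrite hgr; apply: submodsetZ; [exact: lspan_submod|exact: hL'].
Qed.

End MinimalGenerators.

Section MinimalResolution.
Variables (k : fieldType) (R : comAlgType k) (gR : nat -> {pred R}).
Hypothesis hR : standard_graded gR.

Definition presents n (N : set 'rV[R]_n) (sh : 'I_n -> int) n' (sh' : 'I_n' -> int)
    (D : 'M[R]_(n', n)) :=
  [/\ is_hmx gR sh' sh D, forall v, N v <-> exists w, v = w *m D
    & forall w : 'rV[R]_n', w *m D = 0 -> forall a, irrelevant gR (w 0 a)].

Lemma presents_hmx n (N : set 'rV[R]_n) sh n' sh' (D : 'M[R]_(n', n)) :
  presents N sh sh' D -> is_hmx gR sh' sh D.
Proof. by case. Qed.

Lemma minimal_presentation n (N : set 'rV[R]_n) (sh : 'I_n -> int) :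
  submodset N -> homog (rcrow gR sh) N ->
  exists n' (sh' : 'I_n' -> int) (D : 'M[R]_(n', n)), presents N sh sh' D.
Proof.
move=> hN hh.
have hn := noetherian_rV (b := n) (standard_graded_noetherian hR).
have [s [hs1 hs2]] := noetherian_fg hn hN.
have [n' [g [sh' [h1 h2 h3 h4]]]] := minimal_generators hR (rcrow_grading hR sh) hh hs1 hs2.
have hD (w : 'rV[R]_n') : w *m (\matrix_a g a) = \sum_a w 0 a *: g a.
  by rewrite mulmx_sum_row; apply: eq_bigr => a _; rewrite rowK.
exists n', sh', (\matrix_a g a); split.
- move=> a b; rewrite mxE; have /rowP/(_ b) := h1 a; rewrite mxE => <-.
  exact: rc_in.
- move=> v; split=> [/h3 [w ->]|[w ->]]; first by exists w.
  by rewrite hD; apply: submodset_sum => // a _; apply: submodsetZ.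
- by move=> w; rewrite hD; apply: h4.
Qed.

(* Two consecutive free modules of the resolution under construction; carrying
   both makes the ranks of successive stages agree by conversion. *)
Record stage := Stage {
  stage_n : nat;
  stage_sh : 'I_stage_n -> int;
  stage_n' : nat;
  stage_sh' : 'I_stage_n' -> int;
  stage_D : 'M[R]_(stage_n', stage_n);
  stage_hD : is_hmx gR stage_sh' stage_sh stage_D
}.

Definition mx_kernel n' n (D : 'M[R]_(n', n)) : set 'rV[R]_n' := [set v | v *m D = 0].

Lemma mx_kernel_submod n' n (D : 'M[R]_(n', n)) : submodset (mx_kernel D).
Proof.
split; first exact: mul0mx.
move=> a u v hu hv; rewrite /mx_kernel /= mulmxDl -scalemxAl.
by rewrite [u *m D]hu [v *m D]hv scaler0 addr0.
Qed.

Lemma rcrow_mul n' n (sh' : 'I_n' -> int) (sh : 'I_n -> int) (D : 'M[R]_(n', n)) z v :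
  is_hmx gR sh' sh D -> rcrow gR sh z (v *m D) = rcrow gR sh' z v *m D.
Proof.
move=> hD; have := hmx_mulr hR (fun _ : 'I_1 => z) v hD.
have h m (t : 'I_m -> int) u : hmx gR (fun _ : 'I_1 => z) t u = rcrow gR t z u.
  by apply/matrixP => a b; rewrite !mxE (ord1 a).
by rewrite !h.
Qed.

Lemma mx_kernel_homog n' n (sh' : 'I_n' -> int) (sh : 'I_n -> int) (D : 'M[R]_(n', n)) :
  is_hmx gR sh' sh D -> homog (rcrow gR sh') (mx_kernel D).
Proof.
move=> hD z v hv; rewrite /mx_kernel /= -(rcrow_mul _ _ hD) [v *m D]hv.
exact: (grading0 (rcrow_grading hR sh)).
Qed.

Record next_data (s : stage) := NextData {
  next_n : nat;
  next_sh : 'I_next_n -> int;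
  next_D : 'M[R]_(next_n, stage_n' s);
  next_presents : presents (mx_kernel (stage_D s)) (@stage_sh' s) next_sh next_D
}.

Lemma next_data_ex s : exists x : next_data s, True.
Proof.
have [n' [sh' [D hD]]] :=
  minimal_presentation (mx_kernel_submod (stage_D s)) (mx_kernel_homog (@stage_hD s)).
by exists (NextData hD).
Qed.

Definition next_stage_data s : next_data s := sval (cid (next_data_ex s)).

Definition next_stage s : stage :=
  Stage (presents_hmx (next_presents (next_stage_data s))).

Variables (M : lmodType R) (gM : int -> {pred M}).
Hypothesis hM : graded_module gR gM.

Lemma minimal_resolution_ex : fin_gen M ->
  exists F : free_resolution gR gM, minimal_resolution F.
Proof.
move=> [m [g0 hg0]].
have gm := graded_module_grading hM.
have hT : homog (gcomp gM) setT by [].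
have hS : [set: M] `<=` lspan [seq g0 a | a : 'I_m].
  move=> v _; have [e ->] := hg0 v.
  apply: submodset_sum => [|a _]; first exact: lspan_submod.
  apply: submodsetZ; first exact: lspan_submod.
  by apply/lspan_mem/map_f; rewrite mem_enum.
have [//|n [g [sh [h1 _ h3 h4]]]] := minimal_generators hR gm hT _ hS.
pose N : set 'rV[R]_n := [set v | \sum_a v 0 a *: g a = 0].
have hN : submodset N.
  split; first by rewrite /N /= big1 // => a _; rewrite mxE scale0r.
  move=> e u v hu hv; rewrite /N /=.
  under eq_bigr do rewrite !mxE scalerDl -scalerA.
  by rewrite big_split -scaler_sumr /= [X in e *: X]hu [X in _ + X]hv scaler0 addr0.
have hhN : homog (rcrow gR sh) N.
  move=> z v hv; rewrite /N /= -[RHS](grading0 gm z) -[in RHS]hv (grading_sumD gm).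
  by apply: eq_bigr => a _; rewrite mxE (grading_scaler hR z _ gm (h1 a)).
have [n' [sh' [D [hD1 hD2 hD3]]]] := minimal_presentation hN hhN.
pose st i := iter i next_stage (Stage hD1).
have hst i : presents (mx_kernel (stage_D (st i))) (@stage_sh' (st i))
    (@stage_sh' (st i.+1)) (stage_D (st i.+1)).
  exact: next_presents.
have hk i (w : 'rV[R]__) : w *m stage_D (st i) = 0 -> forall a, irrelevant gR (w 0 a).
  case: i w => [|i] w; first exact: hD3.
  by case: (hst i) => _ _; apply.
have dh i (a : 'I_(stage_n (st i.+1))) (b : 'I_(stage_n (st i))) :
    stage_D (st i) a b \in zgrade gR (@stage_sh (st i.+1) a - @stage_sh (st i) b).
  exact: stage_hD.
have ah b : g b \in gM (@stage_sh (st 0%N) b) by apply/(gcomp_id (proj1 hM)).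
have asurj x : exists v : 'rV[R]_(stage_n (st 0%N)), x = \sum_b v 0 b *: g b by apply: h3.
have aex (v : 'rV[R]_(stage_n (st 0%N))) :
    \sum_b v 0 b *: g b = 0 <-> exists w, v = w *m stage_D (st 0%N) by apply: hD2.
have dex i (v : 'rV[R]_(stage_n (st i.+1))) :
    v *m stage_D (st i) = 0 <-> exists w, v = w *m stage_D (st i.+1).
  by case: (hst i) => _ + _; apply.
exists (@FreeResolution k R gR M gM (fun i => stage_n (st i)) (fun i => @stage_sh (st i))
  (fun i => stage_D (st i)) g dh ah asurj aex dex).
case=> [|i] a b /=.
  have /(h4 _)/(_ b) : \sum_b (row a D) 0 b *: g b = 0.
    by apply/hD2; exists (delta_mx 0 a); rewrite rowE.
  by rewrite mxE.
have /(hk i)/(_ b) : row a (stage_D (st i.+1)) *m stage_D (st i) = 0.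
  by apply/dex; exists (delta_mx 0 a); rewrite rowE.
by rewrite mxE.
Qed.

Lemma irrelevant_linear m n (f : {linear 'rV[R]_m -> 'rV[R]_n}) (v : 'rV[R]_m) :
  (forall a, irrelevant gR (v 0 a)) -> forall b, irrelevant gR (f v 0 b).
Proof.
move=> hv b; rewrite [v]row_sum_delta linear_sum summxE.
apply: (submodset_sum (E := R^o)) => [|a _]; first exact: irrelevant_submod.
rewrite linearZ mxE mulrC.
by apply: (submodsetZ (E := R^o)); [exact: irrelevant_submod|exact: hv].
Qed.

(** The identity of [F] factors up to homotopy through the resolution [P], which vanishes beyond
    [n]. There the identity is a sum of composites with differentials of [F], whose entries are
    irrelevant, and a basis vector would put 1 into the irrelevant ideal. *)
Lemma minimal_resolution_length (F : free_resolution gR gM) n :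
  minimal_resolution F -> has_proj_resolution M n ->
  forall i, (n < i)%N -> rk F i = 0%N.
Proof.
move=> hF [P [d [e [hP he hde hdd hP0]]]] i hi.
pose X (i : nat) : lmodType R := if i is i'.+1 then P i' else M.
pose dX (i : nat) : {linear X i.+1 -> X i} :=
  match i with
  | 0%N => e : {linear X 1 -> X 0}
  | i'.+1 => d i' : {linear X i'.+2 -> X i'.+1}
  end.
have cX l x : dX l (dX l.+1 x) = 0.
  by case: l x => [|l] x /=; [apply/hde; exists x|apply/hdd; exists x].
have pX l : projective (X l.+1) := hP l.
have aX : acyclic dX.
  by split=> [|[|l] y /=]; [exact: he|move/hde|move/hdd].
have [f [f0 hf]] := comparison (fr_complex (F := F)) (@fr_projective _ _ _ _ _ F) aX
  (idfun : {linear M -> M}).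
have [g [g0 hg]] := comparison cX pX (@fr_acyclic _ _ _ _ _ F) (idfun : {linear M -> M}).
have [||s [_ hs]] := comparison_homotopy (fr_complex (F := F)) (@fr_projective _ _ _ _ _ F)
  (@fr_acyclic _ _ _ _ _ F) (f := fun l => (g l \o f l) \- idfun).
- by move=> x /=; rewrite f0 g0 /= subrr.
- by move=> l x; rewrite linearB /= hg hf.
case: i hi hs => [//|i] hi hs.
apply/eqP; rewrite -leqn0 leqNgt; apply/negP => hr; pose a := Ordinal hr.
have := hs i.+1 (delta_mx 0 a : fr_module F i.+2).
have f00 : f i.+2 (delta_mx 0 a : fr_module F i.+2) = 0 := hP0 _ hi _.
rewrite /= f00 linear0 sub0r => h.
apply: (irrelevant1 hR).
have -> : 1 = - ((- delta_mx 0 a : 'rV[R]_(rk F i.+1)) 0 a) by rewrite !mxE !eqxx opprK.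
apply: (submodsetN (E := R^o)); first exact: irrelevant_submod.
rewrite h mxE; apply: (submodsetD (E := R^o)); first exact: irrelevant_submod.
  rewrite mxE; apply: (submodset_sum (E := R^o)) => [|l _]; first exact: irrelevant_submod.
  by apply: (submodsetZ (E := R^o)); [exact: irrelevant_submod|exact: hF].
apply: irrelevant_linear => b; rewrite mxE.
apply: (submodset_sum (E := R^o)) => [|l _]; first exact: irrelevant_submod.
by apply: (submodsetZ (E := R^o)); [exact: irrelevant_submod|exact: hF].
Qed.

End MinimalResolution.

(** * Depth and the Auslander-Buchsbaum formula *)

(* The Koszul complex of [ys] as matrices: [kz i] goes from degree [i] to
   degree [i + 1], acts on the left, and multiplication by each member of [ys]
   is null-homotopic. *)
Record koszul_complex (R : comNzRingType) (ys : seq R) := KoszulComplex {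
  kz_rk : nat -> nat;
  kz : forall i, 'M[R]_(kz_rk i.+1, kz_rk i);
  kz_kz : forall i, kz i.+1 *m kz i = 0;
  kz_entry : forall i a b, lspan (E := R^o) ys (kz i a b);
  kz_rk0 : (0 < kz_rk 0)%N;
  kz_rk_top : (0 < kz_rk (size ys))%N;
  kz_rk_high : forall i, (size ys < i)%N -> kz_rk i = 0%N;
  kz_homotopy : forall y, y \in ys -> exists h : forall i, 'M[R]_(kz_rk i, kz_rk i.+1),
    h 0%N *m kz 0 = y%:M /\ forall i, h i.+1 *m kz i.+1 + kz i *m h i = y%:M
}.

Section KoszulExistence.
Variables (R : comNzRingType) (y : R) (ys : seq R) (K : koszul_complex ys).

Local Notation L := (kz_rk K).

(** The complex for [y :: ys] is the mapping cone of multiplication by [y] on the complex for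
    [ys]. *)
Definition cone_rk (i : nat) : nat := if i is i'.+1 then (L i'.+1 + L i')%N else L 0.

Definition cone_mx (i : nat) : 'M[R]_(cone_rk i.+1, cone_rk i) :=
  match i with
  | 0%N => col_mx (kz K 0) y%:M
  | i'.+1 => block_mx (kz K i'.+1) 0 y%:M (- kz K i')
  end.

Lemma cone_cone i : cone_mx i.+1 *m cone_mx i = 0.
Proof.
case: i => [|i] /=.
  by rewrite mul_block_col kz_kz mul0mx addr0 mul_scalar_mx mul_mx_scalar scalerN subrr col_mx0.
rewrite mulmx_block !kz_kz !mulmx0 !mul0mx !addr0 !mulNmx mulmxN opprK kz_kz addr0.
by rewrite mul_scalar_mx mul_mx_scalar addrN block_mx0.
Qed.

Lemma koszul_cons : exists K' : koszul_complex (y :: ys), True.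
Proof.
have sy : lspan (E := R^o) ys `<=` lspan (E := R^o) (y :: ys).
  by apply: lspan_sub => z hz; rewrite inE hz orbT.
have s0 : lspan (E := R^o) (y :: ys) 0 := lspan0 _.
have yy n (a b : 'I_n) : lspan (E := R^o) (y :: ys) (y%:M a b).
  by rewrite mxE; case: eqP => _ //; apply: (lspan_mem (E := R^o)); apply: mem_head.
have he i a b : lspan (E := R^o) (y :: ys) (cone_mx i a b).
  case: i a b => [|i] a b /=.
    by rewrite mxE; case: split => a' //; apply/sy/kz_entry.
  rewrite !mxE; case: split => a'; rewrite mxE; case: split => b' //.
  - exact/sy/kz_entry.
  - by rewrite mxE.
  - rewrite mxE; apply: (submodsetN (E := R^o)); first exact: lspan_submod.
    exact/sy/kz_entry.
have htop : (0 < cone_rk (size (y :: ys)))%N by rewrite /= addn_gt0 kz_rk_top orbT.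
have hhigh i : (size (y :: ys) < i)%N -> cone_rk i = 0%N.
  by case: i => [|i] //= hi; rewrite !kz_rk_high // ltnW.
have hh z : z \in y :: ys -> exists h : forall i, 'M[R]_(cone_rk i, cone_rk i.+1),
    h 0%N *m cone_mx 0 = z%:M /\ forall i, h i.+1 *m cone_mx i.+1 + cone_mx i *m h i = z%:M.
  rewrite inE => /orP [/eqP ->|/kz_homotopy - /(_ K) [h [h0 hS]]].
    (* For [y] itself the homotopy is the identity from the second summand of one cone module to the
       first summand of the preceding one. *)
    exists (fun i => match i return 'M[R]_(cone_rk i, cone_rk i.+1) with
      | 0%N => row_mx 0 1%:M
      | i'.+1 => block_mx 0 1%:M 0 0
      end); split=> [|i]; first by rewrite /= mul_row_col mul0mx mul1mx add0r.
    case: i => [|i] /=.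
      rewrite mulmx_block mul_col_row !mulmx0 !mulmx1 !mul0mx !mul1mx !add0r.
      by rewrite add_block_mx !add0r !addr0 addNr -scalar_mx_block.
    rewrite !mulmx_block !mulmx0 !mulmx1 !mul0mx !mul1mx !add0r !addr0.
    by rewrite add_block_mx !add0r !addr0 addNr -scalar_mx_block.
  (* For an earlier element the old homotopy acts on both summands, with a sign on the shifted
     one. *)
  exists (fun i => match i return 'M[R]_(cone_rk i, cone_rk i.+1) with
    | 0%N => row_mx (h 0%N) 0
    | i'.+1 => block_mx (h i'.+1) 0 0 (- h i')
    end); split=> [|i]; first by rewrite /= mul_row_col mul0mx addr0.
  case: i => [|i] /=.
    rewrite mulmx_block mul_col_row !mulmx0 !mul0mx !addr0 !add0r !mulNmx mulmxN opprK h0.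
    rewrite add_block_mx !addr0 hS mul_mx_scalar mul_scalar_mx addNr.
    by rewrite -scalar_mx_block.
  rewrite !mulmx_block !mulmx0 !mul0mx !addr0 !add0r !mulNmx !mulmxN !opprK.
  rewrite add_block_mx addr0 !hS mul_mx_scalar mul_scalar_mx addNr.
  by rewrite -scalar_mx_block.
by exists (@KoszulComplex R (y :: ys) cone_rk cone_mx cone_cone he (kz_rk0 K) htop hhigh hh).
Qed.

End KoszulExistence.

Lemma koszul_ex (R : comNzRingType) (ys : seq R) : exists K : koszul_complex ys, True.
Proof.
elim: ys => [|y ys [K _]]; last exact: (koszul_cons y K).
pose rk0 i := if i is 0%N then 1%N else 0%N.
have hh y : y \in [::] -> exists h : forall i, 'M[R]_(rk0 i, rk0 i.+1),
    h 0%N *m (0 : 'M_(rk0 1, rk0 0)) = y%:M /\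
    forall i, h i.+1 *m (0 : 'M_(rk0 i.+2, rk0 i.+1)) + (0 : 'M_(rk0 i.+1, rk0 i)) *m h i = y%:M.
  by [].
have h1 i : (0 : 'M[R]_(rk0 i.+2, rk0 i.+1)) *m (0 : 'M_(rk0 i.+1, rk0 i)) = 0 by rewrite mul0mx.
have h2 i a b : lspan (E := R^o) [::] ((0 : 'M_(rk0 i.+1, rk0 i)) a b).
  by rewrite mxE; apply: lspan0.
have h3 i : (size ([::] : seq R) < i)%N -> rk0 i = 0%N by case: i.
by exists (@KoszulComplex R [::] rk0 (fun i => 0) h1 h2 isT isT h3 hh).
Qed.

Section MxIn.
Variables (R : comNzRingType) (b : nat) (N : set 'rV[R]_b) (hN : submodset N).

(** Cochains with values in [R^b / N] are represented by matrices with [b] columns; [mx_in] says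
    that such a cochain is zero. *)
Definition mx_in m (c : 'M[R]_(m, b)) := forall a, N (row a c).

Lemma mx_inD m (c e : 'M[R]_(m, b)) : mx_in c -> mx_in e -> mx_in (c + e).
Proof. by move=> hc he a; rewrite linearD; exact: (submodsetD hN (hc a) (he a)). Qed.

Lemma mx_inB m (c e : 'M[R]_(m, b)) : mx_in c -> mx_in e -> mx_in (c - e).
Proof. by move=> hc he a; rewrite linearB; exact: (submodsetB hN (hc a) (he a)). Qed.

Lemma mx_inZ m x (c : 'M[R]_(m, b)) : mx_in c -> mx_in (x *: c).
Proof. by move=> hc a; rewrite linearZ; exact: (submodsetZ _ hN (hc a)). Qed.

Lemma mx_in_mull m n (A : 'M[R]_(n, m)) (c : 'M[R]_(m, b)) : mx_in c -> mx_in (A *m c).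
Proof.
move=> hc a; rewrite row_mul mulmx_sum_row; apply: submodset_sum => // i _.
exact: (submodsetZ _ hN (hc i)).
Qed.

Lemma mx_in0 m : mx_in (0 : 'M[R]_(m, b)).
Proof. by move=> a; rewrite row0; case: hN. Qed.

Definition add_mul (x : R) : set 'rV[R]_b := [set v | exists u w, N u /\ v = u + x *: w].

Lemma mx_in_add_mul x m (c : 'M[R]_(m, b)) :
  (forall a, add_mul x (row a c)) <-> exists e w, mx_in e /\ c = e + x *: w.
Proof.
split=> [h|[e [w [he ->]]] a]; last first.
  by exists (row a e), (row a w); split; [exact: he|rewrite linearD linearZ].
have /choice [u hu] := h; have /choice [w hw] := hu.
exists (\matrix_a u a), (\matrix_a w a); split=> [a|].
  by rewrite rowK; case: (hw a).
by apply/row_matrixP => a; rewrite linearD linearZ /= !rowK; case: (hw a).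
Qed.

End MxIn.

Section KoszulDepth.
Variables (R : comNzRingType) (ys : seq R) (K : koszul_complex ys).

Local Notation L := (kz_rk K).

Lemma kz_homotopy_ideal x : lspan (E := R^o) ys x ->
  exists h : forall i, 'M[R]_(L i, L i.+1),
    h 0%N *m kz K 0 = x%:M /\ forall i, h i.+1 *m kz K i.+1 + kz K i *m h i = x%:M.
Proof.
move=> [c ->].
have /choice [h hh] : forall j : 'I_(size ys), exists h : forall i, 'M[R]_(L i, L i.+1),
    h 0%N *m kz K 0 = (ys`_j)%:M /\ forall i, h i.+1 *m kz K i.+1 + kz K i *m h i = (ys`_j)%:M.
  by move=> j; apply/kz_homotopy/mem_nth.
have hs n : (\sum_(j < size ys) c j * ys`_j)%:M = \sum_(j < size ys) c j *: (ys`_j)%:M :> 'M[R]_n.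
  by rewrite raddf_sum; apply: eq_bigr => j _; rewrite scale_scalar_mx.
exists (fun i => \sum_(j < size ys) c j *: h j i); split=> [|i].
  rewrite [RHS]hs mulmx_suml; apply: eq_bigr => j _; rewrite -scalemxAl.
  by case: (hh j) => ->.
rewrite [RHS]hs mulmx_suml mulmx_sumr -big_split /=; apply: eq_bigr => j _.
by rewrite -scalemxAl -scalemxAr -scalerDr; case: (hh j) => _ ->.
Qed.

(** In degree 0 there is no incoming differential, so a coboundary is a cochain that vanishes modulo
    [N]. *)
Definition kz_boundary b (N : set 'rV[R]_b) (i : nat) : 'M[R]_(L i, b) -> Prop :=
  match i return 'M[R]_(L i, b) -> Prop with
  | 0%N => fun c => mx_in N c
  | j.+1 => fun c => exists g, mx_in N (c - kz K j *m g)
  end.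

(* The [i]-th Koszul cohomology of R^b / N vanishes. *)
Definition kz_vanish b (N : set 'rV[R]_b) (i : nat) :=
  forall c : 'M[R]_(L i, b), mx_in N (kz K i *m c) -> kz_boundary N c.

Definition kz_depth b (N : set 'rV[R]_b) (n : nat) := forall i, (i < n)%N -> kz_vanish N i.

Lemma kz_depth_le b (N : set 'rV[R]_b) m n : (m <= n)%N -> kz_depth N n -> kz_depth N m.
Proof. by move=> mn h i hi; apply: h; apply: leq_trans mn. Qed.

Lemma kz_depthS b (N : set 'rV[R]_b) n : kz_depth N n -> kz_vanish N n -> kz_depth N n.+1.
Proof. by move=> h hn i; rewrite ltnS leq_eqVlt => /orP [/eqP -> //|]; apply: h. Qed.

Definition regular_on b (N : set 'rV[R]_b) (x : R) := forall v, N (x *: v) -> N v.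

(** The long exact sequence of multiplication by [x] on [R^b / N], carried out on cochains. Since
    [x] lies in the ideal it acts as zero on Koszul cohomology, so the first nonvanishing degree
    drops by exactly one. *)
Lemma kz_depth_regular b (N : set 'rV[R]_b) x n :
  submodset N -> lspan (E := R^o) ys x -> regular_on N x ->
  (kz_depth N n.+1 <-> kz_depth (add_mul N x) n).
Proof.
move=> hN hx hreg; have [h [h0 hS]] := kz_homotopy_ideal hx.
have regM m (c : 'M_(m, b)) : mx_in N (x *: c) -> mx_in N c.
  by move=> hc a; apply: hreg; rewrite -linearZ; apply: hc.
split=> hd i hi.
- move=> c /mx_in_add_mul [e [u [he hc]]].
  have ku : mx_in N (kz K i.+1 *m u).
    apply: regM; rewrite scalemxAr.
    have -> : x *: u = kz K i *m c - e by rewrite hc addrC addKr.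
    rewrite mulmxBr mulmxA. rewrite (kz_kz K i) mul0mx; apply: mx_inB => //; first exact: mx_in0.
    exact: mx_in_mull.
  have [v hv] := hd i.+1 hi u ku.
  have hc' : mx_in N (kz K i *m (c - x *: v)).
    rewrite mulmxBr hc -scalemxAr -addrA -scalerBr; apply: mx_inD => //.
    exact: mx_inZ.
  have := hd i (leqW hi) _ hc'.
  clear hi e he hc ku hv hc'; case: i c u v => [|j] c u v /=.
    by move=> h'; apply/mx_in_add_mul; exists (c - x *: v), v; rewrite subrK.
  move=> [g hg]; exists g; apply/mx_in_add_mul.
  exists (c - x *: v - kz K j *m g), v; split=> //.
  by rewrite addrAC subrK.
- move=> c hc; case: i hi c hc => [|j] hi c hc /=.
    by apply: regM; rewrite -mul_scalar_mx -h0 -mulmxA; apply: mx_in_mull.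
  (* Modulo [N] the cochain [x *: c] is the coboundary of [h j *m c]. The latter is a cocycle modulo
     [add_mul N x], and vanishing there makes this coboundary [x] times another one; regularity
     cancels [x]. *)
  have hxc : mx_in N (x *: c - kz K j *m (h j *m c)).
    rewrite -mul_scalar_mx -(hS j) mulmxDl mulmxA addrK -mulmxA.
    exact: mx_in_mull.
  have hw : mx_in (add_mul N x) (kz K j *m (h j *m c)).
    apply/mx_in_add_mul; exists (- (x *: c - kz K j *m (h j *m c))), c; split.
      by rewrite -[- _]sub0r; apply: mx_inB => //; apply: mx_in0.
    by rewrite opprB subrK.
  have [v hv] : exists v, mx_in N (kz K j *m (h j *m c) - x *: (kz K j *m v)).
    have := hd j hi _ hw; case: j hi c hc hxc hw => [|l] hi c hc hxc hw /=.
      move=> /mx_in_add_mul [e [v [he ->]]]; exists v.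
      by rewrite mulmxDr -scalemxAr addrK; apply: mx_in_mull.
    move=> [g /mx_in_add_mul [e [v [he hev]]]]; exists v.
    rewrite (_ : _ - _ = kz K l.+1 *m e); first exact: mx_in_mull.
    have -> : e = h l.+1 *m c - kz K l *m g - x *: v by rewrite hev addrK.
    by rewrite !mulmxBr [_ *m (_ *m g)]mulmxA (kz_kz K l) mul0mx subr0 -scalemxAr.
  exists v; apply: regM; rewrite scalerBr.
  rewrite -[x *: c](subrK (kz K j *m (h j *m c))) -addrA.
  exact: mx_inD.
Qed.

(** Cohomology in degree 0 is the part of [R^b / N] killed by all of [ys]. *)
Lemma kz_depth1 b (N : set 'rV[R]_b) : submodset N ->
  (kz_depth N 1 <-> forall u, (forall y, y \in ys -> N (y *: u)) -> N u).
Proof.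
move=> hN; split=> [h1 u hu|h i]; last first.
  rewrite ltnS leqn0 => /eqP -> {i} c hc a; apply: h => y hy.
  have [h [h0 _]] := kz_homotopy K hy.
  rewrite -linearZ -mul_scalar_mx -h0 -mulmxA; exact: mx_in_mull.
pose c : 'M[R]_(L 0, b) := \matrix_a u.
have := h1 0%N isT c; rewrite /= => hc.
have /(_ (Ordinal (kz_rk0 K))) : mx_in N c; last by rewrite rowK.
apply: hc => a; rewrite row_mul mulmx_sum_row; apply: submodset_sum => // i _.
rewrite rowK mxE; have [e ->] := kz_entry a i.
rewrite scaler_suml; apply: submodset_sum => // j _.
rewrite -scalerA; apply: submodsetZ => //; exact/hu/mem_nth.
Qed.

Lemma mx_in_set0 m b (c : 'M[R]_(m, b)) : mx_in [set 0] c <-> c = 0.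
Proof.
split=> [h|-> a]; last by rewrite row0.
by apply/row_matrixP => a; rewrite row0; apply: h.
Qed.

Lemma kz_vanish_free b i : kz_vanish [set (0 : 'rV[R]_1)] i -> kz_vanish [set (0 : 'rV[R]_b)] i.
Proof.
move=> h c /mx_in_set0 hc.
have hcol j : kz_boundary [set 0] (col j c).
  by apply: h; apply/mx_in_set0; rewrite colE mulmxA hc mul0mx.
case: i {h hc} c hcol => [|i] c hcol /=.
  apply/mx_in_set0/matrixP => a j; have /mx_in_set0/colP/(_ a) := hcol j.
  by rewrite !mxE.
have /choice [g hg] := hcol; exists (\matrix_(a, j) g j a 0).
apply/mx_in_set0/matrixP => a j; have /mx_in_set0/colP/(_ a) := hg j.
by rewrite !mxE; under [in X in _ -> X]eq_bigr do rewrite mxE.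
Qed.

Lemma kz_vanish_free1 b i : (0 < b)%N ->
  kz_vanish [set (0 : 'rV[R]_b)] i -> kz_vanish [set (0 : 'rV[R]_1)] i.
Proof.
move=> hb h c /mx_in_set0 hc; pose j := Ordinal hb.
have := h (c *m delta_mx 0 j) _; case: i {h} c hc => [|i] c hc /= hh.
  have /mx_in_set0/matrixP h0 : mx_in [set 0] (c *m delta_mx (0 : 'I_1) j).
    by apply: hh; apply/mx_in_set0; rewrite mulmxA hc mul0mx.
  apply/mx_in_set0/matrixP => a e; have := h0 a j; rewrite !mxE big_ord1 !mxE !eqxx mulr1.
  by rewrite (ord1 e).
have [g /mx_in_set0/matrixP hg] : exists g, mx_in [set 0] (c *m delta_mx (0 : 'I_1) j - kz K i *m g).
  by apply: hh; apply/mx_in_set0; rewrite mulmxA hc mul0mx.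
exists (col j g); apply/mx_in_set0/matrixP => a e; have := hg a j.
rewrite !mxE big_ord1 !mxE !eqxx mulr1 (ord1 e) => h0; rewrite -[RHS]h0; congr (_ - _).
by apply: eq_bigr => l _; rewrite mxE.
Qed.

(** In top degree every cochain is a cocycle, while coboundaries have entries in the ideal; so the
    constant cochain 1 has a nonzero class. *)
Lemma kz_depth_bound n : ~ lspan (E := R^o) ys 1 ->
  kz_depth [set (0 : 'rV[R]_1)] n -> (n <= size ys)%N.
Proof.
move=> h1 hn; rewrite leqNgt; apply/negP => /hn.
have hz (c : 'M_(L (size ys).+1, 1)) : c = 0.
  by apply/matrixP => a; have := ltn_ord a; rewrite {2}kz_rk_high.
have a := Ordinal (kz_rk_top K).
move: (kz_rk_high K) hz a; case: (size ys) => [|j] hh hz a hv.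
  have := hv (const_mx 1); rewrite /= => /(_ _)/mx_in_set0/matrixP/(_ a 0).
  rewrite !mxE => h; apply: h1; rewrite h; first exact: lspan0.
  by apply/mx_in_set0; apply: hz.
have := hv (const_mx 1); rewrite /= => [] [].
  by apply/mx_in_set0; apply: hz.
move=> g /mx_in_set0/matrixP/(_ a 0); rewrite !mxE => /eqP; rewrite subr_eq0 => /eqP h.
apply: h1; rewrite h; apply: (submodset_sum (E := R^o)) => [|l _]; first exact: lspan_submod.
rewrite mulrC; apply: (submodsetZ (E := R^o)); first exact: lspan_submod.
exact: kz_entry.
Qed.

End KoszulDepth.

Section AuslanderBuchsbaum.
Variables (R : comNzRingType) (ys : seq R) (K : koszul_complex ys).
Variables (r : nat -> nat) (D : forall i, 'M[R]_(r i.+1, r i)) (p : nat).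
Hypothesis exactD : forall i (v : 'rV[R]_(r i.+1)),
  v *m D i = 0 <-> exists w, v = w *m D i.+1.
Hypothesis entryD : forall i a b, lspan (E := R^o) ys (D i a b).
Hypotheses (rp : (0 < r p)%N) (r_high : forall i, (p < i)%N -> r i = 0%N).

Local Notation L := (kz_rk K).
Local Notation depth_ge := (kz_depth K).

Definition mx_image i : set 'rV[R]_(r i) := [set v | exists w, v = w *m D i].

Lemma mx_image_submod i : submodset (@mx_image i).
Proof.
split=> [|a _ _ [u ->] [v ->]]; first by exists 0; rewrite mul0mx.
by exists (a *: u + v); rewrite mulmxDl scalemxAl.
Qed.

Lemma mx_in_imageP i m (c : 'M[R]_(m, r i)) : mx_in (@mx_image i) c <-> exists w, c = w *m D i.
Proof.
split=> [/choice [w hw]|[w ->] a]; last by exists (row a w); rewrite row_mul.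
by exists (\matrix_a w a); apply/row_matrixP => a; rewrite row_mul rowK.
Qed.

Lemma mx_exact i m (c : 'M[R]_(m, r i.+1)) : c *m D i = 0 -> mx_in (@mx_image i.+1) c.
Proof. by move=> hc a; apply/exactD; rewrite -row_mul hc row0. Qed.

Lemma image_mul0 i m (c : 'M[R]_(m, r i.+1)) : mx_in (@mx_image i.+1) c -> c *m D i = 0.
Proof. by move=> hc; apply/row_matrixP => a; rewrite row_mul row0; apply/exactD/hc. Qed.

Lemma kz_vanish_image i j :
  kz_vanish K (@mx_image i.+1) j.+1 -> kz_vanish K [set (0 : 'rV_(r i))] j ->
  kz_vanish K (@mx_image i) j.
Proof.
move=> hO hF c /mx_in_imageP [w hw].
have [g /image_mul0 hg] : exists g, mx_in (@mx_image i.+1) (w - kz K j *m g).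
  apply: hO; apply: mx_exact; rewrite -mulmxA -hw mulmxA kz_kz mul0mx //.
have {}hg : w *m D i = kz K j *m (g *m D i).
  by apply/eqP; rewrite -subr_eq0 mulmxA -mulmxBl hg.
have := hF (c - g *m D i) _.
case: j {hO hF} c w hw g hg => [|j] c w hw g hg /= h.
  apply/mx_in_imageP; exists g; apply/eqP; rewrite -subr_eq0; apply/eqP/mx_in_set0/h.
  by apply/mx_in_set0; rewrite mulmxBr hw hg subrr.
have [g' /mx_in_set0/eqP hg'] : exists g', mx_in [set 0] (c - g *m D i - kz K j *m g').
  by apply: h; apply/mx_in_set0; rewrite mulmxBr hw hg subrr.
exists g'; apply/mx_in_imageP; exists g.
by apply/eqP; rewrite -subr_eq0 addrAC.
Qed.

(* The cocycle [c D_i] is a coboundary either because the cohomology of the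
   free module vanishes or, when [D_(i+1) = 0], because [D_i] has entries in
   the ideal. *)
Lemma kz_vanish_coimage i j :
  (forall c : 'M[R]_(L j, r i.+1), mx_in (@mx_image i.+1) (kz K j *m c) ->
     kz_boundary [set 0] (c *m D i)) ->
  (forall l, j = l.+1 -> kz_vanish K (@mx_image i) l) ->
  kz_vanish K (@mx_image i.+1) j.
Proof.
move=> hB hV c hc; have := hB c hc; have := hV.
case: j {hB hV} c hc => [|j] c hc /= hV.
  by move/mx_in_set0/mx_exact.
move=> [g /mx_in_set0/eqP]; rewrite subr_eq0 => /eqP hg.
have hg1 : mx_in (@mx_image i) (kz K j *m g) by rewrite -hg; apply/mx_in_imageP; exists c.
have [v hv] : exists v, kz K j *m g = kz K j *m v *m D i.
  have := hV j erefl g hg1; case: j {hV} c hc g hg hg1 => [|j] c hc g hg hg1 /=.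
    by move/mx_in_imageP => [v ->]; exists v; rewrite mulmxA.
  move=> [g' /mx_in_imageP [v hv]]; exists v.
  by rewrite -mulmxA -hv mulmxBr mulmxA kz_kz mul0mx subr0.
exists v; apply: mx_exact.
by rewrite mulmxBl hg hv subrr.
Qed.

(** Expanding [D i] along [ys] turns [c *m D i] into a sum of multiples of a cocycle by elements of
    [ys], each of which is null-homotopic. *)
Lemma kz_boundary_ideal i j (c : 'M[R]_(L j, r i.+1)) :
  kz K j *m c = 0 -> kz_boundary [set 0] (c *m D i).
Proof.
move=> hc.
have /choice [e he] : forall ab : 'I_(r i.+1) * 'I_(r i), exists e : nat -> R,
    D i ab.1 ab.2 = \sum_(l < size ys) e l * ys`_l.
  by move=> ab; case: (entryD ab.1 ab.2) => e he; exists e.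
pose E (l : 'I_(size ys)) : 'M[R]_(r i.+1, r i) := \matrix_(a, b) e (a, b) l.
have hD : D i = \sum_(l < size ys) ys`_l *: E l.
  apply/matrixP => a b; rewrite (he (a, b)) summxE; apply: eq_bigr => l _.
  by rewrite !mxE mulrC.
have /choice [h hh] : forall l : 'I_(size ys), exists h : forall i, 'M[R]_(L i, L i.+1),
    h 0%N *m kz K 0 = (ys`_l)%:M /\ forall i, h i.+1 *m kz K i.+1 + kz K i *m h i = (ys`_l)%:M.
  by move=> l; apply/kz_homotopy/mem_nth.
rewrite hD mulmx_sumr; case: j c hc => [|j] c hc /=.
  apply/mx_in_set0; rewrite big1 // => l _.
  rewrite -scalemxAr scalemxAl -mul_scalar_mx; case: (hh l) => <- _.
  by rewrite -(mulmxA (h l _)) hc mulmx0 mul0mx.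
exists (\sum_(l < size ys) h l j *m c *m E l); apply/mx_in_set0.
rewrite mulmx_sumr -sumrB big1 // => l _.
rewrite -scalemxAr scalemxAl -mul_scalar_mx; case: (hh l) => _ <-.
by rewrite !mulmxDl -(mulmxA (h l j.+1) _ c) hc mulmx0 mul0mx add0r !mulmxA subrr.
Qed.

Lemma mx_image_top i : (p <= i)%N -> @mx_image i = [set 0].
Proof.
move=> hi; apply/seteqP; split=> v /=; last by move=> ->; exists 0; rewrite mul0mx.
move=> [w ->]; apply/rowP => j; rewrite !mxE big1 // => a _.
by have := ltn_ord a; rewrite {2}r_high.
Qed.

(* [mx_image i] is the image of [D i], so that [F_i / mx_image i] is the [i]-th
   syzygy module; passing to the next syzygy raises the depth by one. *)
Lemma kz_depth_syzygy q i n : (i + q = p)%N ->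
  depth_ge (@mx_image i) n <-> depth_ge [set (0 : 'rV[R]_1)] (n + q).
Proof.
elim: q i n => [|q IHq] i n.
  rewrite !addn0 => ->; rewrite mx_image_top //; split=> h j hj.
    exact: kz_vanish_free1 rp (h j hj).
  exact: kz_vanish_free (h j hj).
move=> hi; have {}IHq m := IHq i.+1 m (etrans (addSnnS _ _) hi).
split=> h; last first.
  move=> j hj; apply: kz_vanish_image.
    have /IHq h' : depth_ge [set (0 : 'rV[R]_1)] (n.+1 + q) by rewrite addSnnS.
    exact: h'.
  apply: kz_vanish_free; apply: h; apply: leq_trans hj _; exact: leq_addr.
suff /IHq : depth_ge (@mx_image i.+1) n.+1 by rewrite addSnnS.
suff : forall j, (j <= n.+1)%N -> depth_ge (@mx_image i.+1) j by apply.
elim=> [//|j IHj] hj; have {}IHj := IHj (ltnW hj).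
apply: kz_depthS => //; apply: kz_vanish_coimage => [c hc|l hl]; last first.
  by apply: h; rewrite -ltnS -hl.
(* For positive [q], depth [j] of the syzygy already gives [R] depth [j + q], so the free module has
   no cohomology in degree [j]. For [q = 0] the syzygy is free itself, and the entries of [D i] have
   to be used. *)
have [q0|q0] := posnP q.
  apply: kz_boundary_ideal; apply/mx_in_set0.
  by rewrite -(@mx_image_top i.+1) // -hi q0 addn1.
have hv : kz_vanish K [set (0 : 'rV[R]_(r i))] j.
  by apply: kz_vanish_free; have /IHq := IHj; apply; rewrite -[X in (X < _)%N]addn0 ltn_add2l.
apply: hv; apply/mx_in_set0; rewrite mulmxA; exact: image_mul0.
Qed.

End AuslanderBuchsbaum.

(** * Regular elements over an infinite field *)

Section RegularElement.
Variables (k : fieldType) (k_inf : infinite_set [set: k]).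
Variables (R : comAlgType k) (R_noeth : noetherian R^o).
Variables (b : nat) (N : set 'rV[R]_b) (hN : submodset N).

Definition colon (u : 'rV[R]_b) : set R^o := [set x : R^o | N ((x : R) *: u)].

Lemma colon_submod u : submodset (colon u).
Proof.
split=> [|a x y hx hy]; first by rewrite /colon /= scale0r; case: hN.
rewrite /colon /= scalerDl; apply: submodsetD => //.
by rewrite -scalerA; apply: submodsetZ.
Qed.

(** [colon u] is the annihilator of the class of [u] in [R^b / N]. A maximal one among those of
    nonzero classes is prime: an associated prime. *)
Definition maximal_colon u := ~ N u /\ forall w, ~ N w -> colon u `<=` colon w -> colon w `<=` colon u.

Lemma maximal_colon_ex u : ~ N u -> exists v, maximal_colon v /\ colon u `<=` colon v.
Proof.
move=> hu.
have [||I [[v [nv ->]] hI hmax]] := @noetherian_max R R^o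
  [set I | exists v, ~ N v /\ I = colon v] (colon u) R_noeth.
- by move=> I [v [_ ->]]; apply: colon_submod.
- by exists u.
by exists v; split=> //; split=> // w nw; apply: hmax; exists w.
Qed.

Lemma maximal_colon_prime u x y :
  maximal_colon u -> colon u (x * y) -> ~ colon u y -> colon u x.
Proof.
move=> [nu hmax] hxy ny.
apply: (hmax (y *: u) ny).
  by move=> z hz; rewrite /colon /= scalerA mulrC -scalerA; apply: submodsetZ.
by rewrite /colon /= scalerA.
Qed.

Lemma maximal_colon_prod u m (x : 'I_m -> R) :
  maximal_colon u -> (forall j, ~ colon u (x j)) -> ~ colon u (\prod_j x j).
Proof.
move=> hu hx; elim: m x hx => [|m IHm] x hx.
  by rewrite big_ord0 /colon /= scale1r; case: hu.
by rewrite big_ord_recl => /(maximal_colon_prime hu) h; apply: (hx ord0); apply: h; apply: IHm.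
Qed.

Lemma noetherian_stable (u : nat -> 'rV[R]_b) : exists m, forall i,
  exists n (c : nat -> R), N n /\ u i = n + \sum_(j < m) c j *: u j.
Proof.
pose S m : set 'rV[R]_b := [set v | exists n w, [/\ N n, lspan (mkseq u m) w & v = n + w]].
have hS m : submodset (S m).
  split=> [|a _ _ [n [w [hn hw ->]]] [n' [w' [hn' hw' ->]]]].
    by exists 0, 0; rewrite addr0; split=> //; [case: hN|exact: lspan0].
  exists (a *: n + n'), (a *: w + w'); split; first by case: hN => _; apply.
    by case: (lspan_submod (mkseq u m)) => _; apply.
  by rewrite scalerDr addrACA.
have mS m m' : (m <= m')%N -> S m `<=` S m'.
  move=> mm v [n [w [hn hw ->]]]; exists n, w; split=> //.
  by apply: lspan_sub hw; apply: mkseq_subset.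
pose T : set 'rV[R]_b := [set v | exists m, S m v].
have hT : submodset T.
  split=> [|a v w [m hv] [m' hw]]; first by exists 0%N; case: (hS 0%N).
  exists (maxn m m'); case: (hS (maxn m m')) => _; apply.
    exact: mS (leq_maxl _ _) _ hv.
  exact: mS (leq_maxr _ _) _ hw.
have [s [hs1 hs2]] := noetherian_fg (noetherian_rV (b := b) R_noeth) hT.
have [m hm] : exists m, forall x, x \in s -> S m x.
  elim: s hs1 {hs2} => [|x s IHs] hs; first by exists 0%N.
  have [m hm] : exists m, forall x, x \in s -> S m x.
    by apply: IHs => y hy; apply: hs; rewrite inE hy orbT.
  have [m' hm'] := hs x (mem_head _ _).
  exists (maxn m m') => y; rewrite inE => /orP [/eqP ->|/hm].
    exact: mS (leq_maxr _ _) _ hm'.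
  exact: mS (leq_maxl _ _) _.
exists m => i.
have [n [w [hn [c hc] hi]]] : S m (u i).
  apply: (lspan_min (hS m) hm); apply: hs2; exists i.+1, 0, (u i); rewrite add0r.
  by split=> //; [case: hN|apply/lspan_mem/mkseq_mem].
exists n, c; split=> //; rewrite hi hc size_mkseq; congr (_ + _).
by apply: eq_bigr => j _; rewrite nth_mkseq.
Qed.

(** A linear form taken on the moment curve: any [size ys] of them with distinct parameters have an
    invertible Vandermonde matrix and so generate the same ideal as [ys]. *)
Definition moment (ys : seq R) (t : k) : R := \sum_(i < size ys) t ^+ i *: ys`_i.

Lemma moment_span (I : set R^o) (ys : seq R) (t : 'I_(size ys) -> k) :
  submodset I -> injective t -> (forall l, I (moment ys (t l))) ->
  forall y, y \in ys -> I y.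
Proof.
move=> hI ht hm.
pose V := Vandermonde (size ys) (\row_l t l).
have hV : V \in unitmx.
  rewrite unitmxE unitfE det_Vandermonde; apply/prodf_neq0 => i _; apply/prodf_neq0 => j hij.
  rewrite !mxE subr_eq0; apply/eqP => /ht h; move: hij; rewrite h ltnn //.
move=> y /(nthP 0) [i hi <-]; pose i' := Ordinal hi.
suff -> : ys`_i = \sum_l (invmx V l i')%:A * moment ys (t l).
  by apply: (submodset_sum (E := R^o)) => // l _; apply: (submodsetZ (E := R^o)).
under eq_bigr do rewrite mulr_algl /moment scaler_sumr.
rewrite exchange_big /= (bigD1 i') //= [X in _ + X]big1 ?addr0 => [|j hj].
  under eq_bigr do rewrite scalerA.
  rewrite -scaler_suml.
  suff -> : \sum_l invmx V l i' * t l ^+ i = 1 by rewrite scale1r.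
  have /matrixP/(_ i' i') := mulmxV hV; rewrite !mxE eqxx => h; apply: etrans h.
  by apply: eq_bigr => l _; rewrite !mxE mulrC.
under eq_bigr do rewrite scalerA.
rewrite -scaler_suml.
suff -> : \sum_l invmx V l i' * t l ^+ j = 0 by rewrite scale0r.
have /matrixP/(_ j i') := mulmxV hV; rewrite !mxE (negPf hj) => h; apply: etrans h.
by apply: eq_bigr => l _; rewrite !mxE mulrC.
Qed.

Lemma pigeonhole (T : finType) m s (f : T -> 'I_m) : (m * s < #|T|)%N ->
  exists j, (s <= #|[pred i | f i == j]|)%N.
Proof.
move=> hT; apply: contrapT => h.
have hj j : (#|[pred i | f i == j]| <= s)%N.
  by rewrite leqNgt; apply/negP => hj; apply: h; exists j; apply: ltnW.
move: hT; rewrite ltnNge => /negP; apply.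
rewrite -sum1_card (partition_big f xpredT) //= -[X in (_ <= X * _)%N]card_ord -sum_nat_const.
by apply: leq_sum => j _; have := hj j; rewrite -sum1_card.
Qed.

(* The [moment ys t] are infinitely many linear forms.  If all of them were zero
   divisors, finitely many maximal annihilators would contain them all, so one
   of these would contain [size ys] of them and hence, by Vandermonde, [ys]. *)
Lemma regular_element (ys : seq R) :
  (forall u, (forall y, y \in ys -> N (y *: u)) -> N u) ->
  exists x, lspan (E := R^o) ys x /\ regular_on N x.
Proof.
move=> hsoc; apply: contrapT => hreg.
have hmom t : lspan (E := R^o) ys (moment ys t).
  apply: (submodset_sum (E := R^o)) => [|i _]; first exact: lspan_submod.
  rewrite -mulr_algl; apply: (submodsetZ (E := R^o)); first exact: lspan_submod.
  exact/(lspan_mem (E := R^o))/mem_nth.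
have /choice [v hv] : forall t, exists v, maximal_colon v /\ colon v (moment ys t).
  move=> t; have [u [hu nu]] : exists u, N (moment ys t *: u) /\ ~ N u.
    apply: contrapT => h; apply: hreg; exists (moment ys t); split=> // u hu.
    by apply: contrapT => nu; apply: h; exists u.
  by have [v [hv huv]] := maximal_colon_ex nu; exists v; split=> //; apply: huv.
have [t tinj] : exists t : nat -> k, injective t.
  have /seq_choice [t ht] : forall s : seq k, exists x, x \notin s.
    move=> s; apply: contrapT => hs; apply: k_inf; apply/finite_seqP; exists s.
    apply/seteqP; split=> // x _ /=; apply: contrapT => /negP hx.
    by apply: hs; exists x.
  have hlt i j : (i < j)%N -> t i <> t j.
    by move=> hij h; have := ht j; rewrite -h => /negP; apply; apply: map_f; rewrite mem_iota.
  exists t => i j hij; case: (ltngtP i j) => // /hlt; [by case|].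
  by rewrite hij; case.
pose u i := v (t i).
have [m hm] := noetherian_stable u.
(* Otherwise pick in each of the first [m] annihilators an element outside that of [u i]. Their
   product kills [u i], a combination of the [u j] modulo [N], against primality. Maximality turns
   the inclusion into an equality. *)
have /choice [f hf] : forall i, exists j : 'I_m, colon (u j) = colon (u i).
  move=> i; have hui := (hv (t i)).1.
  have [j hj] : exists j : 'I_m, colon (u j) `<=` colon (u i).
    apply: contrapT => h.
    have /choice [x hx] : forall j : 'I_m, exists x, colon (u j) x /\ ~ colon (u i) x.
      move=> j; apply: contrapT => h'; apply: h; exists j => x hx.
      by apply: contrapT => nx; apply: h'; exists x.
    apply: (maximal_colon_prod hui (x := x)) => [j|]; first by case: (hx j).
    have [n [c [hn hi]]] := hm i; rewrite -/(u i) hi.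
    rewrite /colon /= scalerDr; apply: submodsetD => //; first exact: submodsetZ.
    rewrite scaler_sumr; apply: submodset_sum => // j _.
    rewrite (bigD1 j) //= scalerA -mulrA mulrC -scalerA.
    by have [hxj _] := hx j; apply: submodsetZ.
  exists j; apply/seteqP; split=> //.
  by case: (hv (t j)).1 => _; apply=> //; case: hui.
(* With [m * size ys + 1] parameters, one annihilator contains at least [size ys] of the forms,
   enough for [moment_span]. *)
have [|j hj] := @pigeonhole 'I_(m * size ys).+1 m (size ys) (fun i => f i).
  by rewrite card_ord.
pose e := enum [pred i : 'I_(m * size ys).+1 | f i == j].
have he : (size ys <= size e)%N by rewrite -cardE.
pose tt (l : 'I_(size ys)) := t (nth ord0 e l).
have httinj : injective tt.
  move=> l l' /tinj/val_inj/eqP; rewrite nth_uniq ?enum_uniq // ?(leq_trans (ltn_ord _)) //.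
  by move/eqP/val_inj.
have hcol : forall y, y \in ys -> colon (u j) y.
  apply: (moment_span (colon_submod _) httinj) => l.
  have : nth ord0 e l \in e by rewrite mem_nth // (leq_trans (ltn_ord _)).
  rewrite mem_enum inE => /eqP <-; rewrite hf.
  by case: (hv (tt l)).
have [nu _] := (hv (t j)).1.
by apply: nu; apply: hsoc.
Qed.

End RegularElement.

Lemma max_natE (P : set nat) n : P n -> (forall m, P m -> (m <= n)%N) -> max_nat P = n.
Proof.
move=> hn hmax; rewrite /max_nat; case: xgetP => [m -> [hm hm']|/(_ n) []] //.
by apply/eqP; rewrite eqn_leq hmax // hm'.
Qed.

Section DepthKoszul.
Variables (k : fieldType) (k_inf : infinite_set [set: k]).
Variables (R : comAlgType k) (gR : nat -> {pred R}) (hR : standard_graded gR).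
Variables (ys : seq R) (hys : forall x, irrelevant gR x <-> lspan (E := R^o) ys x).
Variable K : koszul_complex ys.
Variables (M : lmodType R) (b : nat) (f : {linear 'rV[R]_b -> M}).
Hypothesis f_surj : forall m, exists v, f v = m.

(** Presents [M / (s) M] as a quotient of [R^b], so that appending an element to [s] becomes
    [add_mul]. *)
Definition seq_mul_preimage (s : seq R) : set 'rV[R]_b := [set v | seq_mul s (f v)].

Lemma seq_mul_submod s : submodset (seq_mul (M := M) s).
Proof.
split=> [|a _ _ [u ->] [v ->]].
  by exists (fun=> 0); rewrite big1 // => i _; rewrite scaler0.
exists (fun i => a *: u i + v i); rewrite scaler_sumr -big_split; apply: eq_bigr => i _ /=.
by rewrite scalerDr !scalerA mulrC.
Qed.

Lemma seq_mul_preimage_submod s : submodset (seq_mul_preimage s).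
Proof.
have [h0 h1] := seq_mul_submod s.
split=> [|a u v hu hv]; rewrite /seq_mul_preimage /=; first by rewrite linear0.
by rewrite linearP; apply: h1.
Qed.

Lemma seq_mul_preimage_nil : seq_mul_preimage [::] = [set v | f v = 0].
Proof.
apply/seteqP; split=> v /=; rewrite /seq_mul_preimage /seq_mul /=.
  by move=> [e]; rewrite big_ord0.
by move=> ->; exists (fun=> 0); rewrite big_ord0.
Qed.

Lemma seq_mul_preimage_rcons s x :
  seq_mul_preimage (rcons s x) = add_mul (seq_mul_preimage s) x.
Proof.
have hsum (e : nat -> M) : \sum_(i < size (rcons s x)) (rcons s x)`_i *: e i =
    \sum_(i < size s) s`_i *: e i + x *: e (size s).
  rewrite size_rcons big_ord_recr /= nth_rcons ltnn eqxx; congr (_ + _).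
  by apply: eq_bigr => i _; rewrite nth_rcons ltn_ord.
apply/seteqP; split=> v.
  move=> [e]; rewrite hsum => he; have [w hw] := f_surj (e (size s)).
  exists (v - x *: w), w; rewrite subrK; split=> //; exists e.
  by rewrite linearB linearZ /= hw he addrK.
move=> [u [w [[e he] ->]]]; pose e' i := if i == size s then f w else e i.
exists e'; rewrite (hsum e') {2}/e' eqxx linearD linearZ /= he; congr (_ + _); apply: eq_bigr => i _.
by rewrite /e' ifN // neq_ltn ltn_ord.
Qed.

Lemma kz_depth_regular_seq s : (forall x, x \in s -> irrelevant gR x) ->
  regular_seq M s -> kz_depth K [set v | f v = 0] (size s).
Proof.
move=> hs [hreg _].
(* Backwards along [s]: modulo all but its last [j] members the Koszul depth is at least [j]. *)
have hj j : (j <= size s)%N -> kz_depth K (seq_mul_preimage (take (size s - j) s)) j.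
  elim: j => [//|j IHj] hj; set i := (size s - j.+1)%N.
  have hi : (i < size s)%N by rewrite /i; lia.
  apply/(@kz_depth_regular _ _ K _ _ s`_i).
  - exact: seq_mul_preimage_submod.
  - by apply/hys/hs/mem_nth.
  - move=> v hv; apply: (hreg i (f v) hi).
    by have := hv; rewrite /seq_mul_preimage /= linearZ.
  - have := IHj (ltnW hj); have -> : (size s - j)%N = i.+1 by rewrite /i; lia.
    by rewrite (take_nth 0 hi) seq_mul_preimage_rcons.
have := hj (size s) (leqnn _); by rewrite subnn take0 seq_mul_preimage_nil.
Qed.

Lemma regular_seq_kz_depth n : kz_depth K [set v | f v = 0] n ->
  exists s, [/\ size s = n, forall x, x \in s -> irrelevant gR x
    & forall i (m : M), (i < size s)%N -> seq_mul (take i s) (s`_i *: m) -> seq_mul (take i s) m].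
Proof.
rewrite -seq_mul_preimage_nil => hn.
suff [s [sn hs hreg]] : exists s, [/\ size s = n, forall x, x \in s -> irrelevant gR x
    & forall i, (i < size s)%N -> regular_on (seq_mul_preimage ([::] ++ take i s)) s`_i].
  exists s; split=> // i m hi; have [v <-] := f_surj m; rewrite -linearZ; exact: hreg.
(* The prefix [t] already divided out is generalised, because each new element is regular modulo
   it. *)
elim: n [::] hn => [|n IHn] t hn; first by exists [::].
have ht := seq_mul_preimage_submod t.
have [|x [hx xreg]] := regular_element k_inf (standard_graded_noetherian hR) ht (ys := ys).
  by apply/(kz_depth1 K ht)/(kz_depth_le _ hn).
have /(kz_depth_regular K n ht hx xreg) := hn.
rewrite -seq_mul_preimage_rcons => /IHn [s [sn hs hreg]].
exists (x :: s); split=> [|y|i]; first by rewrite /= sn.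
  by rewrite inE => /orP [/eqP ->|/hs //]; apply/hys.
case: i => [|i] hi /=; first by rewrite cats0.
by rewrite -cat_rcons; apply: hreg.
Qed.

(** A regular sequence must also leave a nonzero quotient. A generator of [M] lying in [(s) M] would
    lift to a kernel vector of [f] whose entry, irrelevant by hypothesis, is 1 minus an irrelevant
    element. *)
Lemma depthE e : (0 < b)%N ->
  (forall v, f v = 0 -> forall a, irrelevant gR (v 0 a)) ->
  (forall n, kz_depth K [set v | f v = 0] n <-> (n <= e)%N) ->
  depth gR M = e.
Proof.
move=> hb hker he; apply: max_natE => [|n [s [<- hs hreg]]]; last first.
  by apply/he; apply: kz_depth_regular_seq.
have /he/regular_seq_kz_depth [s [sn hs hreg]] := leqnn e.
exists s; split=> //; split=> //; pose a := Ordinal hb; exists (f (delta_mx 0 a)) => [[u hu]].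
have /choice [w hw] : forall i, exists v, f v = u i by move=> i; apply: f_surj.
have : f (delta_mx 0 a - \sum_(i < size s) s`_i *: w i) = 0.
  rewrite linearB linear_sum hu; apply/eqP; rewrite subr_eq0; apply/eqP.
  by apply: eq_bigr => i _; rewrite linearZ /= hw.
move=> /hker/(_ a); rewrite !mxE !eqxx summxE => h; apply: (irrelevant1 hR).
rewrite -[1%R](subrK (\sum_(i < size s) (s`_i *: w i) 0 a)).
have hi := irrelevant_submod hR.
apply: (submodsetD (E := R^o)) => //; apply: (submodset_sum (E := R^o)) => // i _.
rewrite mxE mulrC; apply: (submodsetZ (E := R^o)) => //; exact/hs/mem_nth.
Qed.

End DepthKoszul.

Section GradedAuslanderBuchsbaum.
Variables (k : fieldType) (k_inf : infinite_set [set: k]).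
Variables (R : comAlgType k) (gR : nat -> {pred R}) (hR : standard_graded gR).
Variables (M : lmodType R) (gM : int -> {pred M}) (hM : graded_module gR gM).

Lemma auslander_buchsbaum (F : free_resolution gR gM) p :
  minimal_resolution F -> (0 < rk F 0)%N -> (0 < rk F p)%N ->
  (forall i, (p < i)%N -> rk F i = 0%N) ->
  depth gR R^o = (depth gR M + p)%N.
Proof.
move=> hF r0 rp rhigh.
have [ys [ys1 _ hys]] := standard_graded_generators hR.
have [K _] := koszul_ex ys.
have hent i a b : lspan (E := R^o) ys (diff F i a b) by apply/hys/hF.
have hAB n : kz_depth K (@mx_image R (rk F) (diff F) 0) n <->
    kz_depth K [set (0 : 'rV[R]_1)] (n + p).
  exact: (@kz_depth_syzygy R ys K (rk F) (diff F) p (fun i v => diff_exact v) hent rp rhigh p 0 n).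
pose Q n := `[< kz_depth K [set (0 : 'rV[R]_1)] n >].
have hbound n : Q n -> (n <= size ys)%N.
  move/asboolP; apply: kz_depth_bound => /hys; exact: irrelevant1.
have exQ : exists n, Q n by exists 0%N; apply/asboolP.
case: (ex_maxnP exQ hbound) => e /asboolP he hmax.
have hQ n : kz_depth K [set (0 : 'rV[R]_1)] n <-> (n <= e)%N.
  by split=> [h|h]; [apply/hmax/asboolP|apply: kz_depth_le he].
(* Depth at least 0 is vacuous, and the shift in [hAB] turns it into depth at least [p] for [R]. *)
have pe : (p <= e)%N by apply/hQ; apply/(hAB 0%N).
have -> : depth gR M = (e - p)%N.
  apply: (@depthE k k_inf R gR hR ys hys K M (rk F 0) (aug_map F)) => // [m|v /aug_exact [w ->] a|n].
  - by have [v ->] := aug_surjective F m; exists v.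
  - rewrite mxE; apply: (submodset_sum (E := R^o)) => [|l _]; first exact: irrelevant_submod.
    by apply: (submodsetZ (E := R^o)); [exact: irrelevant_submod|exact: hF].
  - have -> : [set v | aug_map F v = 0] = @mx_image R (rk F) (diff F) 0.
      by apply/seteqP; split=> v /=; [move/aug_exact|move=> h; apply/aug_exact].
    by rewrite leq_subRL // addnC; apply: (iff_trans (hAB n)).
rewrite subnK //.
have lf : linear (fun v : 'rV[R]_1 => v 0 0 : R^o) by move=> c u v; rewrite !mxE.
pose f : {linear 'rV[R]_1 -> R^o} := HB.pack (fun v : 'rV[R]_1 => v 0 0 : R^o)
  (GRing.isLinear.Build _ _ _ _ _ lf).
have f0 v : f v = 0 -> v = 0.
  by move=> h; apply/rowP => a; rewrite (ord1 a) mxE; apply: h.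
apply: (@depthE k k_inf R gR hR ys hys K _ 1 f) => // [m|v /f0 -> a|n].
- by exists (const_mx m); rewrite /= mxE.
- by rewrite mxE; case: (irrelevant_submod hR).
- have -> : [set v | f v = 0] = [set 0]; last exact: hQ.
  by apply/seteqP; split=> v /=; [exact: f0|move=> ->; rewrite mxE].
Qed.

End GradedAuslanderBuchsbaum.

(** * Hilbert functions and Krull dimension *)

Section RelativeDimension.
Variables (k : fieldType) (R : comAlgType k).

(** [E] is only an [R]-module, so [k] acts through [c%:A]. Submodules would not do, since parts of
    bounded degree are closed under [k] only. *)
Definition ksubset (E : lmodType R) (W : set E) :=
  W 0 /\ forall (a : k) u v, W u -> W v -> W (a%:A *: u + v).

Definition kcomb (E : lmodType R) (J : finType) (u : J -> E) (c : J -> k) : E :=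
  \sum_j (c j)%:A *: u j.

Definition kindep (E : lmodType R) (W : set E) (J : finType) (u : J -> E) :=
  forall c, W (kcomb u c) -> forall j, c j = 0.

Definition kgen (E : lmodType R) (U W : set E) (J : finType) (u : J -> E) :=
  forall v, U v -> exists c, W (v - kcomb u c).

(* [n] is the dimension over [k] of the image of [U] in [E / W]. *)
Definition has_dim (E : lmodType R) (U W : set E) (n : nat) :=
  exists (J : finType) (u : J -> E),
    [/\ #|J| = n, forall j, U (u j), kindep W u & kgen U W u].

Lemma submodset_ksubset (E : lmodType R) (W : set E) : submodset W -> ksubset W.
Proof. by move=> [h0 h]; split=> // a u v; apply: h. Qed.

Section KSubset.
Variables (E : lmodType R) (W : set E) (hW : ksubset W).

Lemma ksubsetD u v : W u -> W v -> W (u + v).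
Proof. by move=> hu hv; case: hW => _ /(_ 1 u v hu hv); rewrite !scale1r. Qed.

Lemma ksubsetZ (a : k) u : W u -> W (a%:A *: u).
Proof. by move=> hu; rewrite -[_ *: _]addr0; case: hW => h0 h; apply: h. Qed.

Lemma ksubsetN u : W u -> W (- u).
Proof. by move=> /(ksubsetZ (-1)); rewrite scaleNr scale1r scaleN1r. Qed.

Lemma ksubsetB u v : W u -> W v -> W (u - v).
Proof. by move=> hu hv; apply: ksubsetD => //; apply: ksubsetN. Qed.

Lemma ksubset_sum (I : Type) (r : seq I) (P : pred I) (F : I -> E) :
  (forall i, P i -> W (F i)) -> W (\sum_(i <- r | P i) F i).
Proof.
move=> hF; elim/big_rec: _ => [|i x Pi hx]; first by case: hW.
by apply: ksubsetD => //; apply: hF.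
Qed.

Lemma ksubset_comb (J : finType) (u : J -> E) c : (forall j, W (u j)) -> W (kcomb u c).
Proof. by move=> hu; apply: ksubset_sum => j _; apply: ksubsetZ. Qed.

End KSubset.

Lemma kcomb_map (E E' : lmodType R) (f : {linear E -> E'}) (J : finType) (u : J -> E) c :
  f (kcomb u c) = kcomb (fun j => f (u j)) c.
Proof. by rewrite linear_sum; apply: eq_bigr => j _; rewrite linearZ. Qed.

Lemma kcombZ (E : lmodType R) (J : finType) (u : J -> E) a c :
  a%:A *: kcomb u c = kcomb u (fun j => a * c j).
Proof. by rewrite scaler_sumr; apply: eq_bigr => j _; rewrite scalerA mulr_algl scalerA. Qed.

(** Steinitz exchange modulo [W]: a coefficient matrix with more rows than columns has a nonzero
    left kernel vector, which is a forbidden relation among the [u j]. *)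
Lemma kindep_le (E : lmodType R) (W : set E) (J I : finType) (u : J -> E) (v : I -> E) :
  ksubset W -> kindep W u -> (forall j, exists c, W (u j - kcomb v c)) -> (#|J| <= #|I|)%N.
Proof.
move=> hW hu /choice [A hA]; rewrite leqNgt; apply/negP => hlt.
pose B : 'M[k]_(#|J|, #|I|) := \matrix_(a, b) A (enum_val a) (enum_val b).
have : kermx B != 0.
  rewrite kermx_eq0 -row_leq_rank -ltnNge.
  exact: leq_ltn_trans (rank_leq_col B) hlt.
move=> /rowV0Pn [r /sub_kermxP rB r0].
have hc : W (kcomb u (fun j => r 0 (enum_rank j))).
  have -> : kcomb u (fun j => r 0 (enum_rank j)) =
      \sum_j (r 0 (enum_rank j))%:A *: (u j - kcomb v (A j)).
    under [RHS]eq_bigr do rewrite scalerBr.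
    rewrite sumrB /=; suff -> : \sum_j (r 0 (enum_rank j))%:A *: kcomb v (A j) = 0 by rewrite subr0.
    under eq_bigr do rewrite kcombZ.
    rewrite exchange_big big1 // => i _ /=; rewrite -scaler_suml -scaler_suml.
    suff -> : \sum_j r 0 (enum_rank j) * A j i = 0 by rewrite !scale0r.
    have /matrixP/(_ 0 (enum_rank i)) := rB; rewrite !mxE => h; apply: etrans h.
    rewrite (reindex (@enum_val _ (mem J))) /=; last exact/onW_bij/enum_val_bij.
    by apply: eq_bigr => a _; rewrite mxE enum_valK enum_rankK.
  by apply: ksubset_sum => // j _; apply: ksubsetZ.
case/eqP: r0; apply/rowP => a; have := hu _ hc (enum_val a).
by rewrite enum_valK mxE.
Qed.

Lemma has_dim_le_map (E E' : lmodType R) (f : {linear E -> E'}) (U W : set E) (U' W' : set E') n n' :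
  ksubset U -> ksubset W' ->
  (forall v, U v -> U' (f v)) -> (forall v, U v -> W' (f v) -> W v) ->
  has_dim U W n -> has_dim U' W' n' -> (n <= n')%N.
Proof.
move=> hU hW' fU fW [J [u [<- uU ui _]]] [J' [u' [<- _ _ ug']]].
apply: (@kindep_le E' W' J J' (fun j => f (u j)) u') => // [c|j]; last by apply/ug'/fU.
rewrite -kcomb_map => h; apply: ui; apply: fW h; exact: (ksubset_comb hU).
Qed.

Lemma has_dim_le (E : lmodType R) (U W U' W' : set E) n n' :
  ksubset U -> ksubset W' -> U `<=` U' -> W' `<=` W ->
  has_dim U W n -> has_dim U' W' n' -> (n <= n')%N.
Proof. by move=> hU hW' sU sW; apply: (has_dim_le_map (f := idfun)) => // v _; apply: sW. Qed.

Lemma has_dim_uniq (E : lmodType R) (U W : set E) n n' :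
  ksubset U -> ksubset W -> has_dim U W n -> has_dim U W n' -> n = n'.
Proof.
by move=> hU hW h h'; apply/eqP; rewrite eqn_leq !(has_dim_le (U := U) (W := W) (U' := U) (W' := W)).
Qed.

Lemma has_dim_map (E E' : lmodType R) (f : {linear E -> E'}) (U W : set E) (U' W' : set E') n :
  ksubset U -> ksubset W' ->
  (forall v, U v -> U' (f v)) -> (forall v, U v -> (W' (f v) <-> W v)) ->
  (forall v', U' v' -> exists v, U v /\ W' (v' - f v)) ->
  has_dim U W n -> has_dim U' W' n.
Proof.
move=> hU hW' fU fW fs [J [u [<- uU ui ug]]]; exists J, (fun j => f (u j)); split=> //.
- by move=> j; apply: fU.
- by move=> c; rewrite -kcomb_map => h; apply/ui/fW => //; apply: ksubset_comb.
- move=> v' /fs [v [hv hv']]; have [c hc] := ug v hv; exists c.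
  rewrite -[v' - _](subrKA (f v)); apply: ksubsetD => //.
  rewrite -kcomb_map -linearB; apply/fW => //.
  by apply: ksubsetB => //; apply: ksubset_comb.
Qed.

Lemma has_dim_add (E : lmodType R) (U V W : set E) n m :
  ksubset U -> ksubset V -> ksubset W -> W `<=` V ->
  has_dim U V n -> has_dim (U `&` V) W m -> has_dim U W (n + m).
Proof.
move=> hU hV hW WV [J [u [<- uU ui ug]]] [I [v [<- vUV vi vg]]].
pose w (x : J + I) := match x with inl j => u j | inr i => v i end.
have hw c : kcomb w c = kcomb u (fun j => c (inl j)) + kcomb v (fun i => c (inr i)).
  by rewrite /kcomb big_sumType.
exists (J + I)%type, w; split; first by rewrite card_sum.
- by case=> [j|i] /=; [exact: uU|case: (vUV i)].
- move=> c; rewrite hw => hc.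
  have hcv : V (kcomb v (fun i => c (inr i))) by apply: ksubset_comb => // i; case: (vUV i).
  have cu0 : forall j, c (inl j) = 0.
    apply: ui; rewrite -[kcomb u _](addrK (kcomb v (fun i => c (inr i)))).
    by apply: ksubsetB => //; apply: WV.
  have cv0 : forall i, c (inr i) = 0.
    apply: vi; move: hc; rewrite [kcomb u _]big1 ?add0r // => j _.
    by rewrite cu0 scale0r scale0r.
  by case.
- move=> x hx; have [c hc] := ug x hx.
  have [e he] : exists e, W (x - kcomb u c - kcomb v e).
    by apply: vg; split=> //; apply: ksubsetB => //; apply: ksubset_comb.
  exists (fun s => match s with inl j => c j | inr i => e i end).
  by rewrite hw opprD addrA.
Qed.

(** Independent families are no larger than [g], so a largest one exists, and by maximality it
    generates. *)
Lemma has_dim_ex (E : lmodType R) (U W : set E) (I : finType) (g : I -> E) :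
  ksubset W -> kgen U W g -> exists n, has_dim U W n.
Proof.
move=> hW hg.
pose Q n := `[< exists u : 'I_n -> E, (forall j, U (u j)) /\ kindep W u >].
have Q0 : exists n, Q n.
  exists 0%N; apply/asboolP; exists (fun=> 0).
  by split=> [[]//|c _ []].
have Qb n : Q n -> (n <= #|I|)%N.
  move=> /asboolP [u [uU ui]]; rewrite -[X in (X <= _)%N]card_ord.
  by apply: kindep_le hW ui _ => j; apply/hg/uU.
case: (ex_maxnP Q0 Qb) => n /asboolP [u [uU ui]] hmax.
exists n, 'I_n, u; split=> //; first exact: card_ord.
move=> v hv; apply: contrapT => nv.
suff /hmax : Q n.+1 by rewrite ltnn.
apply/asboolP; exists (fun i => if unlift ord0 i is Some j then u j else v); split=> [j|c].
  by case: unlift.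
rewrite /kcomb big_ord_recl unlift_none.
under eq_bigr do rewrite liftK.
rewrite -/(kcomb u (fun j => c (lift ord0 j))) => hc.
have [c0|c0] := eqVneq (c ord0) 0.
  move: hc; rewrite c0 scale0r scale0r add0r => /ui h j.
  by case: (unliftP ord0 j) => [i ->|->].
case: nv; exists (fun j => - (c ord0)^-1 * c (lift ord0 j)).
rewrite -kcombZ scaleNr scaleNr opprK.
have := ksubsetZ hW (c ord0)^-1 hc; rewrite scalerDr scalerA mulr_algl scalerA mulVf //.
by rewrite !scale1r.
Qed.

Lemma has_dim_ffun (E : lmodType R) (U W : set E) n m :
  ksubset U -> ksubset W -> has_dim U W n ->
  has_dim [set v : {ffun 'I_m -> E} | forall i, U (v i)]
          [set v : {ffun 'I_m -> E} | forall i, W (v i)] (m * n).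
Proof.
move=> hU hW [J [u [<- uU ui ug]]].
pose w (x : 'I_m * J) : {ffun 'I_m -> E} := [ffun i => if i == x.1 then u x.2 else 0].
have hw c i : kcomb w c i = kcomb u (fun j => c (i, j)).
  rewrite sum_ffunE (eq_bigr (fun x => (c (x.1, x.2))%:A *: w (x.1, x.2) i)); last first.
    by case=> a j _; rewrite ffunE.
  rewrite -(pair_bigA _ (fun a j => (c (a, j))%:A *: w (a, j) i)) /=.
  rewrite (bigD1 i) //= [X in _ + X]big1 ?addr0 => [|a ha].
    by apply: eq_bigr => j _; rewrite !ffunE eqxx.
  by rewrite big1 // => j _; rewrite !ffunE eq_sym (negPf ha) scaler0.
exists ('I_m * J)%type, w; split; first by rewrite card_prod card_ord.
- by move=> x i; rewrite ffunE; case: ifP => // _; case: hU.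
- by move=> c hc [i j]; have := hc i; rewrite hw => /ui.
- move=> v hv; have /choice [c hc] := fun i => ug _ (hv i).
  by exists (fun x => c x.1 x.2) => i; rewrite !ffunE hw.
Qed.

Lemma has_dim_row (U W : set R^o) n m :
  ksubset U -> ksubset W -> has_dim U W n ->
  has_dim [set v : 'rV[R]_m | forall i, U (v 0 i)] [set v : 'rV[R]_m | forall i, W (v 0 i)] (m * n).
Proof.
move=> hU hW /(has_dim_ffun m hU hW).
pose f (v : {ffun 'I_m -> R^o}) : 'rV[R]_m := \row_i v i.
have lf : linear f by move=> a u v; apply/rowP => i; rewrite !mxE !ffunE.
pose F : {linear {ffun 'I_m -> R^o} -> 'rV[R]_m} := HB.pack f (GRing.isLinear.Build _ _ _ _ _ lf).
apply: (has_dim_map (f := F)).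
- by split=> [i|a u v hu hv i]; rewrite !ffunE; case: hU => // _; apply.
- by split=> [i|a u v hu hv i]; rewrite !mxE; case: hW => // _; apply.
- by move=> v hv i; rewrite mxE.
- by move=> v hv; split=> h i; have := h i; rewrite mxE.
- move=> v hv; exists [ffun i => v 0 i]; split=> [i|i]; first by rewrite ffunE.
  by rewrite !mxE ffunE subrr; case: hW.
Qed.

End RelativeDimension.

(** * Polynomials compared at large arguments *)

Section EventualPolynomials.
Implicit Types P Q : {poly rat}.

Definition eventually (A : nat -> Prop) := exists N, forall n, (N <= n)%N -> A n.

Lemma eventually_and (A B : nat -> Prop) : eventually A -> eventually B ->
  eventually (fun n => A n /\ B n).
Proof.
move=> [N hN] [N' hN']; exists (maxn N N') => n; rewrite geq_max => /andP [h h'].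
by split; [apply: hN|apply: hN'].
Qed.

Lemma eventually_imp (A B : nat -> Prop) : (forall n, A n -> B n) -> eventually A -> eventually B.
Proof. by move=> h [N hN]; exists N => n /hN /h. Qed.

Lemma poly_eventually_ge P : 0 < lead_coef P ->
  exists2 e : rat, 0 < e & eventually (fun n => e <= P.[n%:R]).
Proof.
elim/poly_ind: P => [|P c IHP]; first by rewrite lead_coef0.
have [->|P0] := eqVneq P 0.
  rewrite mul0r add0r lead_coefC => hc; exists c => //; exists 0%N => n _.
  by rewrite hornerC.
have -> : lead_coef (P * 'X + c%:P) = lead_coef P.
  rewrite lead_coefDl ?lead_coefMX // size_mulX //.
  by apply: leq_ltn_trans (size_polyC_leq1 c) _; rewrite ltnS lt0n size_poly_eq0.
move=> /IHP [e e0 [N hN]]; exists 1 => //.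
exists (maxn N (Num.truncn ((1 + `|c|) / e)).+1) => n; rewrite geq_max => /andP [/hN h1 h2].
rewrite hornerMXaddC.
have h3 : (1 + `|c|) / e <= n%:R.
  have := truncnS_gt ((1 + `|c|) / e) => /ltW h; apply: (le_trans h).
  by rewrite ler_nat.
have h4 : 1 + `|c| <= n%:R * e by rewrite -ler_pdivrMr.
have h5 : e * n%:R <= P.[n%:R] * n%:R by rewrite ler_wpM2r // ler0n.
have := ler_norm (- c); rewrite normrN => h6.
lra.
Qed.

Lemma poly_eventually_le P Q : 0 < lead_coef P ->
  eventually (fun n => P.[n%:R] <= Q.[n%:R]) -> (size P <= size Q)%N.
Proof.
move=> hP h; rewrite leqNgt; apply/negP => hs.
have /poly_eventually_ge [e e0 he] : 0 < lead_coef (P - Q).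
  by rewrite lead_coefDl // size_polyN.
have [N hN] := eventually_and h he.
have [h1] := hN N (leqnn N); rewrite hornerD hornerN; lra.
Qed.

Lemma poly_lead_ge0 P : eventually (fun n => 0 <= P.[n%:R]) -> 0 <= lead_coef P.
Proof.
move=> h; rewrite leNgt; apply/negP => hP.
have /poly_eventually_ge [e e0 he] : 0 < lead_coef (- P) by rewrite lead_coefN oppr_gt0.
have [N hN] := eventually_and h he.
have [h1] := hN N (leqnn N); rewrite hornerN; lra.
Qed.

Lemma poly_eventually_uniq P Q : eventually (fun n => P.[n%:R] = Q.[n%:R]) -> P = Q.
Proof.
move=> h; apply/eqP; rewrite -subr_eq0; apply/eqP/eqP; rewrite -lead_coef_eq0 eq_le.
apply/andP; split.
  rewrite -oppr_ge0 -lead_coefN; apply: poly_lead_ge0; apply: eventually_imp h => n h.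
  by rewrite hornerN hornerD hornerN h subrr oppr0.
apply: poly_lead_ge0; apply: eventually_imp h => n h.
by rewrite hornerD hornerN h subrr.
Qed.

(** Nonnegative leading coefficients cannot cancel. *)
Lemma size_polyD_lead P Q : 0 <= lead_coef P -> 0 <= lead_coef Q ->
  size (P + Q) = maxn (size P) (size Q).
Proof.
move=> hP hQ; case: (ltngtP (size P) (size Q)) => h.
- by rewrite addrC size_polyDl.
- by rewrite size_polyDl.
rewrite ?h; apply/eqP; rewrite eqn_leq; apply/andP; split.
  by apply: leq_trans (size_polyD _ _) _; rewrite h maxnn.
have [->|Q0] := eqVneq Q 0; first by rewrite size_poly0.
rewrite leqNgt; apply/negP => hs.
have : (P + Q)`_(size Q).-1 = 0.
  by rewrite nth_default // -ltnS prednK // lt0n size_poly_eq0.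
rewrite coefD -[X in P`_X.-1]h -!lead_coefE => /eqP; rewrite paddr_eq0 // => /andP [_].
by rewrite lead_coef_eq0 (negPf Q0).
Qed.

Definition poly_shift (a : rat) P := P \Po ('X + a%:P).

Lemma poly_shiftE a P x : (poly_shift a P).[x] = P.[x + a].
Proof. by rewrite horner_comp hornerD hornerX hornerC. Qed.

Lemma size_poly_shift a P : size (poly_shift a P) = size P.
Proof. by apply: size_comp_poly2; rewrite size_XaddC. Qed.

Lemma poly_antidifference Q : exists P, poly_shift 1 P - P = Q /\
  size P = if Q == 0 then 0%N else (size Q).+1.
Proof.
have [n] := ubnP (size Q); elim: n Q => // n IHn Q hQ.
have [->|Q0] := eqVneq Q 0.
  by exists 0; rewrite /poly_shift comp_poly0 subrr size_poly0.
pose e := (size Q).-1; have he : size Q = e.+1 by rewrite prednK // lt0n size_poly_eq0.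
(* The difference of ['X^(e.+1)] has leading term [e.+1] times ['X^e]; this [a] cancels the leading
   term of [Q]. *)
pose a := lead_coef Q / e.+1%:R.
have e0 : e.+1%:R != 0 :> rat by rewrite pnatr_eq0.
pose P0 : {poly rat} := a *: 'X^(e.+1).
have hP0 : poly_shift 1 P0 - P0 = a *: \sum_(i < e.+1) 'X^i *+ 'C(e.+1, i).
  rewrite /poly_shift /P0 linearZ /= comp_Xn_poly -scalerBr exprD1n big_ord_recr /=.
  by rewrite binn addrK.
have sQ : (size (Q - (poly_shift 1 P0 - P0))%R <= e)%N.
  apply/leq_sizeP => j hj; rewrite hP0 coefB coefZ coef_sum.
  have [hje|hje] := eqVneq j e.
    rewrite (bigD1 ord_max) //= big1 ?addr0 => [|i hi].
      rewrite coefMn coefXn hje eqxx binSn mulr1n.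
      by rewrite -[Q`_e]/(Q`_(size Q).-1) -lead_coefE /a divfK // subrr.
    rewrite coefMn coefXn; case: eqP => [h|_]; last by rewrite mul0rn.
    by case/negP: hi; rewrite -val_eqE /= -h hje.
  have hj' : (e < j)%N by rewrite ltn_neqAle eq_sym hje.
  rewrite nth_default ?he // big1 ?mulr0 ?subr0 // => i _.
  rewrite coefMn coefXn; case: eqP => [h|_]; last by rewrite mul0rn.
  by have := ltn_ord i; rewrite -h ltnS leqNgt hj'.
have [|P1 [hP1 sP1]] := IHn (Q - (poly_shift 1 P0 - P0)).
  by apply: leq_ltn_trans sQ _; rewrite -ltnS -he.
exists (P0 + P1); split.
  rewrite -[RHS](subrK (poly_shift 1 P0 - P0)) -hP1 /poly_shift comp_polyD.
  by rewrite opprD addrACA addrC.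
rewrite size_polyDl.
  rewrite size_scale ?size_polyXn ?he // /a mulf_neq0 ?invr_eq0 //.
  by rewrite lead_coef_eq0.
rewrite size_scale ?size_polyXn; last by rewrite /a mulf_neq0 ?invr_eq0 // lead_coef_eq0.
by rewrite sP1; case: eqP => // _; rewrite ltnS.
Qed.

End EventualPolynomials.

Section DegreeFiltration.
Variables (k : fieldType) (R : comAlgType k) (gR : nat -> {pred R}).
Hypothesis hR : standard_graded gR.

Local Notation rc := (rc gR).

Definition rlt (n : nat) : set R^o := [set x : R^o | forall w : int, n%:Z <= w -> rc w x = 0].

Definition trunc (n : nat) (x : R) : R := \sum_(i < n) rc i x.

Lemma rc_trunc w n x : rc w (trunc n x) = if w < n%:Z then rc w x else 0.
Proof.
have h (i : nat) : rc w (rc i x) = if w == i%:Z then rc w x else 0.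
  by rewrite (rc_hom hR _ (rc_in hR i x)); case: eqP => // ->.
rewrite /trunc rc_sumD //; case: (ltP w 0) => hw.
  by rewrite big1 => [|i _]; rewrite !(rc_neg hR _ hw) //; case: ifP.
case: ltP => hwn; last first.
  by rewrite big1 // => i _; rewrite h ifN //; have := ltn_ord i; lia.
have hl : (`|w| < n)%N by lia.
rewrite (bigD1 (Ordinal hl)) //= h gez0_abs // eqxx big1 ?addr0 // => i hi.
rewrite h ifN //; apply: contra hi => /eqP hi; rewrite -val_eqE /= hi.
by rewrite absz_nat.
Qed.

Lemma rlt_trunc n x : rlt n (trunc n x).
Proof. by move=> w hw; rewrite rc_trunc ltNge hw. Qed.

Lemma trunc_id n x : rlt n x -> trunc n x = x.
Proof.
move=> hx; apply: (rc_ext hR) => w; rewrite rc_trunc.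
by case: ltP => // /hx ->.
Qed.

(** Truncated subtraction is harmless: for [n < e] both sides are zero, as [a * x] has no component
    below degree [e]. *)
Lemma truncM n e a x : a \in zgrade gR e%:Z -> trunc n (a * x) = a * trunc (n - e) x.
Proof.
move=> ha; apply: (rc_ext hR) => w; rewrite rc_trunc !(rcM hR _ _ ha) rc_trunc.
case: (ltP (w - e%:Z) 0) => hw.
  by rewrite !(rc_neg hR _ hw); case: ifP; case: ifP; rewrite ?mulr0.
have -> : (w - e%:Z < (n - e)%N%:Z) = (w < n%:Z) by lia.
by case: ifP; rewrite ?mulr0.
Qed.

Lemma truncD n x y : trunc n (x + y) = trunc n x + trunc n y.
Proof. by rewrite -big_split; apply: eq_bigr => i _; apply: rcD. Qed.

Lemma trunc_sum n (I : Type) (r : seq I) (P : pred I) (F : I -> R) :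
  trunc n (\sum_(i <- r | P i) F i) = \sum_(i <- r | P i) trunc n (F i).
Proof.
rewrite /trunc exchange_big /=; apply: eq_bigr => i _.
exact: rc_sumD.
Qed.

Lemma rlt_ksubset n : ksubset (rlt n).
Proof.
split=> [w _|a u v hu hv w hw]; first exact: rc0.
by rewrite rcD // [_ *: u]mulr_algl rcZ // hu // hv // scaler0 addr0.
Qed.

Lemma rlt_le m n : (m <= n)%N -> rlt m `<=` rlt n.
Proof. by move=> mn x hx w hw; apply: hx; apply: le_trans hw; rewrite lez_nat. Qed.

Lemma rlt0 : rlt 0 = [set 0].
Proof.
apply/seteqP; split=> x /= hx; last by rewrite hx => w _; apply: rc0.
apply: (rc_ext hR) => w; rewrite (rc0 hR); case: (ltP w 0) => hw; first exact: rc_neg.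
exact: hx.
Qed.

Lemma rltM m n x y : rlt m x -> rlt n y -> rlt (m + n) (x * y).
Proof.
move=> hx hy w hw; rewrite -(trunc_id hx) /trunc mulr_suml rc_sumD // big1 // => i _.
by rewrite (rcM hR _ _ (rc_in hR _ x)) [rc (w - _) y]hy ?mulr0 //; have := ltn_ord i; lia.
Qed.

Lemma rlt_ex x : exists n, (0 < n)%N /\ rlt n x.
Proof.
have [N /(_ N.+1 (leqnSn _)) [_ h]] := rc_sum hR x.
by exists N.+1.
Qed.

Lemma rlt1 n : (0 < n)%N -> rlt n 1.
Proof. by move=> hn w hw; rewrite rc1 // ifN //; lia. Qed.

Lemma rlt_gen n : exists (I : finType) (g : I -> R^o), forall v, rlt n v -> exists c, v = kcomb g c.
Proof.
have [ys [_ hW _]] := standard_graded_generators hR.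
pose l := flatten [seq words ys i | i <- iota 0 n].
exists 'I_(size l), (fun i : 'I_(size l) => l`_i) => v hv.
suff [c hc] : lspan (R := k) l v.
  by exists (fun i : 'I_(size l) => c i); rewrite hc; apply: eq_bigr => i _; rewrite [RHS]mulr_algl.
rewrite -(trunc_id hv); apply: submodset_sum => [|i _]; first exact: lspan_submod.
apply: lspan_sub (hW i _ (rc_in hR i v)) => x hx; apply/flattenP; exists (words ys i) => //.
by apply/map_f; rewrite mem_iota /=.
Qed.

Lemma rlt_dim_ex n (W : set R^o) : ksubset W -> exists m, has_dim (rlt n) W m.
Proof.
move=> hW; have [I [g hg]] := rlt_gen n.
apply: (has_dim_ex (g := g) hW) => v /hg [c ->]; exists c.
by rewrite subrr; case: hW.
Qed.

Definition homog_ideal (I : set R^o) := submodset I /\ homog rc I.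

Lemma homog_trunc (I : set R^o) n x : homog_ideal I -> I x -> I (trunc n x).
Proof. by move=> [hI hh] hx; apply: (submodset_sum (E := R^o)) => // i _; apply: hh. Qed.

Definition ideal_colon (I : set R^o) (a : R) : set R^o := [set x : R^o | I (a * x)].
Definition ideal_add (I : set R^o) (a : R) : set R^o :=
  [set x : R^o | exists i r : R, I i /\ x = i + a * r].

Lemma ideal_colon_homog I e a : homog_ideal I -> a \in zgrade gR e%:Z ->
  homog_ideal (ideal_colon I a).
Proof.
move=> [hI hh] ha; split; first split=> [|c x y hx hy]; rewrite /ideal_colon /=.
- by rewrite mulr0; case: hI.
- by rewrite mulrDr [a * _]mulrCA; case: hI => _; apply.
- move=> w x hx; rewrite /ideal_colon /=.
  have := hh (w + e%:Z) _ hx; by rewrite (rcM hR _ _ ha) addrK.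
Qed.

Lemma ideal_add_homog I e a : homog_ideal I -> a \in zgrade gR e%:Z ->
  homog_ideal (ideal_add I a).
Proof.
move=> [hI hh] ha; split; first split=> [|c _ _ [i [r [hi ->]]] [i' [r' [hi' ->]]]].
- by exists 0, 0; rewrite mulr0 addr0; split=> //; case: hI.
- exists (c * i + i'), (c * r + r'); split; first by case: hI => _; apply.
  by rewrite [_ *: _]mulrDr [c * (a * r)]mulrCA mulrDr addrACA.
- move=> w _ [i [r [hi ->]]]; exists (rc w i), (rc (w - e%:Z) r); split; first exact: hh.
  by rewrite rcD // (rcM hR _ _ ha).
Qed.

Lemma ideal_add_sub I a : I `<=` ideal_add I a.
Proof. by move=> x hx; exists x, 0; rewrite mulr0 addr0. Qed.

Lemma ideal_add_mem (I : set R^o) a : submodset I -> ideal_add I a a.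
Proof. by move=> [h0 _]; exists 0, 1; rewrite mulr1 add0r. Qed.

Lemma homog_ideal_ksubset I : homog_ideal I -> ksubset I.
Proof. by case=> hI _; apply: submodset_ksubset. Qed.

(** The exact sequence [0 -> R / (I : a) -> R / I -> R / (I + (a)) -> 0], whose first map is
    multiplication by [a] and raises degrees by [e]. *)
Lemma rlt_dim_split I e a n m m' : homog_ideal I -> a \in zgrade gR e%:Z ->
  has_dim (rlt (n - e)) (ideal_colon I a) m -> has_dim (rlt n) (ideal_add I a) m' ->
  has_dim (rlt n) I (m' + m).
Proof.
move=> hI ha hm hm'.
have hk := homog_ideal_ksubset hI.
have hadd := ideal_add_homog hI ha.
apply: (has_dim_add (V := ideal_add I a)) => //.
- exact: rlt_ksubset.
- exact: homog_ideal_ksubset.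
- exact: ideal_add_sub.
have lf : linear (fun x : R^o => a * x : R^o).
  by move=> c x y; rewrite mulrDr; congr (_ + _); rewrite [a * _]mulrCA.
pose f : {linear R^o -> R^o} := HB.pack (fun x : R^o => a * x : R^o)
  (GRing.isLinear.Build _ _ _ _ _ lf).
apply: (has_dim_map (f := f)) hm => //; first exact: rlt_ksubset.
- move=> x hx; split; last by exists 0, x; rewrite add0r; split=> //; case: hk.
  move=> w hw; rewrite (rcM hR _ _ ha).
  case: (ltP (w - e%:Z) 0) => h; first by rewrite (rc_neg hR) ?mulr0.
  by rewrite hx ?mulr0 //; lia.
- move=> v' [hv' [i [r [hi hv]]]]; exists (trunc (n - e) r); split; first exact: rlt_trunc.
  rewrite /= -(truncM _ _ ha) -{1}(trunc_id hv') hv truncD addrK.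
  exact: homog_trunc.
Qed.

(* Compare the lowest components of [x] and [y] lying outside [I]. *)
Lemma homog_prime I : homog_ideal I ->
  (forall (e e' : nat) a b, a \in gR e -> b \in gR e' -> I (a * b) -> I a \/ I b) ->
  forall x y, I (x * y) -> I x \/ I y.
Proof.
move=> hI hp x y hxy; apply: contrapT => /not_orP [nx ny].
have low z : ~ I z -> exists i : nat, [/\ ~ I (rc i z), forall w, w < i%:Z -> rc w (z - trunc i z) = 0,
    I (trunc i z) & rc i (z - trunc i z) = rc i z].
  move=> nz; pose Q i := `[< ~ I (rc (Posz i) z) >].
  have exQ : exists i, Q i.
    apply: contrapT => h; apply: nz; have [N /(_ N (leqnn N)) [-> _]] := rc_sum hR z.
    apply: (submodset_sum (E := R^o)) => [|i _]; first by case: hI.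
    by apply: contrapT => h'; apply: h; exists i; apply/asboolP.
  case: (ex_minnP exQ) => i /asboolP hi hmin; exists i; split=> //.
  - by move=> w hw; rewrite rcB // rc_trunc hw subrr.
  - apply: (submodset_sum (E := R^o)) => [|j _]; first by case: hI.
    apply: contrapT => h; have /hmin : Q j by apply/asboolP.
    by rewrite leqNgt ltn_ord.
  - by rewrite rcB // rc_trunc ltxx subr0.
have [i [nxi lx Ix ex]] := low x nx; have [j [nyj ly Iy ey]] := low y ny.
set x' := x - trunc i x in lx ex; set y' := y - trunc j y in ly ey.
have hI' : submodset I by case: hI.
have hxy' : I (x' * y').
  rewrite /x' /y' mulrBl; apply: (submodsetB (E := R^o)) => //.
    rewrite mulrBr; apply: (submodsetB (E := R^o)) => //.
    exact: (submodsetZ (E := R^o)).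
  by rewrite mulrC; apply: (submodsetZ (E := R^o)).
have : I (rc i x * rc j y).
  have -> : rc i x * rc j y = rc (i%:Z + j%:Z) (x' * y'); last by case: hI => _; apply.
  have [N /(_ (maxn N i.+1) (leq_maxl _ _)) [hN _]] := rc_sum hR x'.
  rewrite {1}hN mulr_suml rc_sumD //.
  have hl : (i < maxn N i.+1)%N by rewrite leq_max ltnSn orbT.
  rewrite (bigD1 (Ordinal hl)) //= big1 ?addr0 => [|l hl'].
    by rewrite (rcM hR _ _ (rc_in hR _ x')) addrC addKr ex ey.
  rewrite (rcM hR _ _ (rc_in hR _ x')).
  have hne : (l : nat) <> i by move=> h; case/eqP: hl'; apply: val_inj.
  case: (ltnP l i) => hli; first by rewrite lx ?mul0r // ltz_nat.
  by rewrite [rc (_ - _) y']ly ?mulr0 //; lia.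
by move=> /(hp i j _ _ (rc_in hR i x) (rc_in hR j y)) [].
Qed.

End DegreeFiltration.

Section HilbertPolynomial.
Variables (k : fieldType) (R : comAlgType k) (gR : nat -> {pred R}).
Hypothesis hR : standard_graded gR.

Local Notation rlt := (rlt gR).
Local Notation homog_ideal := (homog_ideal gR).

(** All degrees below [n] are counted together, so for a proper ideal the degree is the dimension of
    [R / I] and not one less. *)
Definition hilbert_poly (I : set R^o) (P : {poly rat}) :=
  eventually (fun n => forall m, has_dim (rlt n) I m -> m%:R = P.[n%:R]).

Definition ideal_chain (I : set R^o) (n : nat) (p : nat -> {pred R}) :=
  [/\ forall i, (i <= n)%N -> idealr_closed (p i) /\ prime_idealr_closed (p i),
      forall i x, (i <= n)%N -> I x -> x \in p i
    & forall i, (i < n)%N -> {subset p i <= p i.+1} /\ ~ {subset p i.+1 <= p i}].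

Lemma has_dim0 (E : lmodType R) (U W : set E) : U `<=` W -> has_dim U W 0.
Proof.
move=> UW; exists 'I_0, (fun=> 0); split; first exact: card_ord.
- by case.
- by move=> c _ [].
- by move=> v hv; exists (fun=> 0); rewrite /kcomb big_ord0 subr0; apply: UW.
Qed.

Lemma rlt_dim_uniq n I m m' : homog_ideal I -> has_dim (rlt n) I m -> has_dim (rlt n) I m' -> m = m'.
Proof.
move=> hI; apply: has_dim_uniq; first exact: rlt_ksubset.
exact: homog_ideal_ksubset hI.
Qed.

Lemma hilbert_poly_lead_ge0 I P : homog_ideal I -> hilbert_poly I P -> 0 <= lead_coef P.
Proof.
move=> hI hP; apply: poly_lead_ge0; apply: eventually_imp hP => n h.
by have [m hm] := rlt_dim_ex hR n (homog_ideal_ksubset hI); rewrite -(h m hm) ler0n.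
Qed.

Lemma ideal_chain_sub I J n p : I `<=` J -> ideal_chain J n p -> ideal_chain I n p.
Proof. by move=> IJ [h1 h2 h3]; split=> // i x hi /IJ; apply: h2. Qed.

Definition asbool_ideal (I : set R^o) : {pred R} := fun x => `[< I x >].

Lemma prime_ideal_pred (I : set R^o) : submodset I -> ~ I 1 ->
  (forall x y : R, I (x * y) -> I x \/ I y) ->
  idealr_closed (asbool_ideal I) /\ prime_idealr_closed (asbool_ideal I).
Proof.
move=> hI I1 hp; split; first split; rewrite /in_mem /=.
- by apply/asboolP; case: hI.
- by apply/asboolP.
- move=> a u v; rewrite /in_mem /= => /asboolP hu /asboolP hv; apply/asboolP.
  by case: hI => _; apply.
- by move=> u v; rewrite /in_mem /= => /asboolP/hp [h|h]; apply/orP; [left|right]; apply/asboolP.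
Qed.

Lemma ideal_chain0 (I : set R^o) : submodset I -> ~ I 1 ->
  (forall x y : R, I (x * y) -> I x \/ I y) -> ideal_chain I 0 (fun=> asbool_ideal I).
Proof.
move=> hI I1 hp; split=> // [i _|i x _ hx]; first exact: prime_ideal_pred.
exact/asboolP.
Qed.

Lemma ideal_chain_cons (I J : set R^o) y n p : submodset I -> ~ I 1 ->
  (forall x y : R, I (x * y) -> I x \/ I y) -> I `<=` J -> J y -> ~ I y ->
  ideal_chain J n p ->
  ideal_chain I n.+1 (fun i => if i is i'.+1 then p i' else asbool_ideal I).
Proof.
move=> hI I1 hp IJ Jy ny [h1 h2 h3]; split.
- by case=> [|i] hi; [exact: prime_ideal_pred|exact: h1].
- by case=> [|i] x hi hx; [exact/asboolP|apply: h2 => //; apply: IJ].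
- case=> [|i] hi; last exact: h3.
  split=> [x /asboolP /IJ hx|h]; first exact: h2.
  by apply: ny; apply/asboolP/h/h2.
Qed.

Lemma hilbert_poly_split I e a P P' : homog_ideal I -> a \in gR e ->
  hilbert_poly (ideal_colon I a) P -> hilbert_poly (ideal_add I a) P' ->
  hilbert_poly I (poly_shift (- e%:R) P + P').
Proof.
move=> hI ha [N hP] [N' hP']; exists (maxn (N + e) N') => n.
rewrite geq_max => /andP [hn hn'] m hm.
have [m1 hm1] := rlt_dim_ex hR (n - e) (homog_ideal_ksubset (ideal_colon_homog hR hI (e := e) ha)).
have [m2 hm2] := rlt_dim_ex hR n (homog_ideal_ksubset (ideal_add_homog hR hI (e := e) ha)).
rewrite (rlt_dim_uniq hI hm (rlt_dim_split hR hI (e := e) ha hm1 hm2)) natrD addrC.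
rewrite hornerD poly_shiftE -(hP' n hn' _ hm2); congr (_ + _).
have hen : (e <= n)%N by apply: leq_trans hn; apply: leq_addl.
rewrite -natrB // -(hP _ _ _ hm1) //.
by rewrite leq_subRL // addnC.
Qed.

(* Noetherian induction: a maximal counterexample [I] is prime, and then a
   generator [y] outside [I] reduces it to [I + (y)]. *)
Theorem hilbert_poly_chain I : homog_ideal I ->
  exists P, hilbert_poly I P /\ (P != 0 -> exists p, ideal_chain I (size P).-1 p).
Proof.
move=> hI0; apply: contrapT => nI0.
pose good (I : set R^o) :=
  exists P, hilbert_poly I P /\ (P != 0 -> exists p, ideal_chain I (size P).-1 p).
have [||J [[hJ nJ] _ hmax]] := @noetherian_max R R^o
  [set I | homog_ideal I /\ ~ good I] I (standard_graded_noetherian hR).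
- by move=> N [[]].
- by [].
apply: nJ; have IH J' : homog_ideal J' -> J `<=` J' -> (exists x, J' x /\ ~ J x) -> good J'.
  move=> hJ' JJ' [x [hx nx]]; apply: contrapT => nJ'; apply: nx.
  exact: (hmax J').
have hJs : submodset J by case: hJ.
have [J1|nJ1] := pselect (J 1).
  exists 0; split; last by rewrite eqxx.
  exists 0%N => n _ m hm; rewrite horner0.
  suff -> : m = 0%N by [].
  apply: (rlt_dim_uniq hJ hm); apply: has_dim0 => x _.
  by rewrite -[x]mulr1; apply: (submodsetZ (E := R^o)).
have [hp|hp] := pselect (forall (e e' : nat) a b, a \in gR e -> b \in gR e' ->
    J (a * b) -> J a \/ J b); last first.
  have [e [e' [a [b [ha hb Jab na nb]]]]] : exists (e e' : nat) a b,
      [/\ a \in gR e, b \in gR e', J (a * b), ~ J a & ~ J b].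
    apply: contrapT => h; apply: hp => e e' a b ha hb Jab.
    by apply: contrapT => /not_orP [na nb]; apply: h; exists e, e', a, b.
  have Jc : J `<=` ideal_colon J a by move=> x hx; apply: (submodsetZ (E := R^o)).
  have Ja := @ideal_add_sub _ _ J a.
  have hc := ideal_colon_homog hR hJ (e := e) ha.
  have had := ideal_add_homog hR hJ (e := e) ha.
  have [P1 [hP1 cP1]] := IH _ hc Jc (ex_intro _ b (conj Jab nb)).
  have [P2 [hP2 cP2]] := IH _ had Ja (ex_intro _ a (conj (ideal_add_mem a hJs) na)).
  exists (poly_shift (- e%:R) P1 + P2); split; first exact: (hilbert_poly_split hJ ha hP1 hP2).
  have l1 : 0 <= lead_coef (poly_shift (- e%:R) P1).
    rewrite lead_coef_comp ?size_XaddC // lead_coefXaddC expr1n mulr1.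
    exact: hilbert_poly_lead_ge0 hP1.
  have l2 := hilbert_poly_lead_ge0 had hP2.
  (* The size of the sum is the larger of the two sizes, and a chain over the ideal attaining it is
     also one over [J]. *)
  rewrite -size_poly_eq0 size_polyD_lead // size_poly_shift.
  case: (leqP (size P1) (size P2)) => hs.
    rewrite size_poly_eq0 => /cP2 [p hp']; exists p; exact: ideal_chain_sub hp'.
  rewrite size_poly_eq0 => /cP1 [p hp']; exists p; exact: ideal_chain_sub hp'.
have {}hp := homog_prime hR hJ hp.
have [ys [ys1 _ hys]] := standard_graded_generators hR.
have [hysJ|] := pselect (forall y, y \in ys -> J y).
  exists 1; split; last first.
    by rewrite size_poly1 => _; exists (fun=> asbool_ideal J); apply: ideal_chain0.
  exists 1%N => n hn m hm; rewrite hornerC.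
  suff -> : m = 1%N by [].
  apply: (rlt_dim_uniq hJ hm); exists 'I_1, (fun=> 1); split; first exact: card_ord.
  - by move=> _; apply: rlt1.
  - move=> c; rewrite /kcomb big_ord1 => hc j; rewrite (ord1 j).
    have [//|c0] := eqVneq (c 0) 0; case: nJ1.
    have := ksubsetZ (homog_ideal_ksubset hJ) (c 0)^-1 hc.
    by rewrite scalerA mulr_algl scalerA mulVf // !scale1r.
  - move=> v _; have [c hc] := rc0P hR v; exists (fun=> c); rewrite /kcomb big_ord1.
    apply: (lspan_min (E := R^o) hJs hysJ); apply/hys/(irrelevantP hR).
    have -> : (c%:A : R) *: (1 : R^o) = c%:A by exact: mulr1.
    by rewrite rcB // hc rcA // eqxx subrr.
move=> hny; have {hny} [y [yys ny]] : exists y, y \in ys /\ ~ J y.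
  by apply: contrapT => h; apply: hny => y hy; apply: contrapT => ny; apply: h; exists y.
have y1 : y \in gR 1 := ys1 y yys.
have had := ideal_add_homog hR hJ (e := 1) y1.
have Jy := ideal_add_mem y hJs.
have [P2 [hP2 cP2]] := IH _ had (@ideal_add_sub _ _ J y) (ex_intro _ y (conj Jy ny)).
(* [J] is prime and misses [y], so the splitting reads [f (n + 1) - f n = P2 (n + 1)]: up to a
   constant the Hilbert function of [J] is an antidifference of that of [J + (y)]. *)
have cJ : ideal_colon J y = J.
  apply/seteqP; split=> x; first by move=> /hp [].
  by move=> hx; apply: (submodsetZ (E := R^o)).
have /choice [f hf] : forall n, exists m, has_dim (rlt n) J m.
  by move=> n; apply: rlt_dim_ex => //; apply: homog_ideal_ksubset hJ.
have [P1 [hP1 sP1]] := poly_antidifference (poly_shift 1 P2).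
have [N hN] : eventually (fun n => (f n.+1)%:R - P1.[n.+1%:R] = (f n)%:R - P1.[n%:R]).
  case: hP2 => N hN; exists N => n hn.
  have [m hm] := rlt_dim_ex hR n.+1 (homog_ideal_ksubset had).
  have hfn : has_dim (rlt (n.+1 - 1)) (ideal_colon J y) (f n) by rewrite subn1 cJ.
  rewrite (rlt_dim_uniq hJ (hf n.+1) (rlt_dim_split hR hJ (e := 1) y1 hfn hm)).
  have := congr1 (fun Q : {poly rat} => Q.[n%:R]) hP1.
  rewrite hornerD hornerN !poly_shiftE -natr1 natrD => h.
  have := hN n.+1 (leqW hn) m hm; rewrite -natr1 => ->; rewrite -h; ring.
pose c := (f N)%:R - P1.[N%:R].
have hc n : (N <= n)%N -> (f n)%:R = P1.[n%:R] + c.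
  elim: n => [|n IHn].
    by rewrite leqn0 /c => /eqP ->; rewrite addrC subrK.
  rewrite leq_eqVlt => /orP [/eqP <-|]; first by rewrite /c addrC subrK.
  rewrite ltnS => hn; have := hN n hn; rewrite (IHn hn) => h.
  by rewrite -[LHS](subrK P1.[n.+1%:R]) h addrC [P1.[n%:R] + c]addrC addrK.
exists (P1 + c%:P); split.
  exists N => n hn m hm; rewrite (rlt_dim_uniq hJ hm (hf n)) hc //.
  by rewrite hornerD hornerC.
move=> P0; move: sP1; rewrite -size_poly_eq0 size_poly_shift size_poly_eq0.
(* If [P2 = 0], the polynomial is constant and [J] alone is the chain. Otherwise the degree goes up
   by one, and [J] is put below the chain over [J + (y)]. *)
case: eqP => [_|/eqP P20] sP1.
  have -> : (size (P1 + c%:P)%R).-1 = 0%N.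
    have /size0nil/(congr1 (@Poly _)) := sP1; rewrite polyseqK /= => ->.
    rewrite add0r; case: (size _) (size_polyC_leq1 c) => [|[]] //.
  by exists (fun=> asbool_ideal J); apply: ideal_chain0.
have -> : (size (P1 + c%:P)%R).-1 = (size P2).-1.+1.
  rewrite size_polyDl sP1 ?prednK ?lt0n ?size_poly_eq0 //.
  by apply: leq_ltn_trans (size_polyC_leq1 c) _; rewrite ltnS lt0n size_poly_eq0.
have [p hp'] := cP2 P20.
by eexists; apply: (ideal_chain_cons hJs nJ1 hp (@ideal_add_sub _ _ J y) Jy ny hp').
Qed.

End HilbertPolynomial.

Section KrullDimension.
Variables (k : fieldType) (R : comAlgType k) (gR : nat -> {pred R}).
Hypothesis hR : standard_graded gR.

Local Notation rlt := (rlt gR).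

(* If [C] lifts a basis of the degrees [< n] of [R / P'], then the sum of the
   [x ^ i C] is direct modulo [P]. *)
Lemma prime_step_growth (P P' : set R^o) x : submodset P -> submodset P' ->
  (forall u v : R, P (u * v) -> P u \/ P v) -> P `<=` P' -> P' x -> ~ P x ->
  exists r, (0 < r)%N /\ forall n m m', has_dim (rlt (r * n)) P m -> has_dim (rlt n) P' m' ->
    (n * m' <= m)%N.
Proof.
move=> hP hP' hprime PP' P'x nPx; have [s [s0 hs]] := rlt_ex hR x.
(* [x ^+ i] has degrees at most [i * s], so for [i < n] the products [x ^+ i * u j] stay below
   degree [s.+1 * n]. *)
exists s.+1; split=> // n m m' [I [v [<- _ _ vg]]] [J [u [<- uU ui _]]].
have hxi i : rlt (i * s).+1 (x ^+ i).
  elim: i => [|i IHi]; first by rewrite expr0; apply: rlt1.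
  by rewrite exprS mulSn -addnS; apply: rltM.
pose w (a : 'I_n * J) : R^o := x ^+ a.1 * u a.2.
have -> : (n * #|J|)%N = #|{: 'I_n * J}| by rewrite card_prod card_ord.
apply: (@kindep_le _ R R^o P _ _ w v); first exact: submodset_ksubset.
- move=> c; have -> : kcomb w c = \sum_(i < n) x ^+ i * kcomb u (fun j => c (i, j)).
    rewrite /kcomb (eq_bigr (fun a => (c (a.1, a.2))%:A *: (x ^+ a.1 * u a.2 : R^o))); last first.
      by case.
    rewrite -(pair_bigA _ (fun i j => (c (i, j))%:A *: (x ^+ i * u j : R^o))) /=.
    apply: eq_bigr => i _; rewrite mulr_sumr; apply: eq_bigr => j _.
    by rewrite [RHS]mulrCA.
  (* In a relation the term without [x] lies in [P'], so its coefficients vanish; a factor [x] then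
     cancels because [P] is prime. Coefficients indexed by all naturals allow the shift in this
     induction. *)
  move=> hc; suff h : forall N (e : nat -> J -> k),
      P (\sum_(i < N) x ^+ i * kcomb u (e i)) -> forall i j, (i < N)%N -> e i j = 0.
    case=> i j; have := h n (fun i j => if insub i is Some i' then c (i', j) else 0) _ i j (ltn_ord i).
    rewrite valK; apply; move: hc; congr P; apply: eq_bigr => l _.
    by congr (_ * _); apply: eq_bigr => j' _; rewrite valK.
  elim=> [//|N IHN] e; rewrite big_ord_recl expr0 mul1r.
  have -> : \sum_(i < N) x ^+ lift ord0 i * kcomb u (e (lift ord0 i)) =
      x * \sum_(i < N) x ^+ i * kcomb u (e i.+1).
    by rewrite mulr_sumr; apply: eq_bigr => i _; rewrite exprS mulrA.
  move=> he.
  have e0 : forall j, e 0%N j = 0.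
    apply: ui; apply: (submodset_subl (E := R^o) hP' _ (PP' _ he)).
    by rewrite mulrC; apply: (submodsetZ (E := R^o)).
  have := he; rewrite [kcomb u (e 0%N)]big1 => [|j _]; last by rewrite e0 scale0r scale0r.
  rewrite add0r => /hprime [//|/(IHN (fun i => e i.+1)) h] [|i] j hi //.
  exact: (h i j hi).
- move=> [i j]; apply: vg; rewrite /w /=.
  have h1 := rltM hR (hxi i) (uU j); apply: rlt_le h1.
  have := leq_mul (ltn_ord i) (leqnn s); rewrite mulSn [(n * s)%N]mulnC mulSn => hi.
  by move: s0 hi; lia.
Qed.

(** Going down from the top prime, each step of [prime_step_growth] gains a factor [N] in dimension
    and costs a constant factor in the degree bound. *)
Lemma chain_growth (I : set R^o) n p : submodset I -> ideal_chain I n p ->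
  exists r, (0 < r)%N /\ forall N m, (0 < N)%N -> has_dim (rlt (r * N)) I m -> (N ^ n <= m)%N.
Proof.
move=> hI [hp Ip sp].
pose Q i : set R^o := [set x : R^o | x \in p i].
have hQ i : (i <= n)%N -> submodset (Q i).
  by move=> /hp [[h0 _ h] _]; split=> // a u v hu hv; apply: h.
have Q1 i : (i <= n)%N -> ~ Q i 1 by move=> /hp [[_ /negP h _] _].
have Qp i (u v : R) : (i <= n)%N -> Q i (u * v) -> Q i u \/ Q i v.
  by move=> /hp [_ h] /h /orP.
have step j : (j <= n)%N -> exists r, (0 < r)%N /\ forall N m, (0 < N)%N ->
    has_dim (rlt (r * N)) (Q (n - j)%N) m -> (N ^ j <= m)%N.
  elim: j => [_|j IHj hj].
    (* At the top prime the dimension is at least 1: the element 1 has degree below [N] and is not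
       in the prime. *)
    exists 1%N; split=> // N m hN; rewrite subn0 expn0 lt0n mul1n => h; apply/eqP => m0.
    move: h; rewrite m0 => -[J [u [cJ _ _ ug]]]; apply: (Q1 n) => //.
    have [c] := ug 1 (rlt1 hR hN); rewrite /kcomb big1 ?subr0 // => a _.
    by have := max_card (pred1 a); rewrite card1 cJ.
  have [r [r0 hr]] := IHj (ltnW hj).
  have e1 : ((n - j.+1).+1 = n - j)%N by lia.
  have l1 : (n - j.+1 < n)%N by lia.
  have [sub nsub] := sp _ l1.
  have [x [hx nx]] : exists x, Q (n - j)%N x /\ ~ Q (n - j.+1)%N x.
    apply: contrapT => h; apply: nsub => x; rewrite e1 => hx.
    by apply: contrapT => nx; apply: h; exists x.
  have [s [s0 hs]] := prime_step_growth (hQ _ (ltnW l1)) (hQ _ (leq_subr _ _))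
    (fun u v => @Qp _ u v (ltnW l1)) (fun x => eq_ind _ (fun i => Q _ x -> Q i x) (@sub x) _ e1) hx nx.
  exists (s * r)%N; split; first by rewrite muln_gt0 s0.
  move=> N m hN hm.
  have [m' hm'] := rlt_dim_ex hR (r * N) (submodset_ksubset (hQ _ (leq_subr j n))).
  rewrite -mulnA in hm; have := hs _ _ _ hm hm'; have := hr N m' hN hm'.
  rewrite expnS => h1 h2; apply: leq_trans h2.
  by apply: leq_mul => //; rewrite leq_pmull.
have [r [r0 hr]] := step n (leqnn n); exists r; split=> // N m hN hm.
have [m' hm'] := rlt_dim_ex hR (r * N) (submodset_ksubset (hQ 0%N (leq0n n))).
apply: leq_trans (hr N m' hN _) _; first by rewrite subnn.
apply: has_dim_le hm' hm => //; first exact: rlt_ksubset.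
  exact: submodset_ksubset.
by move=> x; apply: Ip.
Qed.

(** The growth bound [N ^ n <= P (r * N)] compares ['X^n] with [P] after scaling the variable, which
    does not change its size. *)
Lemma chain_length_le (I : set R^o) P n p : homog_ideal gR I -> hilbert_poly gR I P ->
  ideal_chain I n p -> (n < size P)%N.
Proof.
move=> hI hP hc; have hIs : submodset I by case: hI.
have [r [r0 hr]] := chain_growth hIs hc.
have -> : size P = size (P \Po (r%:R *: 'X)).
  by rewrite size_comp_poly2 // size_scale ?size_polyX // pnatr_eq0 -lt0n.
rewrite -(size_polyXn rat n); apply: poly_eventually_le; first by rewrite lead_coefXn.
case: hP => N hN; exists (maxn N 1) => m; rewrite geq_max => /andP [hm m0].
have [l hl] := rlt_dim_ex hR (r * m) (submodset_ksubset hIs).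
rewrite horner_comp hornerZ hornerX hornerXn -natrM -(hN _ _ l hl); last first.
  by apply: leq_trans hm _; rewrite leq_pmull.
by rewrite -natrX ler_nat; apply: hr.
Qed.

Definition annihilator (M : lmodType R) : set R^o := [set x : R^o | forall m : M, (x : R) *: m = 0].

Lemma kdim_hilbert (M : lmodType R) P : homog_ideal gR (annihilator M) ->
  hilbert_poly gR (annihilator M) P -> P != 0 -> kdim M = (size P).-1.
Proof.
move=> hI hP P0; have [P' [hP' hc]] := hilbert_poly_chain hR hI.
have e : P = P'.
  apply: poly_eventually_uniq; apply: eventually_imp (eventually_and hP hP') => n [h h'].
  have [m hm] := rlt_dim_ex hR n (homog_ideal_ksubset hI).
  by rewrite -(h m hm) -(h' m hm).
rewrite -e in hc; have [p [h1 h2 h3]] := hc P0.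
apply: max_natE => [|m [q [q1 q2 q3]]].
  by exists p; split=> // i x hi hx; apply: (h2 i).
rewrite -ltnS prednK ?lt0n ?size_poly_eq0 //.
apply: (@chain_length_le (annihilator M) P m q hI hP); split.
- exact: q1.
- by move=> i x hi hx; apply: (q2 i).
- exact: q3.
Qed.

End KrullDimension.

(** * Additivity along the resolution and the drop in dimension *)

Section EulerCharacteristic.
Variables (k : fieldType) (R : comAlgType k) (gR : nat -> {pred R}).
Hypothesis hR : standard_graded gR.
Variables (M : lmodType R) (gM : int -> {pred M}) (hM : graded_module gR gM).
Variables (F : free_resolution gR gM) (p : nat) (e : nat -> nat).
Hypothesis e0 : e 0 = 0%N.
Hypothesis e_mono : forall i, (i < p)%N -> (e i <= e i.+1)%N.
Hypothesis diff_deg : forall i a b, (i < p)%N -> diff F i a b \in gR (e i.+1 - e i)%N.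
Hypothesis rk_high : forall i, (p < i)%N -> rk F i = 0%N.
Hypothesis M_neq0 : exists m : M, m <> 0.

Local Notation rlt := (rlt gR).
Local Notation im i := (@mx_image R (rk F) (diff F) i).

(** The part of [F_i] in degrees below [n], its generators being in degree [e i]. For [n <= e i] the
    subtraction yields 0 and the part is zero, as it should be. *)
Definition rlt_row i n : set 'rV[R]_(rk F i) := [set v | forall a, rlt (n - e i) (v 0 a)].
Arguments rlt_row : clear implicits.

Lemma rlt_row_ksubset i n : ksubset (rlt_row i n).
Proof.
split=> [a|c u v hu hv a]; rewrite !mxE; first by case: (rlt_ksubset hR (n - e i)).
by case: (rlt_ksubset hR (n - e i)) => _; apply.
Qed.

Lemma mx_image_ksubset i : ksubset (im i).
Proof. exact/submodset_ksubset/mx_image_submod. Qed.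

Lemma rlt_row_diff i n (v : 'rV[R]_(rk F i.+1)) : (i < p)%N ->
  rlt_row i.+1 n v -> rlt_row i n (v *m diff F i).
Proof.
move=> hi hv b; rewrite mxE; apply: (ksubset_sum (rlt_ksubset hR _)) => a _ w hw.
rewrite (@rcMr _ _ _ hR _ (e i.+1 - e i)%:Z); last exact: diff_deg.
have := e_mono hi; have [hn|hn] := leqP (e i.+1) n => he.
  by rewrite hv ?mul0r //; move: hw; lia.
have := hv a; have -> : (n - e i.+1 = 0)%N by lia.
by rewrite rlt0 // => ->; rewrite rc0 // mul0r.
Qed.

Lemma dim_syzygy i n m m' : (i < p)%N -> has_dim (rlt_row i n) (im i) m ->
  has_dim (rlt_row i.+1 n) (im i.+1) m' -> has_dim (rlt_row i n) [set 0] (m + m').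
Proof.
move=> hi hm hm'; apply: has_dim_add hm _.
- exact: rlt_row_ksubset.
- exact: mx_image_ksubset.
- exact/submodset_ksubset/submodset0.
- by move=> v ->; exists 0; rewrite mul0mx.
apply: (has_dim_map (f := mulmxr (diff F i))) hm'.
- exact: rlt_row_ksubset.
- exact/submodset_ksubset/submodset0.
- by move=> v hv; split; [apply: rlt_row_diff|exists v].
- move=> v _; split=> h; first by apply/diff_exact.
  by apply/diff_exact.
move=> v' [hv [w hw]] /=; rewrite {v'}hw in hv *.
(* A preimage may be truncated: the differential is homogeneous and [v'] has bounded degree. *)
exists (\row_a trunc gR (n - e i.+1) (w 0 a)); split.
  by move=> a; rewrite mxE; apply: rlt_trunc.
apply/eqP; rewrite subr_eq0; apply/eqP/rowP => b.
rewrite -(trunc_id hR (hv b)) !mxE trunc_sum //; apply: eq_bigr => a _.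
rewrite mxE mulrC (truncM hR _ _ (diff_deg a b hi)) mulrC; congr (trunc gR _ _ * _).
by have := e_mono hi; lia.
Qed.

Lemma dim_free i n m : has_dim (rlt (n - e i)) [set 0] m ->
  has_dim (rlt_row i n) [set 0] (rk F i * m).
Proof.
move=> /(has_dim_row (rk F i) (rlt_ksubset hR _) (submodset_ksubset (@submodset0 R R^o))).
congr has_dim; apply/seteqP; split=> v /=; last by move=> -> a; rewrite mxE.
by move=> h; apply/rowP => a; rewrite mxE; apply: h.
Qed.

Lemma euler_characteristic (f : nat -> nat) :
  (forall n, has_dim (rlt n) [set (0 : R^o)] (f n)) ->
  forall n m, has_dim (rlt_row 0 n) (im 0) m ->
  m%:R = \sum_(l < p.+1) (-1) ^+ l * (rk F l)%:R * (f (n - e l)%N)%:R :> rat.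
Proof.
(* Generalised to the [i]-th syzygy, whose alternating sum starts at [F_i]; the induction is on the
   number [q] of steps left. *)
move=> hf n; pose s i q : rat := \sum_(l < q.+1) (-1) ^+ l * (rk F (i + l))%:R * (f (n - e (i + l))%N)%:R.
suff h q i m : (i + q = p)%N -> has_dim (rlt_row i n) (im i) m -> m%:R = s i q.
  by move=> m; apply: h.
have hz j : ksubset [set (0 : 'rV[R]_(rk F j))] by exact/submodset_ksubset/submodset0.
elim: q i m => [|q IHq] i m hi hm.
  rewrite /s big_ord1 expr0 mul1r addn0 -natrM; congr (_%:R).
  apply: has_dim_uniq (dim_free (hf (n - e i)%N)) => //; first exact: rlt_row_ksubset.
  move: hm; congr has_dim.
  have hp : (p <= i)%N by rewrite -hi addn0.
  exact: (mx_image_top (diff F) rk_high hp).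
have ip : (i < p)%N by rewrite -hi addnS ltnS leq_addr.
have [m' hm'] : exists m', has_dim (rlt_row i.+1 n) (im i.+1) m'.
  have := has_dim_row (rk F i.+1) (rlt_ksubset hR (n - e i.+1)) (submodset_ksubset (@submodset0 R R^o)) (hf _).
  move=> [J [u [_ _ _ ug]]]; apply: (has_dim_ex (g := u) (mx_image_ksubset i.+1)) => v hv.
  have [c hc] := ug v hv; exists c.
  have -> : v - kcomb u c = 0 by apply/rowP => a; rewrite [RHS]mxE; apply: hc.
  by case: (mx_image_ksubset i.+1).
have h := has_dim_uniq (rlt_row_ksubset i n) (hz i) (dim_syzygy ip hm hm') (dim_free (hf (n - e i)%N)).
have := IHq i.+1 m' _ hm'; rewrite addSnnS => /(_ hi) hs.
rewrite /s big_ord_recl expr0 mul1r addn0 -natrM -h natrD hs /s.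
rewrite -addrA -big_split /= big1 ?addr0 // => l _.
by rewrite /bump /= !add1n exprS mulN1r !mulNr addSnnS addrN.
Qed.

Lemma annihilator_homog : homog_ideal gR (annihilator M).
Proof.
have gm := graded_module_grading hM.
split; first split=> [m|a x y hx hy m].
- by rewrite scale0r.
- by rewrite scalerDl -scalerA hx hy scaler0 addr0.
- move=> w x hx m; have [s [_ _ ->]] := grading_sum gm m.
  rewrite scaler_sumr big1 // => z _.
  have := grading_scaler hR (w + z) x gm (w := z) (v := gcomp gM z m).
  rewrite (grading_idem gm) eqxx addrK => <- //.
  by rewrite hx (grading0 gm).
Qed.

Lemma annihilatorP x : annihilator M x <-> forall a, im 0 (x *: delta_mx 0 a).
Proof.
split=> [hx a|h m].
  by apply/aug_exact; rewrite -[LHS]/(aug_map F _) linearZ /= hx.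
have [v ->] := aug_surjective F m.
rewrite -[X in x *: X]/(aug_map F v) -linearZ /= [v]row_sum_delta scaler_sumr.
suff : im 0 (\sum_a x *: (v 0 a *: delta_mx 0 a)) by move/aug_exact.
apply: submodset_sum => [|a _]; first exact: mx_image_submod.
by rewrite scalerA mulrC -scalerA; apply: submodsetZ; [exact: mx_image_submod|exact: h].
Qed.

Lemma annihilator_neq1 : ~ annihilator M 1.
Proof. by case: M_neq0 => m hm /(_ m); rewrite scale1r. Qed.

Lemma hilbert_poly_neq0 I P : homog_ideal gR I -> ~ I 1 -> hilbert_poly gR I P -> P != 0.
Proof.
move=> hI I1 [N hN]; apply/eqP => P0.
have [m hm] := rlt_dim_ex hR N.+1 (homog_ideal_ksubset hI).
have /eqP := hN N.+1 (leqnSn N) m hm; rewrite P0 horner0 pnatr_eq0 => /eqP m0.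
move: hm; rewrite m0 => -[J [u [cJ _ _ ug]]]; apply: I1.
have [c] := ug 1 (rlt1 hR (ltn0Sn N)); rewrite /kcomb big1 ?subr0 // => a _.
by have := max_card (pred1 a); rewrite card1 cJ.
Qed.

Lemma zero_ideal_homog : homog_ideal gR [set (0 : R^o)].
Proof. by split=> [|w x ->]; [exact: submodset0|exact: rc0]. Qed.

Lemma annihilator_regular : annihilator R^o = [set 0].
Proof.
apply/seteqP; split=> x /=; last by move=> -> m; rewrite scale0r.
by move=> h; have := h 1; rewrite [_ *: 1]mulr1.
Qed.

Lemma im0_rows (v : 'rV[R]_(rk F 0)) : (forall a, annihilator M (v 0 a)) -> im 0 v.
Proof.
move=> hv; rewrite [v]row_sum_delta; apply: submodset_sum => [|a _]; first exact: mx_image_submod.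
by have /annihilatorP := hv a; apply.
Qed.

(** With [r = rk F 0], the ring [R / Ann M] embeds into [M^r] by acting on the [r] generators, and
    [M] is a quotient of [(R / Ann M)^r]. *)
Lemma dim_module_le n m m' : has_dim (rlt n) (annihilator M) m ->
  has_dim (rlt_row 0 n) (im 0) m' -> (m <= rk F 0 * m')%N /\ (m' <= rk F 0 * m)%N.
Proof.
have hA := homog_ideal_ksubset annihilator_homog.
have hI0 := mx_image_ksubset 0.
move=> hm hm'; split.
  have lf : linear (fun x : R^o => [ffun a : 'I_(rk F 0) => (x : R) *: (delta_mx 0 a : 'rV[R]_(rk F 0))]).
    by move=> c x y; apply/ffunP => a; rewrite !ffunE scalerDl scalerA.
  pose f : {linear R^o -> {ffun 'I_(rk F 0) -> 'rV[R]_(rk F 0)}} :=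
    HB.pack (fun x : R^o => [ffun a : 'I_(rk F 0) => (x : R) *: (delta_mx 0 a : 'rV[R]_(rk F 0))])
    (GRing.isLinear.Build _ _ _ _ _ lf).
  apply: (has_dim_le_map (f := f)) hm (has_dim_ffun (rk F 0) (rlt_row_ksubset 0 n) hI0 hm').
  - exact: rlt_ksubset.
  - by split=> [a|c u v hu hv a]; rewrite !ffunE; case: hI0 => // _; apply.
  - move=> x hx a b; rewrite ffunE !mxE e0 subn0 eqxx /=.
    by case: eqP => _; rewrite ?mulr1 ?mulr0 //; case: (rlt_ksubset hR n).
  - by move=> x _ h; apply/annihilatorP => a; have := h a; rewrite ffunE.
apply: has_dim_le hm' (has_dim_row (rk F 0) (rlt_ksubset hR n) hA hm).
- exact: rlt_row_ksubset.
- by split=> [a|c u v hu hv a]; rewrite !mxE; case: hA => // _; apply.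
- by move=> v hv a; have := hv a; rewrite e0 subn0.
- by move=> v hv; apply: im0_rows.
Qed.

(** The base is [- e i] because the generators of [F_i] contribute the Hilbert polynomial of [R] at
    [n - e i], which is expanded around [n]. *)
Definition alternating_moment (l : nat) : rat :=
  \sum_(i < p.+1) (-1) ^+ i * (rk F i)%:R * (- (e i)%:R) ^+ l.

(** In characteristic 0 the [l]-th normalised derivative has size exactly [size P - l], so the first
    nonzero weight decides. For [c >= size P] both sides are 0. *)
Lemma size_taylor_sum (P : {poly rat}) (s : nat -> rat) c : P != 0 ->
  (forall l, (l < c)%N -> s l = 0) -> s c != 0 ->
  size (\sum_(l < size P) s l *: P^`N(l))%R = (size P - c)%N.
Proof.
move=> P0 sl sc.
have coefE j : (\sum_(l < size P) s l *: P^`N(l))%R`_j =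
    \sum_(l < size P) s l * (P`_(l + j) *+ 'C(l + j, l)).
  by rewrite coef_sum; apply: eq_bigr => l _; rewrite coefZ coef_nderivn.
have sP : (0 < size P)%N by rewrite lt0n size_poly_eq0.
apply/eqP; rewrite eqn_leq; apply/andP; split.
  apply/leq_sizeP => j hj; rewrite coefE big1 // => l _.
  have [hl|hl] := ltnP l c; first by rewrite sl ?mul0r.
  have aux u m : (u - c <= j)%N -> (c <= m)%N -> (u <= m + j)%N by lia.
  by rewrite nth_default ?mul0rn ?mulr0 //; apply: aux hj hl.
have [hc|hc] := leqP (size P) c; first by move: hc; rewrite -subn_eq0 => /eqP ->.
rewrite leqNgt; apply/negP => hs.
have : (\sum_(l < size P) s l *: P^`N(l))%R`_((size P).-1 - c) = 0.
  have aux t u : (c < u)%N -> (t < u - c)%N -> (t <= u.-1 - c)%N by lia.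
  by rewrite nth_default //; apply: aux hc hs.
rewrite coefE (bigD1 (Ordinal hc)) //= big1 ?addr0 => [|l hl].
  have hc' : (c <= (size P).-1)%N by rewrite -ltnS prednK.
  rewrite subnKC //.
  move=> /eqP; rewrite mulf_eq0 (negPf sc) /= -mulr_natr mulf_eq0 pnatr_eq0 -lead_coefE lead_coef_eq0.
  by rewrite (negPf P0) /= -leqn0 leqNgt bin_gt0 hc'.
have [hl'|hl'] := ltnP l c; first by rewrite sl ?mul0r.
have : (l : nat) != c by apply: contra hl => /eqP h; apply/eqP/val_inj.
have aux u m : (c < u)%N -> (c <= m)%N -> m != c -> (u <= m + (u.-1 - c))%N by lia.
by move=> hlc; rewrite nth_default ?mul0rn ?mulr0 //; apply: aux hc hl' hlc.
Qed.

(* Taylor expansion of the Hilbert polynomial [P] of [R]: up to equal growth, the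
   Hilbert polynomial of [M] is the sum of the
   [alternating_moment l *: P^`N(l)], whose degree drops by the least [l] with
   a nonzero moment. *)
Lemma kdim_difference c : (forall l, (l < c)%N -> alternating_moment l = 0) ->
  alternating_moment c != 0 -> kdim R^o = (kdim M + c)%N.
Proof.
move=> sl sc.
have hz := zero_ideal_homog; have hA := annihilator_homog.
have [PR [hPR _]] := hilbert_poly_chain hR hz.
have [PA [hPA _]] := hilbert_poly_chain hR hA.
have PR0 : PR != 0 by apply: hilbert_poly_neq0 hPR => //; apply/eqP/oner_neq0.
have PA0 := hilbert_poly_neq0 hA annihilator_neq1 hPA.
rewrite (kdim_hilbert hR hA hPA PA0) (kdim_hilbert (P := PR) hR) ?annihilator_regular //.
pose PM : {poly rat} := \sum_(l < size PR) alternating_moment l *: PR^`N(l).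
have sPM : size PM = (size PR - c)%N by apply: size_taylor_sum.
have /choice [f hf] : forall n, exists m, has_dim (rlt n) [set (0 : R^o)] m.
  by move=> n; apply: rlt_dim_ex => //; apply: homog_ideal_ksubset hz.
have hPM : eventually (fun n => forall m, has_dim (rlt_row 0 n) (im 0) m -> m%:R = PM.[n%:R]).
  have [N hN] := hPR; exists (N + \max_(i < p.+1) e i)%N => n hn m hm.
  rewrite (euler_characteristic hf hm).
  have hPn (i : 'I_p.+1) : (f (n - e i)%N)%:R = \sum_(l < size PR) PR^`N(l).[n%:R] * (- (e i)%:R) ^+ l.
    have he : (e i <= \max_(i < p.+1) e i)%N by apply: (leq_bigmax i).
    rewrite -nderiv_taylor; last exact: mulrC.
    rewrite -natrB; last by move: hn he; lia.
    by apply: hN (hf _); move: hn he; lia.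
  under eq_bigr do rewrite hPn mulr_sumr.
  rewrite exchange_big /PM horner_sum; apply: eq_bigr => l _.
  by rewrite hornerZ mulr_suml; apply: eq_bigr => i _; rewrite [in LHS]mulrCA mulrC.
have dimM n : exists m, has_dim (rlt_row 0 n) (im 0) m.
  have [J [u [_ _ _ ug]]] := dim_free (hf (n - e 0)%N).
  apply: (has_dim_ex (g := u) (mx_image_ksubset 0)) => v /ug [w hw]; exists w.
  by rewrite hw; case: (mx_image_ksubset 0).
have lA : 0 < lead_coef PA.
  by rewrite lt_def lead_coef_eq0 PA0; apply: hilbert_poly_lead_ge0 hPA.
have both : eventually (fun n => exists m m', [/\ m%:R = PA.[n%:R], m'%:R = PM.[n%:R],
    (m <= rk F 0 * m')%N & (m' <= rk F 0 * m)%N]).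
  apply: eventually_imp (eventually_and hPA hPM) => n [h h'].
  have [m hm] := rlt_dim_ex hR n (homog_ideal_ksubset hA); have [m' hm'] := dimM n.
  have [h1 h2] := dim_module_le hm hm'.
  by exists m, m'; split; [apply: h|apply: h'| |].
have le1 : (size PA <= size PM)%N.
  apply: leq_trans (size_scale_leq (rk F 0)%:R PM); apply: poly_eventually_le => //.
  apply: eventually_imp both => n [m [m' [<- h + _]]].
  by rewrite hornerZ -h -natrM ler_nat.
(* As [M] is nonzero, so is its polynomial; this excludes truncation in [size PR - c]. *)
have PM0 : PM != 0.
  by rewrite -size_poly_eq0 -lt0n; apply: leq_trans le1; rewrite lt0n size_poly_eq0.
have lM : 0 < lead_coef PM.
  rewrite lt_def lead_coef_eq0 PM0; apply: poly_lead_ge0; apply: eventually_imp both.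
  by move=> n [m [m' [_ <- _ _]]]; rewrite ler0n.
have le2 : (size PM <= size PA)%N.
  apply: leq_trans (size_scale_leq (rk F 0)%:R PA); apply: poly_eventually_le => //.
  apply: eventually_imp both => n [m [m' [h <- _]]].
  by rewrite hornerZ -h -natrM ler_nat.
have : (0 < size PA)%N by rewrite lt0n size_poly_eq0.
by move: le1 le2; rewrite sPM; lia.
Qed.

End EulerCharacteristic.

(** * Pure diagrams *)

Section PureMoments.
Variables (p : nat) (x : 'I_p.+1 -> rat) (x_inj : injective x).

Definition moments_vanish (c : 'I_p.+1 -> rat) :=
  forall l, (l < p)%N -> \sum_i c i * x i ^+ l = 0.

Lemma moments_poly c n (q : {poly rat}) :
  (forall l, (l < n)%N -> \sum_i c i * x i ^+ l = 0) -> (size q <= n)%N ->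
  \sum_i c i * q.[x i] = 0.
Proof.
move=> hc hq; under eq_bigr do rewrite (horner_coef_wide _ hq) mulr_sumr.
rewrite exchange_big big1 // => l _ /=.
under eq_bigr do rewrite mulrCA.
by rewrite -mulr_sumr hc ?mulr0.
Qed.

(** The [l]-th power of an affine function is a polynomial of degree at most [l], so only moments up
    to [l] enter. *)
Lemma moments_affine c n (u v : rat) :
  (forall l, (l < n)%N -> \sum_i c i * x i ^+ l = 0) ->
  forall l, (l < n)%N -> \sum_i c i * (u + v * x i) ^+ l = 0.
Proof.
move=> hc l hl; pose q : {poly rat} := (u%:P + v *: 'X) ^+ l.
have hq : (size q <= n)%N.
  apply: leq_trans (size_poly_exp_leq _ _) _.
  have h : (size (u%:P + v *: 'X)%R <= 2)%N.
    apply: leq_trans (size_polyD _ _) _; rewrite geq_max; apply/andP; split.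
      exact: leq_trans (size_polyC_leq1 _) _.
    by apply: leq_trans (size_scale_leq _ _) _; rewrite size_polyX.
  have := leq_mul (n1 := 1) _ (leqnn l); move: h; case: (size _) => [|[|[|]]] //= _ _.
  - by rewrite mul0n; apply: leq_ltn_trans hl.
  - by rewrite mul0n; apply: leq_ltn_trans hl.
  - by rewrite mul1n.
have := moments_poly hc hq; under eq_bigr do
  rewrite /q horner_exp hornerD hornerC hornerZ hornerX.
by [].
Qed.

Lemma size_prod_linear (A : pred 'I_p.+1) :
  size (\prod_(l | A l) ('X - (x l)%:P) : {poly rat}) = #|A|.+1.
Proof.
have -> : \prod_(l | A l) ('X - (x l)%:P) = \prod_(l <- enum A) ('X - (x l)%:P) :> {poly rat}.
  by rewrite big_enum.
by rewrite size_prod_XsubC cardE.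
Qed.

Lemma moments_pair c i z : i != z -> moments_vanish c ->
  c i * \prod_(l | (l != i) && (l != z)) (x i - x l) =
  - (c z * \prod_(l | (l != i) && (l != z)) (x z - x l)).
Proof.
move=> iz hc; pose A := [pred l | (l != i) && (l != z)].
pose q : {poly rat} := \prod_(l | A l) ('X - (x l)%:P).
have qE y : q.[y] = \prod_(l | (l != i) && (l != z)) (y - x l).
  by rewrite horner_prod; apply: eq_bigr => l _; rewrite hornerXsubC.
(* Two of the [p + 1] nodes are left out, so [q] has size at most [p] and meets only the vanishing
   moments. *)
have hA : (#|A|.+1 <= p)%N.
  have := cardC A; rewrite card_ord.
  have : (1 < #|[predC A]|)%N.
    rewrite (cardD1 i) (cardD1 z) !inE /= !eqxx /= andbF eq_sym iz //.
  move: (#|A|) (#|[predC A]|) => u v; lia.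
have := moments_poly (n := p) (q := q) hc; rewrite size_prod_linear => /(_ hA).
rewrite (bigD1 i) //= (bigD1 z) 1?eq_sym //= big1 ?addr0 => [|l /andP [li lz]].
  by rewrite !qE => /eqP; rewrite addr_eq0 => /eqP.
by rewrite qE (bigD1 l) /= ?li ?lz // subrr mul0r mulr0.
Qed.

(** If the first [p + 1] moments all vanished, pairing with the polynomial that is zero at every
    node but the first would force [c ord0 = 0]. This bounds the codimension by [p]. *)
Lemma moments_top c : c ord0 != 0 -> exists l, (l <= p)%N /\ \sum_i c i * x i ^+ l != 0.
Proof.
move=> c0; apply: contrapT => h.
have hc l : (l < p.+1)%N -> \sum_i c i * x i ^+ l = 0.
  by rewrite ltnS => hl; apply/eqP/negPn/negP => h'; apply: h; exists l.
pose q : {poly rat} := \prod_(l | l != ord0) ('X - (x l)%:P).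
have := moments_poly (q := q) hc; rewrite size_prod_linear.
have -> : #|[pred l : 'I_p.+1 | l != ord0]| = p by rewrite cardC1 card_ord.
move=> /(_ (leqnn _)); rewrite (bigD1 ord0) //= big1 ?addr0 => [|l l0].
  move=> /eqP; rewrite mulf_eq0 (negPf c0) /= horner_prod => /prodf_eq0 [l l0].
  by rewrite hornerXsubC subr_eq0 => /eqP/x_inj h'; rewrite -h' eqxx in l0.
by rewrite horner_prod (bigD1 l) //= hornerXsubC subrr mul0r mulr0.
Qed.

Lemma moments_solution : exists c, moments_vanish c /\ exists i, c i != 0.
Proof.
pose A : 'M[rat]_(p.+1, p) := \matrix_(i, l) x i ^+ l.
have : kermx A != 0.
  rewrite kermx_eq0 -row_leq_rank -ltnNge.
  exact: leq_ltn_trans (rank_leq_col A) _.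
move=> /rowV0Pn [r /sub_kermxP rA r0]; exists (fun i => r 0 i); split.
  move=> l hl; have /matrixP/(_ 0 (Ordinal hl)) := rA; rewrite !mxE => h; apply: etrans h.
  by apply: eq_bigr => i _; rewrite mxE.
apply: contrapT => h; case/eqP: r0; apply/rowP => i; rewrite mxE.
by apply/eqP/negPn/negP => hi; apply: h; exists i.
Qed.

Definition pure_ratio (z i : 'I_p.+1) : rat :=
  \prod_(l | (l != i) && (l != z)) `|(x l - x z) / (x l - x i)|.

Lemma moments_ratio c z i : moments_vanish c -> `|c i| = `|c z| * pure_ratio z i.
Proof.
move=> hc; have [->|iz] := eqVneq i z.
  rewrite /pure_ratio big1 ?mulr1 // => l /andP [lz _].
  by rewrite divff ?normr1 // subr_eq0 (inj_eq x_inj).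
have := congr1 Num.norm (moments_pair iz hc).
rewrite normrN !normrM !normr_prod => h.
rewrite /pure_ratio.
under eq_bigr do rewrite normrM normfV distrC [X in _ / X]distrC.
rewrite big_split prodfV mulrA -h mulfK //.
apply/prodf_neq0 => l /andP [li _].
by rewrite normr_eq0 subr_eq0 (inj_eq x_inj) eq_sym.
Qed.

Hypothesis x_incr : forall i j : 'I_p.+1, (i < j)%N -> x i < x j.

Lemma moments_neq0 c z i : moments_vanish c -> c z != 0 -> c i != 0.
Proof.
move=> hc hz; rewrite -normr_eq0 (moments_ratio z i hc) mulf_eq0 normr_eq0 (negPf hz) /=.
apply/prodf_neq0 => l /andP [li lz].
by rewrite normr_eq0 mulf_neq0 ?invr_eq0 // subr_eq0 (inj_eq x_inj).
Qed.

(** Every other node lies on the same side of two consecutive ones, so the two products in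
    [moments_pair] have equal signs. *)
Lemma moments_alternate c (i j : 'I_p.+1) : moments_vanish c -> (forall l, c l != 0) ->
  (j = i.+1 :> nat) -> c i * c j < 0.
Proof.
move=> hc c0 ji.
have hij : j != i by apply/eqP => h; move: ji; rewrite h; lia.
have := moments_pair hij hc; set A := \prod_(l | _) _; set B := \prod_(l | _) _ => h.
have AB : 0 < A * B.
  rewrite /A /B -big_split /=; apply: prodr_gt0 => l /andP [lj li].
  have [h1|h1] := ltnP l i.
    by rewrite mulr_gt0 // subr_gt0 x_incr // ji ltnS ltnW.
  have li' : (l : nat) <> i by move=> h2; case/eqP: li; apply: val_inj.
  have lj' : (l : nat) <> j by move=> h2; case/eqP: lj; apply: val_inj.
  by rewrite -mulrNN !opprB mulr_gt0 // subr_gt0 x_incr //; move: h1 li' lj' ji; lia.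
have A0 : A != 0 by move: AB; case: eqP => // ->; rewrite mul0r ltxx.
have hj : c j = - (c i * B) / A by rewrite -h mulfK.
have -> : c i * c j = - (c i ^+ 2 * (A * B) / A ^+ 2) by rewrite hj; field.
have c2 : 0 < c i ^+ 2 by rewrite exprn_even_gt0 //= c0.
have A2 : 0 < A ^+ 2 by rewrite exprn_even_gt0.
by rewrite oppr_lt0 divr_gt0 // mulr_gt0.
Qed.

Lemma moments_sign c : moments_vanish c -> (forall l, c l != 0) ->
  forall i : 'I_p.+1, (-1) ^+ i * c i = Num.sg (c ord0) * `|c i|.
Proof.
move=> hc c0 i.
suff h n (hn : (n < p.+1)%N) : Num.sg (c (Ordinal hn)) = (-1) ^+ n * Num.sg (c ord0).
  have hi : Num.sg (c i) = (-1) ^+ i * Num.sg (c ord0).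
    by rewrite -(h i (ltn_ord i)); congr (Num.sg (c _)); apply: val_inj.
  rewrite [c i in LHS]numEsg hi mulrA mulrA -exprD addnn -mul2n mulnC exprM.
  by rewrite sqrr_sign mul1r.
elim: n hn => [|n IHn] hn.
  by rewrite expr0 mul1r; congr (Num.sg (c _)); apply: val_inj.
have hn' : (n < p.+1)%N := ltnW hn.
have := moments_alternate (i := Ordinal hn') (j := Ordinal hn) hc c0 erefl.
rewrite -sgr_cp0 sgrM => /eqP h; rewrite exprS -mulrA -(IHn hn').
by move: h; rewrite mulN1r; case: sgrP; case: sgrP => _ _ h; lra.
Qed.

(* The moment conditions have a one-dimensional solution space whose members
   alternate in sign, so absolute values determine the solution. *)
Lemma pure_ratio_moments (b : 'I_p.+1 -> rat) z : (forall i, 0 <= b i) ->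
  moments_vanish (fun i => (-1) ^+ i * b i) <-> forall i, b i = b z * pure_ratio z i.
Proof.
move=> b0; split=> [h i|h].
  have := moments_ratio z i h; rewrite !normrM !normrX normrN1 !expr1n !mul1r.
  by rewrite !ger0_norm.
have [c [hc [j cj]]] := moments_solution.
have c0 l := moments_neq0 l hc cj.
(* The scalar taking the alternating solution [c] to [(-1) ^+ i * b i]: absolute values agree at
   [z], and [Num.sg (c ord0)] corrects the sign. *)
pose m : rat := b z / `|c z| * Num.sg (c ord0).
have hb (i : 'I_p.+1) : (-1) ^+ i * b i = m * c i.
  rewrite h.
  have -> : c i = (-1) ^+ i * ((-1) ^+ i * c i) by rewrite mulrA -expr2 sqrr_sign mul1r.
  rewrite (moments_sign hc c0) (moments_ratio z i hc) /m.
  have hz : `|c z| != 0 by rewrite normr_eq0.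
  have hs : Num.sg (c ord0) ^+ 2 = 1 by rewrite sqr_sg c0.
  by rewrite -[LHS]mulr1 -hs; field.
move=> l hl; under eq_bigr do rewrite hb -mulrA.
by rewrite -mulr_sumr hc ?mulr0.
Qed.

End PureMoments.

Lemma is_pdim_pdim (R : nzRingType) (M : lmodType R) n : is_pdim M n -> pdim M = n.
Proof.
move=> [h1 h2]; rewrite /pdim; case: xgetP => [m -> [h1' h2']|/(_ n) []] //.
by apply/eqP; rewrite eqn_leq h2' // h2.
Qed.

(** * The minimal resolution of a pure module *)

Section PureResolution.
Variables (k : fieldType) (R : comAlgType k) (gR : nat -> {pred R}).
Hypothesis hR : standard_graded gR.
Variables (M : lmodType R) (gM : int -> {pred M}) (hM : graded_module gR gM).

Lemma minimal_image_proper (F : free_resolution gR gM) i : minimal_resolution F ->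
  (forall v : 'rV[R]_(rk F i), exists w, v = w *m diff F i) -> rk F i = 0%N.
Proof.
move=> hF h; apply/eqP; rewrite -leqn0 leqNgt; apply/negP => hr; pose a := Ordinal hr.
have [w /rowP/(_ a)] := h (delta_mx 0 a); rewrite !mxE !eqxx /= => h1.
apply: (irrelevant1 hR); have -> : (1 : R) = \sum_j w 0 j * diff F i j a by exact: h1.
apply: (submodset_sum (E := R^o)) => [|l _]; first exact: irrelevant_submod.
by apply: (submodsetZ (E := R^o)); [exact: irrelevant_submod|exact: hF].
Qed.

(** Irrelevant homogeneous entries of degree at most 0 are zero. If the whole differential were
    zero, exactness would make the next one map onto [F_(i+1)], which minimality forbids. *)
Lemma minimal_shift_lt (F : free_resolution gR gM) i (s s' : int) : minimal_resolution F ->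
  (forall a, shift (f := F) (i := i) a = s) -> (forall a, shift (f := F) (i := i.+1) a = s') ->
  (0 < rk F i.+1)%N -> s < s'.
Proof.
move=> hF hs hs' hr; rewrite ltNge; apply/negP => hss.
suff h0 : rk F i.+1 = 0%N by rewrite h0 in hr.
apply: minimal_image_proper => // v; apply/diff_exact.
suff -> : diff F i = 0 by rewrite mulmx0.
apply/matrixP => a b; rewrite mxE.
have h := diff_homogeneous (f := F) a b; rewrite hs hs' in h.
have := (irrelevantP hR _).1 (hF i a b).
have [e|ne] := eqVneq s' s; first by rewrite (rc_hom hR _ h) e subrr eqxx.
move=> _; rewrite -((rcP hR _ _).2 h) rc_neg //.
by rewrite subr_lt0 lt_def eq_sym ne.
Qed.

Lemma minimal_module_neq0 (F : free_resolution gR gM) : minimal_resolution F ->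
  (0 < rk F 0)%N -> exists m : M, m <> 0.
Proof.
move=> hF hr; apply: contrapT => h.
suff h0 : rk F 0 = 0%N by rewrite h0 in hr.
apply: minimal_image_proper => // v; apply/aug_exact.
by apply: contrapT => hv; apply: h; exists (\sum_b v 0 b *: aug b).
Qed.

Lemma pure_minimal_resolution p (d : 'I_p.+1 -> int) : fin_gen M -> pure_of_type gR gM d ->
  exists F : free_resolution gR gM,
    [/\ minimal_resolution F, forall (i : 'I_p.+1) (a : 'I_(rk F i)), shift a = d i,
        forall i, (i <= p)%N -> (0 < rk F i)%N & forall i, (p < i)%N -> rk F i = 0%N].
Proof.
move=> fgM [hpure [hp _] hb]; have [F hF] := minimal_resolution_ex hR hM fgM.
have hs (i : 'I_p.+1) (a : 'I_(rk F i)) : shift a = d i.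
  by apply: (hpure i) => //; apply: minimal_betti_shift.
exists F; split=> // [i hi|]; last exact: minimal_resolution_length hF hp.
have := hb (Ordinal (hi : (i < p.+1)%N)).
rewrite (minimal_betti_const hR hM (F := F) hF (hs (Ordinal (hi : (i < p.+1)%N)))).
by rewrite lt0n => /eqP.
Qed.

End PureResolution.

Theorem theorem2p9 (k : fieldType) (k_inf : infinite_set [set: k])
    (R : comAlgType k) (gR : nat -> {pred R}) (hR : standard_graded gR)
    (M : lmodType R) (gM : int -> {pred M}) (hM : graded_module gR gM)
    (fgM : fin_gen M)
    (p : nat) (d : 'I_p.+1 -> int) (hd : pure_of_type gR gM d) :
  [<-> cmd gR M = cmd gR R^o;
       codim M = (pdim M)%:Z;
       forall l : nat, (l < p)%N ->
         \sum_(i < p.+1) (-1) ^+ i * d i ^+ l * (betti gR gM i (d i))%:Z = 0;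
       forall (i : 'I_p.+1) (j : int),
         (betti gR gM i j)%:R = (total_betti gR gM 0)%:R * pure_diagram d i j;
       forall (i : 'I_p.+1) (j : int),
         (betti gR gM i j)%:R = (total_betti gR gM p)%:R * pure_diagram' d i j].
Proof.
have [F [hF hs r0 rhigh]] := pure_minimal_resolution hR hM fgM hd.
have hpd : pdim M = p by case: hd => _ h _; apply: is_pdim_pdim.
have AB := auslander_buchsbaum k_inf hR hF (r0 0%N isT) (r0 p (leqnn p)) rhigh.
have bE (i : 'I_p.+1) : betti gR gM i (d i) = rk F i.
  exact: (minimal_betti_const hR hM hF (hs i)).
have tE i : total_betti gR gM i = rk F i := minimal_total_betti hR hM i hF.
have b0E (i : 'I_p.+1) j : j != d i -> betti gR gM i j = 0%N.
  by move=> hj; apply: (minimal_betti_neq hR hM hF) => a; rewrite hs => h; rewrite h eqxx in hj.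
(* [d] is extended to all naturals, with junk values above [p], to allow induction on unbounded
   indices. *)
pose dn i : int := d (inord i).
have dnE (i : 'I_p.+1) : dn i = d i by rewrite /dn inord_val.
have dn_lt i : (i < p)%N -> dn i < dn i.+1.
  move=> hi; have hi1 : (i < p.+1)%N := ltnW hi.
  apply: (minimal_shift_lt hR (F := F) (i := i)) => // [a|a|].
  - by rewrite (hs (Ordinal hi1)) -dnE.
  - by rewrite (hs (Ordinal (hi : (i.+1 < p.+1)%N))) -dnE.
  - exact: r0.
have dn_mono i j : (i < j <= p)%N -> dn i < dn j.
  elim: j => [|j IHj] /andP [hij hj] //.
  apply: (le_lt_trans _ (dn_lt j hj)); move: hij; rewrite ltnS leq_eqVlt => /orP [/eqP -> //|hij].
  by apply/ltW/IHj; rewrite hij ltnW.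
have dn_ge i : (i <= p)%N -> dn 0%N <= dn i.
  by case: i => // i hi; apply/ltW/dn_mono.
(* Degrees are normalised to start at 0, since [kdim_difference] takes natural degrees; a twist of
   [M] does not affect its dimension. *)
pose e i := `|dn i - dn 0%N|%N.
have eE i : (i <= p)%N -> (e i)%:Z = dn i - dn 0%N.
  by move=> hi; rewrite /e gez0_abs // subr_ge0 dn_ge.
have e_mono i : (i < p)%N -> (e i <= e i.+1)%N.
  by move=> hi; have := dn_lt i hi; have := eE i (ltnW hi); have := eE _ hi; lia.
have diff_deg i (a : 'I_(rk F i.+1)) (b : 'I_(rk F i)) : (i < p)%N ->
    diff F i a b \in gR (e i.+1 - e i)%N.
  move=> hi; have h := diff_homogeneous (f := F) a b.
  have hi1 : (i < p.+1)%N := ltnW hi.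
  rewrite (hs (Ordinal hi1)) (hs (Ordinal (hi : (i.+1 < p.+1)%N))) -!dnE /= in h.
  have -> : gR (e i.+1 - e i)%N = zgrade gR (e i.+1 - e i)%N%:Z by [].
  suff -> : (e i.+1 - e i)%N%:Z = dn i.+1 - dn i by [].
  by have := e_mono i hi; have := eE i (ltnW hi); have := eE _ hi; lia.
have e0 : e 0%N = 0%N by rewrite /e subrr.
have M0 := minimal_module_neq0 hR hF (r0 0%N isT).
have kdimE := kdim_difference hR hM (F := F) (p := p) (e := e) e0 e_mono diff_deg rhigh M0.
pose x (i : 'I_p.+1) : rat := (d i)%:~R.
have x_incr (i j : 'I_p.+1) : (i < j)%N -> x i < x j.
  by move=> hij; rewrite ltr_int -!dnE; apply: dn_mono; rewrite hij -ltnS ltn_ord.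
have x_inj : injective x.
  by move=> i j hij; apply: val_inj => /=; case: (ltngtP i j) => // /x_incr; rewrite hij ltxx.
pose b (i : 'I_p.+1) : rat := (rk F i)%:R.
have b_ge0 i : 0 <= b i by apply: ler0n.
pose c (i : 'I_p.+1) := (-1) ^+ i * b i.
have c_neq0 i : c i != 0.
  by rewrite mulf_neq0 ?signr_eq0 // pnatr_eq0 -lt0n r0 // -ltnS.
have e_x (i : 'I_p.+1) : - (e i)%:R = x ord0 + -1 * x i :> rat.
  have hi : (i <= p)%N by rewrite -ltnS.
  have d0 : dn 0%N = d ord0 := dnE ord0.
  by rewrite pmulrn eE // rmorphB /= dnE d0 opprB mulN1r.
have mom_int l : \sum_(i < p.+1) (-1) ^+ i * d i ^+ l * (betti gR gM i (d i))%:Z = 0 <->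
    \sum_i c i * x i ^+ l = 0.
  have -> : \sum_i c i * x i ^+ l =
      (\sum_(i < p.+1) (-1) ^+ i * d i ^+ l * (betti gR gM i (d i))%:Z)%:~R.
    rewrite rmorph_sum; apply: eq_bigr => i _; rewrite bE !rmorphM !rmorphXn /= rmorphN1.
    by rewrite /c /b /x mulrAC.
  by split=> [->|/eqP]; rewrite ?rmorph0 // intr_eq0 => /eqP.
have mom_e n : (forall l, (l < n)%N -> \sum_i c i * x i ^+ l = 0) <->
    (forall l, (l < n)%N -> alternating_moment F p e l = 0).
  split=> h l hl.
    rewrite /alternating_moment -[RHS](moments_affine (x := x) (x ord0) (-1) h hl).
    by apply: eq_bigr => i _; rewrite e_x.
  pose y (i : 'I_p.+1) : rat := - (e i)%:R.
  have hy : forall l, (l < n)%N -> \sum_i c i * y i ^+ l = 0 by exact: h.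
  rewrite -[RHS](moments_affine (x := y) (x ord0) (-1) hy hl); apply: eq_bigr => i _.
  by congr (_ * _ ^+ _); rewrite /y e_x; ring.
(* The codimension is the least [m] with a nonzero moment and [moments_top] gives [m <= p], so it
   equals [p] exactly when all moments below [p] vanish. *)
have codimE : codim M = p%:Z <-> moments_vanish x c.
  have ex_l : exists l, alternating_moment F p e l != 0.
    apply: contrapT => h; have [l [hl /eqP]] := moments_top x_inj (c_neq0 ord0).
    apply; apply: (mom_e p.+1).2 => // l' _; apply/eqP/negPn/negP => h'.
    by apply: h; exists l'.
  case: (ex_minnP ex_l) => m hm hmin.
  have hlt l : (l < m)%N -> alternating_moment F p e l = 0.
    by move=> hl; apply/eqP/negPn/negP => /hmin; rewrite leqNgt hl.
  have hmp : (m <= p)%N.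
    rewrite leqNgt; apply/negP => hmp.
    have [l [hl /eqP]] := moments_top x_inj (c_neq0 ord0); apply.
    by apply: (mom_e m).2 => //; apply: leq_ltn_trans hmp.
  have hc : codim M = m%:Z.
    by rewrite /codim (kdimE _ hlt hm) PoszD addrC addKr.
  rewrite hc; split=> [[h]|h].
    by apply/(mom_e p).2 => l hl; apply: hlt; rewrite h.
  congr Posz; apply/eqP; rewrite eqn_leq hmp leqNgt; apply/negP => hm'.
  by move: hm; rewrite ((mom_e p).1 h) ?eqxx.
have iii : (forall l, (l < p)%N ->
    \sum_(i < p.+1) (-1) ^+ i * d i ^+ l * (betti gR gM i (d i))%:Z = 0) <-> moments_vanish x c.
  by split=> h l hl; apply/mom_int/h.
(* Both diagrams are instances: [z] is the position whose Betti number sets the scale, the first for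
   [pure_diagram] and the last for [pure_diagram']. *)
have diagram z (D : 'I_p.+1 -> int -> rat) :
    (forall i j, D i j = if j == d i then pure_ratio x z i else 0) ->
    moments_vanish x c <-> forall (i : 'I_p.+1) j, (betti gR gM i j)%:R = b z * D i j.
  move=> hD; have h := pure_ratio_moments x_inj x_incr z b_ge0.
  split=> [/h hb i j|hb].
    rewrite hD; case: eqP => [->|/eqP hj]; first by rewrite bE -hb.
    by rewrite b0E // mulr0.
  by apply/h => i; have := hb i (d i); rewrite bE hD eqxx.
have ratioE z i : pure_ratio x z i = \prod_(l < p.+1 | (l != i) && (l != z))
    `|(d l - d z)%:~R / (d l - d i)%:~R|.
  by apply: eq_bigr => l _; rewrite !rmorphB.
have iv : moments_vanish x c <-> forall (i : 'I_p.+1) (j : int),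
    (betti gR gM i j)%:R = (total_betti gR gM 0)%:R * pure_diagram d i j.
  by rewrite tE; apply: (diagram ord0) => i j; rewrite /pure_diagram ratioE.
have v : moments_vanish x c <-> forall (i : 'I_p.+1) (j : int),
    (betti gR gM i j)%:R = (total_betti gR gM p)%:R * pure_diagram' d i j.
  by rewrite tE; apply: (diagram ord_max) => i j; rewrite /pure_diagram' ratioE.
(* The cycle closes from (v) to (i): since the depth of [R] exceeds that of [M] by [p], equal [cmd]
   and codimension [p] are the same linear condition. *)
tfae.
- rewrite /cmd /codim hpd AB; move: (kdim M) (kdim R^o) (depth gR M) => u w t h; lia.
- by rewrite hpd => /codimE/iii.
- by move/iii/iv.
- by move/iv/v.
- move/v/codimE; rewrite /cmd /codim AB; move: (kdim M) (kdim R^o) (depth gR M) => u w t h; lia.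
Qed.
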